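(* There exists a constant $C>0$ such that, for every $B\in\mathbb{R}$ with $|B|\le C$, $$\left.\frac{\partial\lambda_1^B(\Omega_a)}{\partial a}\right|_{a=1}=0\qquad\text{and}\qquad\left.\frac{\partial^2\lambda_1^B(\Omega_a)}{\partial a^2}\right|_{a=1}>0.$$
   Context: For $a>0$ let $\Omega_a:=\left(-\frac a2,\frac a2\right)\times\left(-\frac1{2a},\frac1{2a}\right)\subset\mathbb{R}^2$. For $B\in\mathbb{R}$, $\lambda_1^B(\Omega_a)$ denotes the lowest eigenvalue of the magnetic Dirichlet Laplacian $(-i\nabla-A)^2$ on $\Omega_a$ with constant magnetic field $\operatorname{curl}A=\partial_1A_2-\partial_2A_1=B$, i.e. of the self-adjoint operator in $L^2(\Omega_a)$ (complex-valued functions) associated with the quadratic form $u\mapsto\|(\partial_1-iA_1)u\|_{L^2(\Omega_a)}^2+\|(\partial_2-iA_2)u\|_{L^2(\Omega_a)}^2$ with domain $W_0^{1,2}(\Omega_a)$; it does not depend on the choice of smooth $A:\overline{\Omega_a}\to\mathbb{R}^2$ with $\operatorname{curl}A=B$, and one may take $A(x)=\big(-\theta x_2,(1-\theta)x_1\big)B$ for any $\theta\in\mathbb{R}$. The assertion includes the existence of the two derivatives. *)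

(* Defs.v *)
From HB Require Import structures.
From mathcomp Require Import all_boot all_order all_algebra.
From mathcomp Require Import complex.
From mathcomp Require Import all_classical all_reals all_analysis.
From mathcomp Require Import ring.

Set Implicit Arguments.
Unset Strict Implicit.
Unset Printing Implicit Defensive.

Import Order.TTheory GRing.Theory Num.Theory numFieldNormedType.Exports.

Local Open Scope classical_set_scope.
Local Open Scope ring_scope.
Local Open Scope complex_scope.

Notation mu2 R :=
  (product_measure1 (@lebesgue_measure R) (@lebesgue_measure R)).

Section Calculus.
Context {R : realType}.
Implicit Types (Omega : set (R * R)) (f : R * R -> R) (u v g : R * R -> R[i]).

Definition e1 : R * R := (1, 0).
Definition e2 : R * R := (0, 1).

Fixpoint Ck (k : nat) f : Prop :=
  continuous f /\
  if k is k'.+1 then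
    [/\ forall p, derivable f p e1, forall p, derivable f p e2,
        Ck k' (fun p => 'D_e1 f p) & Ck k' (fun p => 'D_e2 f p)]
  else True.

Definition smooth f : Prop := forall k, Ck k f.

(* Elements of C_c^oo(Omega; C), extended by 0 to the whole plane. *)
Definition test_function Omega u : Prop :=
  [/\ smooth (fun p => complex.Re (u p)), smooth (fun p => complex.Im (u p)),
      compact (closure [set p | u p != 0]) &
      closure [set p | u p != 0] `<=` Omega].

Definition partial (e : R * R) u : R * R -> R[i] := fun p =>
  'D_e (fun q => complex.Re (u q)) p +i* 'D_e (fun q => complex.Im (u q)) p.

Definition cintegral Omega u : R[i] :=
  Rintegral (mu2 R) Omega (fun p => complex.Re (u p)) +i*
  Rintegral (mu2 R) Omega (fun p => complex.Im (u p)).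

(* Linear in the first argument. *)
Definition L2inner Omega u v : R[i] :=
  cintegral Omega (fun p => u p * (v p)^*).

Definition L2sqnorm Omega u : \bar R :=
  (\int[mu2 R]_(p in Omega)
     (complex.Re (u p) ^+ 2 + complex.Im (u p) ^+ 2)%:E)%E.

Definition L2 Omega u : Prop :=
  [/\ measurable_fun Omega (fun p => complex.Re (u p)),
      measurable_fun Omega (fun p => complex.Im (u p)) &
      (L2sqnorm Omega u < +oo)%E].

Definition weak_partial Omega (e : R * R) u g : Prop :=
  forall phi, test_function Omega phi ->
    cintegral Omega (fun p => u p * partial e phi p) =
    - cintegral Omega (fun p => g p * phi p).

(* [W12 Omega u g1 g2]: u belongs to W^{1,2}(Omega), with weak gradient
   (g1, g2). As usual, functions are representatives of a.e.-classes. *)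
Definition W12 Omega u g1 g2 : Prop :=
  [/\ L2 Omega u, L2 Omega g1, L2 Omega g2,
      weak_partial Omega e1 u g1 & weak_partial Omega e2 u g2].

Definition W12sqnorm Omega u g1 g2 : \bar R :=
  (L2sqnorm Omega u + L2sqnorm Omega g1 + L2sqnorm Omega g2)%E.

(* [W012 Omega u g1 g2]: u belongs to the closure of C_c^oo(Omega) in
   W^{1,2}(Omega), and (g1, g2) is its weak gradient. *)
Definition W012 Omega u g1 g2 : Prop :=
  W12 Omega u g1 g2 /\
  forall eps : R, 0 < eps -> exists2 phi, test_function Omega phi &
    (W12sqnorm Omega (fun p => u p - phi p)%R
       (fun p => g1 p - partial e1 phi p)%R
       (fun p => g2 p - partial e2 phi p)%R < eps%:E)%E.

End Calculus.

Section MagneticLaplacian.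
Context {R : realType}.
Variables (A : R * R -> R * R) (Omega : set (R * R)).
Implicit Types u v f g h : R * R -> R[i].

Definition curl (p : R * R) : R :=
  'D_e1 (fun q => (A q).2) p - 'D_e2 (fun q => (A q).1) p.

(* (\partial_j - i A_j) u, the partial derivative of u being g. *)
Definition covariant1 u g : R * R -> R[i] :=
  fun p => g p - 'i%C * ((A p).1)%:C * u p.
Definition covariant2 u g : R * R -> R[i] :=
  fun p => g p - 'i%C * ((A p).2)%:C * u p.

(* The sesquilinear form polarizing
   ||(\partial_1 - i A_1) u||^2 + ||(\partial_2 - i A_2) u||^2. *)
Definition magnetic_form u g1 g2 v h1 h2 : R[i] :=
  L2inner Omega (covariant1 u g1) (covariant1 v h1) +
  L2inner Omega (covariant2 u g2) (covariant2 v h2).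

(* Graph of the operator H associated with the form: u belongs to the domain
   of H and H u = f. *)
Definition magnetic_laplacian u f : Prop :=
  L2 Omega f /\
  exists g1 g2, W012 Omega u g1 g2 /\
    forall v h1 h2, W012 Omega v h1 h2 ->
      magnetic_form u g1 g2 v h1 h2 = L2inner Omega f v.

(* H is self-adjoint, hence its eigenvalues are real. *)
Definition magnetic_eigenvalue (lambda : R) : Prop :=
  exists u, magnetic_laplacian u (fun p => lambda%:C * u p) /\
    ~ {ae mu2 R, forall p, Omega p -> u p = 0}.

Definition lowest_magnetic_eigenvalue (lambda : R) : Prop :=
  magnetic_eigenvalue lambda /\ forall nu, magnetic_eigenvalue nu -> lambda <= nu.

End MagneticLaplacian.

Section Rectangles.
Context {R : realType}.

Definition rectangle (a : R) : set (R * R) :=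
  `]- (a / 2), a / 2[ `*` `]- (1 / (2 * a)), 1 / (2 * a)[.

Definition constant_field_potential (B : R) : R * R -> R * R :=
  fun p => (- (B / 2) * p.2, B / 2 * p.1).

Let derive_affine (f : R * R -> R) (v p : R * R) (c : R) :
  (forall h, f (h *: v + p) - f p = h * c) -> 'D_v f p = c.
Proof.
move=> fE; apply: cvg_lim => //; apply: cvg_near_cst.
near=> h; rewrite /= fE /GRing.scale /= mulKf//.
by near: h; exact: nbhs_dnbhs_neq.
Unshelve. all: by end_near. Qed.

Lemma curl_constant_field_potential (B : R) (p : R * R) :
  curl (constant_field_potential B) p = B.
Proof.
rewrite /curl (@derive_affine _ e1 p (B / 2)); last first.
  by move=> h; rewrite /= /GRing.scale /=; ring.
rewrite (@derive_affine _ e2 p (- (B / 2))); last first.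
  by move=> h; rewrite /= /GRing.scale /=; ring.
by rewrite opprK -splitr.
Qed.

(* The number lambda_1^B(Omega_a), for a > 0; the gauge is the member
   theta = 1/2 of the family A(x) = B (- theta x_2, (1 - theta) x_1), all of
   which have curl B and yield the same eigenvalues. If there were no lowest
   eigenvalue, the value would be 0. *)
Definition lambda1 (B a : R) : R :=
  xget 0
    (lowest_magnetic_eigenvalue (constant_field_potential B) (rectangle a)).

End Rectangles.

(* Main.v *)
From HB Require Import structures.
Require Import Defs.
From mathcomp Require Import all_boot all_order all_algebra.
From mathcomp Require Import complex.
From mathcomp Require Import all_classical all_reals all_analysis.
From mathcomp Require Import measurable_realfun ring lra.

(** The dilation (x, y) -> (a x, y / a) maps the unit square onto the rectangle
    and preserves both the area and the flux of the field. It carries the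
    magnetic form of the rectangle to a^-2 t1 + a^2 t2 on the form domain of the
    square, where t1 and t2, the squared norms of the two covariant derivatives
    on the square, do not depend on a ([magnetic_form_pull], [W012_pull],
    [pull_W012]). The eigenvalue is thus the lowest one, L a, of a pencil of two
    forms on a fixed Hilbert space, which is treated as a real space with a
    complex structure J.

    Reflection in the diagonal followed by complex conjugation exchanges t1 and
    t2 ([t1V_SV], [t2V_SV]). Hence L (1 / a) = L a, and L is critical at 1. Let
    psi be the ground state at a = 1 and chi the derivative of the ground state
    with respect to a. As t1 and t2 agree on psi, differentiation of
    L' = (- 2 a^-3 t1 + 2 a t2)(psi_a, psi_a) / |psi_a|^2 gives

      L''(1) |psi|^2 = 8 t1(psi, psi) + 4 (t2 - t1)(psi, chi),

    where chi solves (t1 + t2 - L 1)(chi, v) = 2 (t1 - t2)(psi, v) for v in the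
    complement of the zero-field ground state w. At zero field
    w = 2 cos(pi x) cos(pi y), and the two directional energies of w agree
    against every v ([d1V_w], [d2V_w]), so that chi vanishes. In a small field
    the right-hand side is small and the spectral gap makes chi small, whereas
    8 t1(psi, psi) stays at least 2 |psi|^2 ([second_gt0]). This is the abstract
    theorem [pencil_regular]. It includes the existence of the ground states
    ([ground_state_exists]), by the Riesz lemma on the complement of w, and the
    differentiability of L and of psi_a, by comparing the eigenvalue equations
    at two values of a.

    The form domain W_0^{1,2} of the square is realized as the closure of the
    test functions, jointly with their gradients, in L2; it is complete by the
    theorem of Riesz and Fischer ([sqi_complete]). Inequalities between bounded
    forms need only be verified on test functions ([dense_form_ge0]). The
    spectral gap of the square reduces to the inequality
    (u(x) k(y) - u(y) k(x))^2 <= int u'^2 - pi^2 int u^2 with k = cos(pi x),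
    valid for u vanishing at the endpoints of the unit interval ([deficit1P]):
    integrated over pairs of points of the square it yields [gap2]. That w
    belongs to the form domain is shown by cutting it off with explicit bump
    functions ([W0_wX]). *)

Set Implicit Arguments.
Unset Strict Implicit.
Unset Printing Implicit Defensive.

Import Order.TTheory GRing.Theory Num.Theory numFieldNormedType.Exports.

Local Open Scope classical_set_scope.
Local Open Scope ring_scope.

(** * Quadratic forms and the Riesz lemma *)

Section Forms.
Context {R : realType} {V : lmodType R}.
Implicit Types (q d : V -> V -> R) (u v : V).

Definition symbil q : Prop :=
  (forall u v, q u v = q v u) /\
  (forall a u v x, q (a *: u + v) x = a * q u x + q v x).

Section SymBil.
Variable q : V -> V -> R.
Hypothesis Hq : symbil q.

Lemma symbilC u v : q u v = q v u. Proof. exact: Hq.1. Qed.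
Lemma symbil0l v : q 0 v = 0.
Proof. by have := Hq.2 (-1) 0 0 v; rewrite scaler0 add0r mulN1r addNr. Qed.
Lemma symbilDl u v x : q (u + v) x = q u x + q v x.
Proof. by have := Hq.2 1 u v x; rewrite scale1r mul1r. Qed.
Lemma symbilZl a u x : q (a *: u) x = a * q u x.
Proof. by have := Hq.2 a u 0 x; rewrite addr0 symbil0l addr0. Qed.
Lemma symbilNl u x : q (- u) x = - q u x.
Proof. by rewrite -scaleN1r symbilZl mulN1r. Qed.
Lemma symbilDr u v x : q x (u + v) = q x u + q x v.
Proof. by rewrite symbilC symbilDl !(symbilC x). Qed.
Lemma symbilZr a u x : q x (a *: u) = a * q x u.
Proof. by rewrite symbilC symbilZl (symbilC x). Qed.
Lemma symbilNr u x : q x (- u) = - q x u.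
Proof. by rewrite symbilC symbilNl (symbilC x). Qed.
Definition symbilE :=
  (symbilDl, symbilDr, symbilZl, symbilZr, symbilNl, symbilNr).

Hypothesis q_ge0 : forall u, 0 <= q u u.

Lemma cauchy_schwarz u v : `|q u v| <= Num.sqrt (q u u) * Num.sqrt (q v v).
Proof.
rewrite -sqrtrM// -sqrtr_sqr ler_wsqrtr//.
have [v0|v0] := eqVneq (q v v) 0.
  rewrite v0 mulr0; have [->|B0] := eqVneq (q u v) 0; first by rewrite expr0n.
  have := q_ge0 (u + (- ((q u u + 1) / q u v)) *: v).
  rewrite !symbilE v0 (symbilC v u) !mulr0 addr0 mulNr divfK//.
  by have := q_ge0 u; lra.
have v1 : 0 < q v v by rewrite lt_def v0 q_ge0.
have := q_ge0 (u + (- (q u v / q v v)) *: v).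
rewrite !symbilE (symbilC v u) => h.
have : 0 <= (q u u - q u v ^+ 2 / q v v) * q v v.
  apply: mulr_ge0; last exact: ltW.
  by apply: le_trans h _; rewrite le_eqVlt; apply/orP; left; apply/eqP; field.
by rewrite mulrBl divfK// subr_ge0.
Qed.

End SymBil.

Lemma symbil_comb q1 q2 (a b : R) : symbil q1 -> symbil q2 ->
  symbil (fun u v => a * q1 u v + b * q2 u v).
Proof.
move=> h1 h2; split=> [u v|c u v x].
  by rewrite (symbilC h1) (symbilC h2).
by rewrite !(symbilE h1) !(symbilE h2); ring.
Qed.

Definition nrm d u : R := Num.sqrt (d u u).

Definition bounded_by d q (M : R) : Prop :=
  forall u v, `|q u v| <= M * (nrm d u * nrm d v).

Definition cvg_to_in d (x : nat -> V) (l : V) : Prop :=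
  forall e, 0 < e -> exists N, forall i, (N <= i)%N -> nrm d (x i - l) < e.

Definition cauchy_in d (x : nat -> V) : Prop :=
  forall e, 0 < e -> exists N, forall i j, (N <= i)%N -> (N <= j)%N ->
    nrm d (x i - x j) < e.

Definition complete_form d : Prop :=
  forall x, cauchy_in d x -> exists l, cvg_to_in d x l.

Definition subspace (P : V -> Prop) : Prop :=
  P 0 /\ (forall a u v, P u -> P v -> P (a *: u + v)).

Definition closed_in d (P : V -> Prop) : Prop :=
  forall x l, (forall i, P (x i)) -> cvg_to_in d x l -> P l.

Lemma nrm_ge0 d u : 0 <= nrm d u. Proof. exact: sqrtr_ge0. Qed.

Lemma nrm_sqr d u : 0 <= d u u -> nrm d u ^+ 2 = d u u.
Proof. by move=> h; rewrite sqr_sqrtr. Qed.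

Lemma le_of_sqr_le (x b : R) : 0 <= x -> 0 <= b -> x ^+ 2 <= b * x -> x <= b.
Proof.
move=> x0 b0; rewrite expr2; have [->//|xn0] := eqVneq x 0.
by rewrite ler_pM2r// lt_def xn0.
Qed.

Section Riesz.
Variables (d Q : V -> V -> R) (P : V -> Prop) (l : V -> R) (kappa M K : R).

Hypothesis d_ge0 : forall u, 0 <= d u u.
Hypothesis d_complete : complete_form d.
Hypothesis Psub : subspace P.
Hypothesis Pclosed : closed_in d P.
Hypothesis HQ : symbil Q.
Hypothesis kappa0 : 0 < kappa.
Hypothesis Qcoer : forall u, P u -> kappa * d u u <= Q u u.
Hypothesis Qbnd : bounded_by d Q M.
Hypothesis l_lin : forall a u v, l (a *: u + v) = a * l u + l v.
Hypothesis l_bnd : forall v, `|l v| <= K * nrm d v.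

Let J u := Q u u - 2 * l u.

Let PD u v : P u -> P v -> P (u + v).
Proof. by move=> pu pv; rewrite -[u]scale1r; exact: Psub.2. Qed.
Let PZ a u : P u -> P (a *: u).
Proof. by move=> pu; rewrite -[_ *: _]addr0; apply: Psub.2 => //; exact: Psub.1. Qed.
Let PB u v : P u -> P v -> P (u - v).
Proof. by move=> pu pv; rewrite addrC -scaleN1r; exact: Psub.2. Qed.

Let l0 : l 0 = 0.
Proof. by have := l_lin (-1) 0 0; rewrite scaler0 add0r mulN1r addNr. Qed.
Let lD u v : l (u + v) = l u + l v.
Proof. by have := l_lin 1 u v; rewrite scale1r mul1r. Qed.
Let lZ a u : l (a *: u) = a * l u.
Proof. by have := l_lin a u 0; rewrite addr0 l0 addr0. Qed.

Let J_lbnd u : P u -> - (K ^+ 2 / kappa) <= J u.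
Proof.
move=> pu; rewrite /J; have h1 := Qcoer pu; have := l_bnd u.
move/(le_trans (ler_norm _)); rewrite -(nrm_sqr (d_ge0 u)) in h1.
set n := nrm d u in h1 *; move=> h2.
have : 0 <= (kappa * n - K) ^+ 2 / kappa by rewrite divr_ge0 ?sqr_ge0// ltW.
have -> : (kappa * n - K) ^+ 2 / kappa = kappa * n ^+ 2 - 2 * (K * n) + K ^+ 2 / kappa.
  by field; rewrite gt_eqF.
by lra.
Qed.

Let E := [set J u | u in [set u | P u]].
Let Einf : has_inf E.
Proof.
split; first by exists (J 0), 0 => //=; exact: Psub.1.
by exists (- (K ^+ 2 / kappa)) => _ [u /= pu <-]; exact: J_lbnd.
Qed.
Let j := inf E.

Let j_le u : P u -> j <= J u.
Proof. by move=> pu; apply: ge_inf; [exact: Einf.2|exists u]. Qed.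

Let near_min e : 0 < e -> exists u, P u /\ J u < j + e.
Proof.
move=> e0; have [_ [u /= pu <-] h] := inf_adherent e0 Einf.
by exists u.
Qed.

Let near_min_cauchy u v e : 0 < e -> P u -> P v ->
  J u < j + e -> J v < j + e -> kappa * d (u - v) (u - v) <= 4 * e.
Proof.
move=> e0 pu pv hu hv; apply: (le_trans (Qcoer (PB pu pv))).
have := j_le (PZ (1 / 2) (PD pu pv)).
move: hu hv; rewrite /J !(symbilE HQ) lZ lD (symbilC HQ v u).
set a := Q u u; set b := Q v v; set c := Q u v; set x := l u; set y := l v.
move=> hu hv h.
have : j <= (1/4) * (a + b + 2 * c) - (x + y).
  by apply: le_trans h _; rewrite le_eqVlt; apply/orP; left; apply/eqP; field.
by lra.
Qed.

(** The first-order condition in quantitative form: an almost minimizer cannot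
    be improved along v by more than e, and the best step along v gains the
    square of the residual divided by Q v v. *)
Let near_min_crit u v e : 0 < e -> P u -> P v -> J u < j + e ->
  (Q u v - l v) ^+ 2 <= e * Q v v.
Proof.
move=> e0 pu pv hu.
have Qv0 : 0 <= Q v v.
  by apply: le_trans (Qcoer pv); rewrite mulr_ge0// ltW.
have h s : 0 <= e + 2 * s * (Q u v - l v) + s ^+ 2 * Q v v.
  have := j_le (PD pu (PZ s pv)); move: hu.
  rewrite /J !(symbilE HQ) lD lZ (symbilC HQ v u); nra.
move: h; set B := Q u v - l v; set A := Q v v => h.
have [A0|A0] := eqVneq A 0.
  rewrite A0 mulr0; have [->|B0] := eqVneq B 0; first by rewrite expr0n.
  have := h (- e / B); rewrite A0 mulr0 addr0.
  by rewrite (_ : 2 * (- e / B) * B = - (2 * e)); [lra|field].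
have A1 : 0 < A by rewrite lt_def A0.
have := h (- B / A).
have -> : e + 2 * (- B / A) * B + (- B / A) ^+ 2 * A = (e * A - B ^+ 2) / A.
  by field.
by rewrite pmulr_lge0 ?invr_gt0// subr_ge0.
Qed.

(** Existence by minimizing Q u u - 2 l u over P: coercivity and the
    parallelogram identity make every minimizing sequence Cauchy. P is a
    predicate rather than a type, as it will be an orthogonal complement. *)
Lemma riesz : exists chi, P chi /\ forall v, P v -> Q chi v = l v.
Proof.
have e0 n : 0 < (n.+1%:R : R)^-1 by rewrite invr_gt0 ltr0n.
have /choice[x hx] : forall n, exists u, P u /\ J u < j + n.+1%:R^-1.
  by move=> n; exact: near_min.
have small e : 0 < e -> exists N, forall i, (N <= i)%N -> (i.+1%:R : R)^-1 < e.
  move=> e1; exists (Num.truncn e^-1) => i Ni.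
  rewrite -[e]invrK ltf_pV2 ?posrE ?invr_gt0 ?ltr0n//.
  apply: lt_le_trans (truncnS_gt _) _; by rewrite ler_nat.
have xc : cauchy_in d x.
  move=> e e1.
  have [N hN] := small (kappa * e ^+ 2 / 5) ltac:(by rewrite divr_gt0// mulr_gt0// exprn_gt0).
  exists N => i k Ni Nk.
  have [pi hi] := hx i; have [pk hk] := hx k.
  set E0 := kappa * e ^+ 2 / 5 in hN.
  have E1 : 0 < E0 by apply: lt_trans (hN _ Ni).
  have h := near_min_cauchy E1 pi pk (lt_trans hi _) (lt_trans hk _).
  rewrite -(ger0_norm (nrm_ge0 _ _)) -[ltRHS]ger0_norm ?ltW// -ltr_sqr ?nnegrE//.
  rewrite ger0_norm ?nrm_ge0// ger0_norm ?ltW// nrm_sqr//.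
  rewrite -(ltr_pM2l kappa0); apply: le_lt_trans (h _ _) _.
  - by rewrite ltrD2l hN.
  - by rewrite ltrD2l hN.
  have : 0 < kappa * e ^+ 2 by rewrite mulr_gt0// exprn_gt0.
  by rewrite /E0; lra.
have [chi hchi] := d_complete xc.
have pchi : P chi by apply: (Pclosed _ hchi) => i; exact: (hx i).1.
exists chi; split => // v pv.
apply/eqP; rewrite -subr_eq0 -normr_le0; apply/ler_addgt0Pl => e e1; rewrite addr0.
have Qv0 : 0 <= Q v v.
  by apply: le_trans (Qcoer pv); rewrite mulr_ge0// ltW.
set n := nrm d v.
have [N1 hN1] := small (e ^+ 2 / (4 * (Q v v + 1))) ltac:(by
  rewrite divr_gt0 ?exprn_gt0// mulr_gt0//; lra).
have M0 : 0 <= `|M| * n by rewrite mulr_ge0// nrm_ge0.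
have [N2 hN2] := hchi (e / (2 * (`|M| * n + 1))) ltac:(by
  rewrite divr_gt0// mulr_gt0//; lra).
set i := maxn N1 N2.
have [pi hi] := hx i.
have h1 := near_min_crit (e0 i) pi pv hi.
have h2 := hN1 i (leq_maxl _ _); have h3 := hN2 i (leq_maxr _ _).
have -> : Q chi v - l v = (Q (x i) v - l v) - Q (x i - chi) v.
  by rewrite !(symbilE HQ); ring.
apply: le_trans (ler_normB _ _) _.
have H1 : `|Q (x i) v - l v| <= e / 2.
  have e20 : 0 <= e / 2 by lra.
  rewrite -ler_sqr ?nnegrE// real_normK ?num_real//.
  apply: (le_trans h1); apply: (@le_trans _ _ (e ^+ 2 / (4 * (Q v v + 1)) * Q v v)).
    by rewrite ler_wpM2r// ltW.
  rewrite -mulrA mulrC -mulrA.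
  have : (4 * (Q v v + 1))^-1 * Q v v <= 1 / 4.
    rewrite mulrC ler_pdivrMr; [lra|]; lra.
  have : 0 <= e ^+ 2 by exact: sqr_ge0.
  by rewrite [(e / 2) ^+ 2]exprMn exprVn; nra.
have H2 : `|Q (x i - chi) v| <= e / 2.
  apply: le_trans (Qbnd _ _) _.
  apply: (@le_trans _ _ ((e / (2 * (`|M| * n + 1))) * (`|M| * n))).
    rewrite mulrCA; apply: (@le_trans _ _ (nrm d (x i - chi) * (`|M| * n))).
      by rewrite ler_wpM2l ?nrm_ge0// ler_wpM2r ?nrm_ge0// ler_norm.
    by rewrite ler_wpM2r// ltW.
  rewrite mulrAC ler_pdivrMr; last by lra.
  by nra.
by lra.
Qed.

End Riesz.

(** * Ground states of perturbed forms *)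

Lemma subspaceB P u v : subspace P -> P u -> P v -> P (u - v).
Proof. by move=> Ps pu pv; rewrite addrC -scaleN1r; exact: Ps.2. Qed.
Lemma subspaceZ P a u : subspace P -> P u -> P (a *: u).
Proof. by move=> Ps pu; rewrite -[_ *: _]addr0; apply: Ps.2 => //; exact: Ps.1. Qed.

Definition cplx_struct (J : V -> V) : Prop :=
  (forall a u v, J (a *: u + v) = a *: J u + J v) /\ (forall u, J (J u) = - u).
Definition preserves (J : V -> V) q : Prop := forall u v, q (J u) (J v) = q u v.

Lemma preserves_skew J q u v : symbil q -> cplx_struct J -> preserves J q ->
  q (J u) v = - q u (J v).
Proof.
move=> Hq [_ JJ] HJ; rewrite -(HJ (J u) v) JJ (symbilNl Hq).
by [].
Qed.
Lemma preserves_diag J q u : symbil q -> cplx_struct J -> preserves J q ->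
  q u (J u) = 0.
Proof.
move=> Hq HJ Pq; have := preserves_skew u u Hq HJ Pq.
rewrite (symbilC Hq (J u)) => h; lra.
Qed.

(** The situation without magnetic field: d is the energy, m the L2 form, J the
    multiplication by i, w the ground state with eigenvalue mu, and c a lower
    bound for the distance from mu to the rest of the spectrum. Orthogonality
    to w over the complex numbers amounts to the two real conditions
    m u w = 0 and m u (J w) = 0. *)
Record unperturbed d m (J : V -> V) (w : V) (mu c : R) : Prop := Unperturbed {
  up_d : symbil d;
  up_d0 : forall u, 0 <= d u u;
  up_complete : complete_form d;
  up_m : symbil m;
  up_m0 : forall u, 0 <= m u u;
  up_md : forall u, m u u <= d u u;
  up_J : cplx_struct J;
  up_mJ : preserves J m;
  up_ww : m w w = 1;
  up_dw : forall v, d w v = mu * m w v;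
  up_mu : 0 < mu;
  up_c : 0 < c;
  up_gap : forall u, m u w = 0 -> m u (J w) = 0 -> (mu + c) * m u u <= d u u
}.

Section Ground.
Variables (d m : V -> V -> R) (J : V -> V) (w : V) (mu c : R).
Hypothesis U : unperturbed d m J w mu c.
Let Hd := up_d U. Let d0 := up_d0 U. Let Hm := up_m U. Let m0 := up_m0 U.
Let HJ := up_J U. Let c0 := up_c U. Let mu0 := up_mu U.

Definition orth u : Prop := m u w = 0 /\ m u (J w) = 0.

Lemma nrm_le_m u : nrm m u <= nrm d u.
Proof. by rewrite ler_sqrt//; exact: up_md U u. Qed.

Lemma m_bounded : bounded_by d m 1.
Proof.
move=> u v; rewrite mul1r; apply: (le_trans (cauchy_schwarz Hm m0 u v)).
by apply: ler_pM; rewrite ?sqrtr_ge0//; exact: nrm_le_m.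
Qed.
Lemma d_bounded : bounded_by d d 1.
Proof. by move=> u v; rewrite mul1r; exact: cauchy_schwarz. Qed.

Lemma orth_subspace : subspace orth.
Proof.
split; first by rewrite /orth !(symbil0l Hm).
by move=> a u v [u1 u2] [v1 v2]; rewrite /orth !(symbilE Hm) u1 u2 v1 v2 !mulr0 !addr0.
Qed.

Lemma limit_kernel x l v : (forall i, m (x i) v = 0) -> cvg_to_in d x l -> m l v = 0.
Proof.
move=> h hl; apply/eqP; rewrite -normr_le0; apply/ler_addgt0Pl => e e0; rewrite addr0.
have n0 := nrm_ge0 d v.
have [N hN] := hl (e / (nrm d v + 1)) ltac:(by rewrite divr_gt0//; lra).
have := hN N (leqnn _); have := m_bounded (x N - l) v.
rewrite !(symbilE Hm) h add0r normrN mul1r => h1 h2.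
apply: (le_trans h1); apply: (@le_trans _ _ (e / (nrm d v + 1) * nrm d v)).
  by rewrite ler_wpM2r// ltW.
rewrite mulrAC ler_pdivrMr; last by lra.
by nra.
Qed.

Lemma orth_closed : closed_in d orth.
Proof.
move=> x l h hl; split.
  by apply: (limit_kernel _ hl) => i; exact: (h i).1.
by apply: (limit_kernel _ hl) => i; exact: (h i).2.
Qed.

Lemma orthJ u : orth u -> orth (J u).
Proof.
move=> [h1 h2]; split; last by rewrite (up_mJ U).
by rewrite (preserves_skew _ _ Hm HJ (up_mJ U)) h2 oppr0.
Qed.

Lemma m_w_Jw : m w (J w) = 0.
Proof. by rewrite (preserves_diag w Hm HJ (up_mJ U)). Qed.

Variables (q : V -> V -> R) (theta : R).
Hypothesis Hq : symbil q.
Hypothesis qJ : preserves J q.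
Hypothesis theta0 : 0 <= theta.
Hypothesis theta_small : theta * (2 * (2 * mu + c)) <= c.
Hypothesis q_near : bounded_by d (fun u v => q u v - d u v) theta.

Definition kappa0 := c / (2 * (mu + c)).

Lemma kappa0_gt0 : 0 < kappa0.
Proof. by rewrite divr_gt0// mulr_gt0//; have := c0; have := mu0; lra. Qed.

Lemma theta_lt1 : 2 * theta < 1.
Proof. have := c0; have := mu0; have := theta0; have := theta_small; nra. Qed.

Lemma q_lbound u : (1 - theta) * d u u <= q u u.
Proof.
have := q_near u u; rewrite -expr2 nrm_sqr// ler_norml => /andP[h _]; lra.
Qed.
Lemma q_ubound u : q u u <= (1 + theta) * d u u.
Proof.
have := q_near u u; rewrite -expr2 nrm_sqr// ler_norml => /andP[_ h]; lra.
Qed.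

(** The gap survives a perturbation of relative size theta. On the complement
    m <= d / (mu + c), so q - lam m is at least
    ((1 - theta) - (1 + theta) mu / (mu + c)) d, and the coefficient is
    (c - theta (2 mu + c)) / (mu + c). *)
Lemma coercive_of_le lam : lam <= (1 + theta) * mu -> forall r, orth r ->
  kappa0 * d r r <= q r r - lam * m r r.
Proof.
move=> hl r [r1 r2]; have g := up_gap U r1 r2; have h := q_lbound r.
have mr := m0 r; have dr := d0 r.
set D := d r r in g h dr *; set M := m r r in g mr *; set q1 := q r r in h *.
have C := c0; have MU := mu0.
have h1 : lam * M <= (1 + theta) * mu * M by rewrite ler_wpM2r.
have h2 : (1 + theta) * mu * M * (mu + c) <= (1 + theta) * mu * D.
  rewrite -mulrA [M * _]mulrC ler_wpM2l// mulr_ge0//; last exact: ltW.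
  by have := theta0; lra.
suff : kappa0 * D * (mu + c) <= ((1 - theta) * D - lam * M) * (mu + c).
  rewrite ler_pM2r; last by lra.
  lra.
have -> : kappa0 * D * (mu + c) = c / 2 * D.
  by rewrite /kappa0; field; rewrite gt_eqF//; lra.
have h3 : lam * M * (mu + c) <= (1 + theta) * mu * D.
  by apply: le_trans h2; rewrite ler_wpM2r//; lra.
have : 0 <= (c / 2 - theta * (2 * mu + c)) * D.
  by rewrite mulr_ge0//; have := theta_small; lra.
lra.
Qed.

(** The vectors whose component along the complex line of w is w itself; the
    infimum of the Rayleigh quotient over them is the lowest eigenvalue. *)
Let A0 u := m u w = 1 /\ m u (J w) = 0.
Let A0w : A0 w. Proof. by split; [exact: up_ww U|exact: m_w_Jw]. Qed.
Let A0_m u : A0 u -> 1 <= m u u.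
Proof.
move=> [h1 h2]; have := cauchy_schwarz Hm m0 u w.
rewrite h1 (up_ww U) sqrtr1 mulr1 normr1 => h.
have := @ler_sqr R 1 (Num.sqrt (m u u)); rewrite !nnegrE ler01 sqrtr_ge0 => /(_ isT isT).
by rewrite h sqr_sqrtr// expr1n => ->.
Qed.

Let E := [set q u u / m u u | u in [set u | A0 u]].
Let Einf : has_inf E.
Proof.
split; first by exists (q w w / m w w), w.
exists 0 => _ [u /= /A0_m hu <-]; rewrite divr_ge0//.
by apply: le_trans (q_lbound u); rewrite mulr_ge0//; have := theta_lt1; have := theta0; lra.
Qed.
Let lam := inf E.

Let lam_le u : A0 u -> lam * m u u <= q u u.
Proof.
move=> hu; have mu1 := A0_m hu.
rewrite -ler_pdivlMr; last by lra.
by apply: ge_inf; [exact: Einf.2|exists u].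
Qed.

Let lam_ub : lam <= (1 + theta) * mu.
Proof.
have := lam_le A0w; rewrite (up_ww U) mulr1 => /le_trans; apply.
by apply: le_trans (q_ubound w) _; rewrite (up_dw U) (up_ww U) mulr1.
Qed.

Let lam_ge0 : 0 <= lam.
Proof.
apply: lb_le_inf => [|_ [u /= /A0_m hu <-]]; first exact: Einf.1.
rewrite divr_ge0//.
by apply: le_trans (q_lbound u); rewrite mulr_ge0//; have := theta_lt1; have := theta0; lra.
Qed.

Let Q u v := q u v - lam * m u v.
Let HQ : symbil Q.
Proof.
split=> [u v|a u v x]; rewrite /Q; first by rewrite (symbilC Hq) (symbilC Hm).
by rewrite !(symbilE Hq) !(symbilE Hm); ring.
Qed.
Let QJ : preserves J Q.
Proof. by move=> u v; rewrite /Q qJ (up_mJ U). Qed.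
Let Qbnd : bounded_by d Q (1 + theta + lam).
Proof.
move=> u v.
have -> : Q u v = (q u v - d u v) + d u v - lam * m u v by rewrite /Q; ring.
apply: le_trans (ler_normB _ _) _; rewrite normrM (ger0_norm lam_ge0).
apply: le_trans (lerD (ler_normD _ _) (lexx _)) _.
have := q_near u v; have := d_bounded u v; have := m_bounded u v.
have := ler_wpM2l lam_ge0 (m_bounded u v).
lra.
Qed.

Let split_orth psi u : A0 psi ->
  orth (u - (m u w *: psi + m u (J w) *: J psi)).
Proof.
move=> [p1 p2]; have p3 : m (J psi) w = 0.
  by rewrite (preserves_skew _ _ Hm HJ (up_mJ U)) p2 oppr0.
split; rewrite !(symbilE Hm); first by rewrite p1 p3; ring.
by rewrite p2 (up_mJ U) p1; ring.
Qed.

(** Prescribing the products with w and J w fixes both the size and the phase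
    of psi. Differences of ground states of different forms then lie in the
    complement of w, where the forms are coercive. *)
Record ground_state (l : R) psi : Prop := GroundState {
  gs_norm : m psi w = 1;
  gs_phase : m psi (J w) = 0;
  gs_eig : forall v, q psi v = l * m psi v;
  gs_min : forall u, l * m u u <= q u u;
  gs_ub : l <= (1 + theta) * mu;
  gs_ge0 : 0 <= l;
  gs_near : kappa0 * nrm d (psi - w) <= theta * nrm d w
}.

(** The Riesz lemma on the complement corrects w to psi = w + r such that
    q - lam m vanishes on (psi, v) for v in the complement. It also vanishes on
    (psi, psi), since otherwise a larger lam would still bound the Rayleigh
    quotient from below, and on (psi, J w) by invariance under J. *)
Lemma ground_state_exists : exists l psi, ground_state l psi.
Proof.
have K0 := kappa0_gt0.
have l_lin a u v : - Q w (a *: u + v) = a * (- Q w u) + - Q w v.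
  by rewrite !(symbilE HQ); ring.
have l_bnd v : `| - Q w v| <= (1 + theta + lam) * nrm d w * nrm d v.
  by rewrite normrN -mulrA; exact: Qbnd.
have [r [pr hr]] := riesz d0 (up_complete U) orth_subspace orth_closed HQ K0
  (coercive_of_le lam_ub) Qbnd l_lin l_bnd.
have [psi psiE] : exists psi, psi = w + r by exists (w + r).
have Qpsi v : orth v -> Q psi v = 0.
  by move=> pv; rewrite psiE !(symbilE HQ) hr// addrN.
have Apsi : A0 psi.
  split; rewrite psiE !(symbilE Hm); first by rewrite pr.1 (up_ww U) addr0.
  by rewrite pr.2 m_w_Jw addr0.
have Qnneg r' : orth r' -> 0 <= Q r' r'.
  by move=> /(coercive_of_le lam_ub); apply: le_trans; rewrite mulr_ge0// ltW.
(* if the value at psi were positive, lam + eta would be a lower bound *)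
have F0 : Q psi psi = 0.
  apply/eqP; rewrite eq_le; apply/andP; split; last first.
    by rewrite /Q subr_ge0; exact: lam_le.
  rewrite leNgt; apply/negP => F0.
  have mp := A0_m Apsi.
  pose eta := Num.min (Q psi psi / (2 * m psi psi)) (kappa0 / 2).
  have eta0 : 0 < eta.
    rewrite lt_min; apply/andP; split; last by rewrite divr_gt0.
    by rewrite divr_gt0//; lra.
  have : lam + eta <= lam.
    apply: lb_le_inf => [|_ [u /= hu <-]]; first exact: Einf.1.
    have mu1 := A0_m hu.
    rewrite ler_pdivlMr; last by lra.
    have [s sE] : exists s, s = u - psi by exists (u - psi).
    have ps : orth s.
      split; rewrite sE !(symbilE Hm); first by rewrite hu.1 Apsi.1 subrr.
      by rewrite hu.2 Apsi.2 subrr.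
    have us : u = psi + s by rewrite sE addrC subrK.
    have : eta * m u u <= Q u u.
      rewrite {3 4}us !(symbilE HQ) (symbilC HQ s psi) (Qpsi _ ps).
      have h1 := coercive_of_le lam_ub ps; rewrite -/(Q s s) in h1.
      have h2 : m u u <= 2 * m psi psi + 2 * m s s.
        have := m0 (psi - s); rewrite us !(symbilE Hm) (symbilC Hm s psi); lra.
      have h3 : eta * (2 * m psi psi) <= Q psi psi.
        rewrite -ler_pdivlMr; last by lra.
        by rewrite ge_min lexx.
      have h4 : eta * (2 * m s s) <= kappa0 * m s s.
        rewrite mulrA ler_wpM2r// -ler_pdivlMr//.
        by rewrite ge_min lexx orbT.
      have h5 : kappa0 * m s s <= kappa0 * d s s.
        by rewrite ler_wpM2l ?(up_md U)// ltW.
      have h6 := ler_wpM2l (ltW eta0) h2.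
      lra.
    by rewrite /Q; lra.
  lra.
have Qpsi0 v : Q psi v = 0.
  have [p pE] : exists p, p = v - (m v w *: w + m v (J w) *: J w) by eexists.
  have hp := split_orth v A0w; rewrite -pE in hp.
  have -> : v = (m v w *: w + m v (J w) *: J w) + p by rewrite pE addrC subrK.
  rewrite !(symbilE HQ) (Qpsi _ hp) addr0.
  have h1 : Q psi w = 0.
    have -> : Q psi w = Q psi (psi - r) by rewrite psiE addrK.
    by rewrite !(symbilE HQ) F0 (Qpsi _ pr) subrr.
  have h2 : Q psi (J w) = 0.
    have -> : J w = J psi - J r.
      by rewrite psiE -[w + r]addrC -[r]scale1r HJ.1 !scale1r addrC addKr.
    by rewrite !(symbilE HQ) (Qpsi _ (orthJ pr)) (preserves_diag psi HQ HJ QJ) subrr.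
  by rewrite h1 h2 !mulr0 addr0.
have QJpsi0 v : Q (J psi) v = 0.
  by rewrite (preserves_skew _ _ HQ HJ QJ) Qpsi0 oppr0.
exists lam, psi; split => //.
- exact: Apsi.1.
- exact: Apsi.2.
- by move=> v; have := Qpsi0 v; rewrite /Q => h; lra.
- move=> u; suff : 0 <= Q u u by rewrite /Q; lra.
  have [p pE] : exists p, p = u - (m u w *: psi + m u (J w) *: J psi) by eexists.
  have hp := split_orth u Apsi; rewrite -pE in hp.
  have -> : u = (m u w *: psi + m u (J w) *: J psi) + p by rewrite pE addrC subrK.
  rewrite !(symbilE HQ) !Qpsi0 !QJpsi0 (symbilC HQ p) Qpsi0 (symbilC HQ p) QJpsi0.
  by rewrite !mulr0 !add0r; exact: Qnneg.
- rewrite psiE addrC addKr; apply: le_of_sqr_le.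
  + by rewrite mulr_ge0 ?nrm_ge0// ltW.
  + by rewrite mulr_ge0 ?nrm_ge0.
  rewrite exprMn nrm_sqr// expr2 -mulrA.
  rewrite mulrCA ler_pM2l//.
  apply: le_trans (coercive_of_le lam_ub pr) _.
  have -> : q r r - lam * m r r = - (q w r - d w r).
    have : Q r r = - Q w r by rewrite hr.
    rewrite /Q (up_dw U) (symbilC Hm w) pr.1; lra.
  apply: le_trans (ler_norm _) _; rewrite normrN -mulrA; exact: q_near.
Qed.

Lemma gs_coercive l psi : ground_state l psi -> forall r, orth r ->
  kappa0 * d r r <= q r r - l * m r r.
Proof. by move=> g; apply: coercive_of_le; exact: gs_ub g. Qed.

Lemma gs_m_ge1 l psi : ground_state l psi -> 1 <= m psi psi.
Proof. by move=> g; apply: A0_m; split; [exact: gs_norm g|exact: gs_phase g]. Qed.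

Lemma nrm_triangle u v : nrm d (u + v) <= nrm d u + nrm d v.
Proof.
have [u0 v0] := (nrm_ge0 d u, nrm_ge0 d v).
rewrite -ler_sqr ?nnegrE ?addr_ge0 ?nrm_ge0//.
rewrite nrm_sqr// sqrrD !nrm_sqr// !(symbilE Hd) (symbilC Hd v u).
have := le_trans (ler_norm _) (d_bounded u v); rewrite mul1r -mulr_natr; lra.
Qed.

Lemma theta_le_kappa : theta <= kappa0.
Proof.
have := c0; have := mu0; have := theta_small => h1 h2 h3.
rewrite /kappa0 ler_pdivlMr; last by rewrite mulr_gt0//; lra.
have : 0 <= theta * (2 * mu) by rewrite mulr_ge0//; lra.
lra.
Qed.

Lemma gs_nrm_le l psi : ground_state l psi -> nrm d psi <= 2 * nrm d w.
Proof.
move=> g; have K0 := kappa0_gt0.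
have h : nrm d (psi - w) <= nrm d w.
  rewrite -(ler_pM2l K0); apply: le_trans (gs_near g) _.
  by rewrite ler_wpM2r ?nrm_ge0// theta_le_kappa.
rewrite -[psi](subrK w); apply: le_trans (nrm_triangle _ _) _; lra.
Qed.

End Ground.
End Forms.

(** * Differentiability of the lowest eigenvalue of a pencil *)

Section Scalar.
Context {R : realType}.

(** The estimates on forms below come as algebraic second-order error bounds;
    this turns them into derivatives. *)
Lemma is_derive_quadratic (f : R -> R) (a l C delta : R) : 0 < delta ->
  (forall b, `|b - a| <= delta -> `|f b - f a - (b - a) * l| <= C * (b - a) ^+ 2) ->
  is_derive a 1 f l.
Proof.
move=> delta0 h.
suff H : (fun t => t^-1 *: ((f \o shift a) (t *: (1 : R)) - f a)) @ 0^' --> l.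
  apply: DeriveDef; first by apply/cvg_ex; exists l.
  exact: cvg_lim.
apply/cvgrPdist_lt => e e0.
have C0 : 0 < `|C| + 1 by rewrite ltr_wpDl.
near=> t.
have t0 : t != 0 by near: t; exact: nbhs_dnbhs_neq.
have td : `|t| < delta by near: t; apply: dnbhs0_lt.
have te : `|t| < e / (`|C| + 1) by near: t; apply: dnbhs0_lt; rewrite divr_gt0.
have tn : 0 < `|t| by rewrite normr_gt0.
rewrite /= /GRing.scale /= mulr1 distrC.
have := h (t + a); rewrite addrK => /(_ (ltW td)).
have -> : t^-1 * (f (t + a) - f a) - l = t^-1 * (f (t + a) - f a - t * l) by field.
rewrite normrM normfV => h1; rewrite mulrC ltr_pdivrMr//.
apply: (le_lt_trans h1); have -> : t ^+ 2 = `|t| * `|t| by rewrite -expr2 real_normK ?num_real.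
rewrite mulrA ltr_pM2r//.
apply: (@le_lt_trans _ _ (`|C| * `|t|)); first by rewrite ler_wpM2r// ler_norm.
have := te; rewrite ltr_pdivlMr// => h2.
have : 0 <= `|C| by []. nra.
Unshelve. all: by end_near. Qed.

Lemma inv_bounds (a : R) : `|a - 1| <= 1 / 2 -> [/\ 1/2 <= a, a <= 3/2, 0 <= a^-1 & a^-1 <= 2].
Proof.
rewrite ler_norml => /andP[h1 h2].
have a0 : 0 < a by lra.
split; [lra|lra|by rewrite invr_ge0; lra|].
rewrite -[a^-1]mul1r ler_pdivrMr//; lra.
Qed.

Lemma inv_sqr_lip (a b : R) : `|a - 1| <= 1/2 -> `|b - 1| <= 1/2 ->
  `|b ^- 2 - a ^- 2| <= 16 * `|b - a|.
Proof.
move=> /inv_bounds[a1 a2 a3 a4] /inv_bounds[b1 b2 b3 b4].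
have an0 : a != 0 by rewrite gt_eqF//; lra.
have bn0 : b != 0 by rewrite gt_eqF//; lra.
have -> : b ^- 2 - a ^- 2 = - (a^-1 * b^-1 * (a^-1 + b^-1)) * (b - a).
  by field; rewrite an0 bn0.
rewrite normrM ler_wpM2r// normrN ger0_norm ?mulr_ge0 ?addr_ge0//.
have : a^-1 * b^-1 <= 4 by rewrite (_ : 4 = 2 * 2); [exact: ler_pM|ring].
have : 0 <= a^-1 * b^-1 by exact: mulr_ge0.
nra.
Qed.

Lemma sqr_lip (a b : R) : `|a - 1| <= 1/2 -> `|b - 1| <= 1/2 ->
  `|b ^+ 2 - a ^+ 2| <= 3 * `|b - a|.
Proof.
move=> /inv_bounds[a1 a2 _ _] /inv_bounds[b1 b2 _ _].
have -> : b ^+ 2 - a ^+ 2 = (b + a) * (b - a) by ring.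
rewrite normrM ler_wpM2r// ger0_norm; lra.
Qed.

Lemma inv_sqr_taylor (a b : R) : `|a - 1| <= 1/2 -> `|b - 1| <= 1/2 ->
  `|b ^- 2 - a ^- 2 - (b - a) * (- 2 * a ^- 3)| <= 48 * (b - a) ^+ 2.
Proof.
move=> /inv_bounds[a1 a2 a3 a4] /inv_bounds[b1 b2 b3 b4].
have an0 : a != 0 by rewrite gt_eqF//; lra.
have bn0 : b != 0 by rewrite gt_eqF//; lra.
have -> : b ^- 2 - a ^- 2 - (b - a) * (- 2 * a ^- 3) =
   (a^-1 ^+ 2 * b^-1 ^+ 2 + 2 * (a^-1 ^+ 3 * b^-1)) * (b - a) ^+ 2.
  by field; rewrite an0 bn0.
have p k : 0 <= a^-1 ^+ k <= 2 ^+ k by rewrite exprn_ge0//= lerXn2r ?nnegrE.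
rewrite normrM [`|(b - a) ^+ 2|]ger0_norm ?sqr_ge0// ler_wpM2r ?sqr_ge0//.
have /andP[p1 p2] := p 2%N; have /andP[p3 p4] := p 3%N.
have q1 : 0 <= b^-1 ^+ 2 by exact: sqr_ge0.
have q2 : b^-1 ^+ 2 <= 2 ^+ 2 by rewrite lerXn2r ?nnegrE.
rewrite ger0_norm; last by rewrite addr_ge0 ?mulr_ge0.
have := ler_pM p1 q1 p2 q2; have := ler_pM p3 b3 p4 b4.
rewrite (_ : 2 ^+ 3 * 2 = 16 :> R); last by ring.
rewrite (_ : 2 ^+ 2 * 2 ^+ 2 = 16 :> R); last by ring.
lra.
Qed.

End Scalar.

Section Pencil.
Context {R : realType} {V : lmodType R}.
Variables (d1 d2 m : V -> V -> R) (J : V -> V) (w : V) (mu c : R).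
Let d u v := d1 u v + d2 u v.
Hypothesis U : unperturbed d m J w mu c.
Hypothesis Hd1 : symbil d1.
Hypothesis Hd2 : symbil d2.
Hypothesis d1_ge0 : forall u, 0 <= d1 u u.
Hypothesis d2_ge0 : forall u, 0 <= d2 u u.
Hypothesis d12w : forall v, d1 w v = d2 w v.

Let Hd := up_d U. Let d0 := up_d0 U. Let Hm := up_m U. Let m0 := up_m0 U.
Let HJ := up_J U. Let c0 := up_c U. Let mu0 := up_mu U.

(** The largest relative perturbation to which [coercive_of_le] applies. *)
Definition pencil_theta0 := c / (2 * (2 * mu + c)).
Let theta0 := pencil_theta0.
Let kappa := kappa0 mu c.

Variables (t1 t2 : V -> V -> R) (S : V -> V) (eps : R).
Hypothesis Ht1 : symbil t1.
Hypothesis Ht2 : symbil t2.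
Hypothesis t1J : preserves J t1.
Hypothesis t2J : preserves J t2.
Hypothesis eps_ge0 : 0 <= eps.
Hypothesis t1_near : bounded_by d (fun u v => t1 u v - d1 u v) eps.
Hypothesis t2_near : bounded_by d (fun u v => t2 u v - d2 u v) eps.
Hypothesis S_t1 : forall u, t1 (S u) (S u) = t2 u u.
Hypothesis S_t2 : forall u, t2 (S u) (S u) = t1 u u.
Hypothesis S_m : forall u, m (S u) (S u) = m u u.
Hypothesis eps_small : eps <= theta0 / 4.
Let beta := eps * (8 + 8 / kappa).
Hypothesis beta_small : beta ^+ 2 * mu < kappa.

Definition pencil (a : R) u v := a ^- 2 * t1 u v + a ^+ 2 * t2 u v.
Definition pencil' (a : R) u v := - 2 * a ^- 3 * t1 u v + 2 * a * t2 u v.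
(** Within this distance of 1 the coefficients move the form by at most half of
    pencil_theta0; the other half is left to eps. *)
Definition pencil_delta := Num.min (1 / 2) (theta0 / 80).
Let delta := pencil_delta.
Let theta (a : R) := 2 * eps + 40 * `|a - 1|.

Lemma theta0_gt0 : 0 < theta0.
Proof. by rewrite divr_gt0// mulr_gt0//; have := c0; have := mu0; lra. Qed.
Lemma theta0_lt : theta0 <= 1 / 2.
Proof.
have := c0; have := mu0 => h1 h2.
rewrite /theta0 /pencil_theta0 ler_pdivrMr; last by rewrite mulr_gt0//; lra.
lra.
Qed.
Lemma pencil_delta_gt0 : 0 < delta.
Proof.
rewrite lt_min; apply/andP; split; first by rewrite divr_gt0.
by apply: divr_gt0 => //; exact: theta0_gt0.
Qed.

Let dhalf a : `|a - 1| <= delta -> `|a - 1| <= 1/2.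
Proof. by rewrite le_min => /andP[]. Qed.
Let NN u v : 0 <= nrm d u * nrm d v.
Proof. by rewrite mulr_ge0 ?nrm_ge0. Qed.

Let d1_bnd : bounded_by d d1 1.
Proof.
move=> u v; rewrite mul1r; apply: (le_trans (cauchy_schwarz Hd1 d1_ge0 u v)).
by apply: ler_pM; rewrite ?sqrtr_ge0// ler_sqrt// lerDl.
Qed.
Let d2_bnd : bounded_by d d2 1.
Proof.
move=> u v; rewrite mul1r; apply: (le_trans (cauchy_schwarz Hd2 d2_ge0 u v)).
by apply: ler_pM; rewrite ?sqrtr_ge0// ler_sqrt// lerDr.
Qed.
Let eps1 : eps <= 1.
Proof. have := theta0_lt; have := eps_small; lra. Qed.
Let t1_bnd : bounded_by d t1 2.
Proof.
move=> u v; have -> : t1 u v = (t1 u v - d1 u v) + d1 u v by ring.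
apply: le_trans (ler_normD _ _) _.
have := t1_near u v; have := d1_bnd u v; have := NN u v; have := eps1; nra.
Qed.
Let t2_bnd : bounded_by d t2 2.
Proof.
move=> u v; have -> : t2 u v = (t2 u v - d2 u v) + d2 u v by ring.
apply: le_trans (ler_normD _ _) _.
have := t2_near u v; have := d2_bnd u v; have := NN u v; have := eps1; nra.
Qed.

Lemma pencil_symbil a : symbil (pencil a). Proof. exact: symbil_comb. Qed.
Lemma pencil'_symbil a : symbil (pencil' a). Proof. exact: symbil_comb. Qed.
Lemma pencil_J a : preserves J (pencil a).
Proof. by move=> u v; rewrite /pencil t1J t2J. Qed.

Let comb_bnd x y u v : `|x * t1 u v + y * t2 u v| <= (`|x| + `|y|) * 2 * (nrm d u * nrm d v).
Proof.
apply: le_trans (ler_normD _ _) _; rewrite !normrM.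
have := ler_wpM2l (normr_ge0 x) (t1_bnd u v).
have := ler_wpM2l (normr_ge0 y) (t2_bnd u v).
lra.
Qed.

(** In this and the next two estimates the constants come from [inv_sqr_lip],
    [sqr_lip] and [inv_sqr_taylor], doubled because t1 and t2 are bounded
    by 2 d. *)
Lemma pencil_near a : `|a - 1| <= delta ->
  bounded_by d (fun u v => pencil a u v - d u v) (theta a).
Proof.
move=> /dhalf h u v.
have h1 : `|1 - 1 : R| <= 1/2 by rewrite subrr normr0.
have -> : pencil a u v - d u v = (t1 u v - d1 u v) + (t2 u v - d2 u v) +
   ((a ^- 2 - 1 ^- 2) * t1 u v + (a ^+ 2 - 1 ^+ 2) * t2 u v).
  by rewrite /pencil /d !expr1n invr1; ring.
apply: le_trans (ler_normD _ _) _.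
apply: le_trans (lerD (ler_normD _ _) (comb_bnd _ _ _ _)) _.
have := inv_sqr_lip h1 h; have := sqr_lip h1 h.
move: (`|a ^- 2 - 1 ^- 2|) (`|a ^+ 2 - 1 ^+ 2|) => x y hx hy.
have := t1_near u v; have := t2_near u v; have := NN u v.
rewrite /theta; set n := nrm d u * nrm d v => n0.
have : (x + y) * 2 * n <= 40 * `|a - 1| * n.
  by rewrite ler_wpM2r//; have : 0 <= `|a - 1| by []; lra.
lra.
Qed.

Lemma pencil_lip a b u v : `|a - 1| <= delta -> `|b - 1| <= delta ->
  `|pencil b u v - pencil a u v| <= 40 * `|b - a| * (nrm d u * nrm d v).
Proof.
move=> /dhalf ha /dhalf hb.
have -> : pencil b u v - pencil a u v =
   (b ^- 2 - a ^- 2) * t1 u v + (b ^+ 2 - a ^+ 2) * t2 u v by rewrite /pencil; ring.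
apply: le_trans (comb_bnd _ _ _ _) _; rewrite ler_wpM2r//.
have := inv_sqr_lip ha hb; have := sqr_lip ha hb; have : 0 <= `|b - a| by []; lra.
Qed.

Lemma pencil_taylor a b u v : `|a - 1| <= delta -> `|b - 1| <= delta ->
  `|pencil b u v - pencil a u v - (b - a) * pencil' a u v| <=
  98 * (b - a) ^+ 2 * (nrm d u * nrm d v).
Proof.
move=> /dhalf ha /dhalf hb.
have -> : pencil b u v - pencil a u v - (b - a) * pencil' a u v =
   (b ^- 2 - a ^- 2 - (b - a) * (- 2 * a ^- 3)) * t1 u v + (b - a) ^+ 2 * t2 u v.
  by rewrite /pencil /pencil'; ring.
apply: le_trans (comb_bnd _ _ _ _) _; rewrite ler_wpM2r//.
rewrite [`|(b - a) ^+ 2|]ger0_norm ?sqr_ge0//.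
have := inv_sqr_taylor ha hb; lra.
Qed.

Lemma pencil'_bnd a : `|a - 1| <= delta -> bounded_by d (pencil' a) 38.
Proof.
move=> /dhalf ha u v; apply: le_trans (comb_bnd _ _ _ _) _; rewrite ler_wpM2r//.
have [a1 a2 a3 a4] := inv_bounds ha.
have a5 : `|a ^- 3| <= 2 ^+ 3.
  by rewrite -exprVn ger0_norm ?exprn_ge0// lerXn2r ?nnegrE.
rewrite !normrM normrN (ger0_norm (ler0n _ 2)) (@ger0_norm _ a); last by lra.
have : (2 : R) ^+ 3 = 8 by ring.
lra.
Qed.

Let th_ge0 a : 0 <= theta a.
Proof. by rewrite addr_ge0// mulr_ge0. Qed.
Let th_small a : `|a - 1| <= delta -> theta a * (2 * (2 * mu + c)) <= c.
Proof.
rewrite le_min => /andP[_ h].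
have p : 0 < 2 * (2 * mu + c) by rewrite mulr_gt0//; have := c0; have := mu0; lra.
rewrite -ler_pdivlMr// -/pencil_theta0 -/theta0 /theta; have := eps_small; lra.
Qed.

Let gs a l psi := ground_state d m J w mu c (pencil a) (theta a) l psi.

Let exists_family : exists LP : R -> R * V, forall a, `|a - 1| <= delta -> gs a (LP a).1 (LP a).2.
Proof.
have /choice : forall a, exists lp : R * V, `|a - 1| <= delta -> gs a lp.1 lp.2.
  move=> a; have [h|h] := leP `|a - 1| delta; last by exists (0, 0) => h'; lra.
  have [l [psi g]] := ground_state_exists U (pencil_symbil a) (pencil_J a)
     (th_ge0 a) (th_small h) (pencil_near h).
  by exists (l, psi).
by move=> [LP h]; exists LP.
Qed.

Section Family.
Variable LP : R -> R * V.
Hypothesis HLP : forall a, `|a - 1| <= delta -> gs a (LP a).1 (LP a).2.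
Let L a := (LP a).1.
Let Psi a := (LP a).2.
Let W := nrm d w.
Let W0 : 0 <= W. Proof. exact: nrm_ge0. Qed.
Let D1 : `|1 - 1 : R| <= delta.
Proof. by rewrite subrr normr0 ltW// pencil_delta_gt0. Qed.

Let Lge0 a : `|a - 1| <= delta -> 0 <= L a.
Proof. by move=> /HLP g; exact: gs_ge0 g. Qed.
Let Psi_le a : `|a - 1| <= delta -> nrm d (Psi a) <= 2 * W.
Proof. by move=> h; exact: (gs_nrm_le U (th_ge0 a) (th_small h) (HLP h)). Qed.
Let mPsi a : `|a - 1| <= delta -> 1 <= m (Psi a) (Psi a).
Proof. by move=> h; exact: (gs_m_ge1 U (HLP h)). Qed.
Let Psi_eig a v : `|a - 1| <= delta -> pencil a (Psi a) v = L a * m (Psi a) v.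
Proof. by move=> /HLP g; exact: gs_eig g v. Qed.
Let kappa_gt0 : 0 < kappa. Proof. exact: kappa0_gt0 U. Qed.

Let m_bnd := m_bounded U.
Let mNN u v : `|m u v| <= nrm d u * nrm d v.
Proof. by have := m_bnd u v; rewrite mul1r. Qed.

(** By coercivity, a bound on the form at r that is linear in the norm of r
    bounds r itself. *)
Let coer_est a r K : `|a - 1| <= delta -> orth m J w r -> 0 <= K ->
  `|pencil a r r - L a * m r r| <= K * nrm d r -> nrm d r <= K / kappa.
Proof.
move=> ha pr K0 h; have := gs_coercive U (th_ge0 a) (th_small ha) (pencil_near ha) (HLP ha) pr.
rewrite -/kappa -/(L a) -(nrm_sqr (d0 r)) => h1.
apply: le_of_sqr_le; [exact: nrm_ge0|by rewrite divr_ge0// ltW|].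
rewrite mulrAC ler_pdivlMr// mulrC; apply: (le_trans h1).
exact: le_trans (ler_norm _) h.
Qed.

Let orthB a b : `|a - 1| <= delta -> `|b - 1| <= delta -> orth m J w (Psi b - Psi a).
Proof.
move=> /HLP ga /HLP gb; split; rewrite !(symbilE Hm).
  by rewrite (gs_norm ga) (gs_norm gb) subrr.
by rewrite (gs_phase ga) (gs_phase gb) subrr.
Qed.

Let CL := 160 * W ^+ 2.
Let CL0 : 0 <= CL. Proof. by rewrite mulr_ge0// sqr_ge0. Qed.

Let L_lip_half a b : `|a - 1| <= delta -> `|b - 1| <= delta ->
  L b - L a <= CL * `|b - a|.
Proof.
move=> ha hb; have := gs_min (HLP hb) (Psi a); rewrite -/(L b) => h1.
have h2 := Psi_eig (Psi a) ha; have h3 := pencil_lip (Psi a) (Psi a) ha hb.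
have h4 := Psi_le ha; have h5 := nrm_ge0 d (Psi a); have h6 := mPsi ha.
have : nrm d (Psi a) * nrm d (Psi a) <= 4 * W ^+ 2.
  by rewrite (_ : 4 * W ^+ 2 = (2 * W) * (2 * W)); [exact: ler_pM|ring].
move: h3; set n := nrm d _ * nrm d _ => h3 hn.
have h7 : 40 * `|b - a| * n <= CL * `|b - a|.
  rewrite /CL; have : 0 <= `|b - a| by []; nra.
have h8 := le_trans (ler_norm _) h3.
have h9 : (L b - L a) * m (Psi a) (Psi a) <= CL * `|b - a| by lra.
have [h10|h10] := leP (L b - L a) 0.
  by apply: (le_trans h10); rewrite mulr_ge0.
nra.
Qed.

Let L_lip a b : `|a - 1| <= delta -> `|b - 1| <= delta ->
  `|L b - L a| <= CL * `|b - a|.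
Proof.
move=> ha hb; rewrite ler_norml; have := L_lip_half ha hb; have := L_lip_half hb ha.
rewrite distrC => h1 h2; apply/andP; split; lra.
Qed.

Let CW0 : 0 <= (40 + CL) * (2 * W).
Proof. by apply: mulr_ge0; [exact: addr_ge0|exact: mulr_ge0]. Qed.
Let CP := (40 + CL) * (2 * W) / kappa.
Let CP0 : 0 <= CP.
Proof. by apply: divr_ge0 => //; exact: ltW. Qed.

(** On r = Psi b - Psi a the form at a is coercive, while the two eigenvalue
    equations reduce it to differences of forms and of eigenvalues. *)
Let Psi_lip a b : `|a - 1| <= delta -> `|b - 1| <= delta ->
  nrm d (Psi b - Psi a) <= CP * `|b - a|.
Proof.
move=> ha hb; have [r rE] : exists r, r = Psi b - Psi a by eexists.
have pr := orthB ha hb; rewrite -rE in pr *.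
have lin q : symbil q -> q r r = q (Psi b) r - q (Psi a) r.
  by move=> Hq; rewrite {1}rE (symbilDl Hq) (symbilNl Hq).
have -> : CP * `|b - a| = ((40 + CL) * (2 * W) * `|b - a|) / kappa by rewrite /CP; ring.
apply: (coer_est ha); [exact: pr|exact: mulr_ge0|].
have -> : pencil a r r - L a * m r r =
   (L b - L a) * m (Psi b) r - (pencil b (Psi b) r - pencil a (Psi b) r).
  rewrite (lin _ (pencil_symbil a)) (lin _ Hm).
  by rewrite (Psi_eig _ ha) (Psi_eig _ hb); ring.
apply: le_trans (ler_normB _ _) _; rewrite normrM.
have h1 := L_lip ha hb; have h2 := mNN (Psi b) r; have h3 := pencil_lip (Psi b) r ha hb.
have h4 := Psi_le hb; have n0 := nrm_ge0 d r; have p0 := nrm_ge0 d (Psi b).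
have h5 : `|L b - L a| * `|m (Psi b) r| <= CL * `|b - a| * (nrm d (Psi b) * nrm d r).
  by apply: ler_pM.
apply: (le_trans (lerD h5 h3)).
have h6 : nrm d (Psi b) * nrm d r <= 2 * W * nrm d r by exact: ler_wpM2r.
have h7 : 0 <= (40 + CL) * `|b - a| by apply: mulr_ge0 => //; exact: addr_ge0.
have := ler_wpM2l h7 h6; lra.
Qed.

Definition rayleigh' a := pencil' a (Psi a) (Psi a) / m (Psi a) (Psi a).

(** Each eigenvalue equation is tested with the other ground state. The identity
    gives the difference quotient of L without any expansion of Psi. *)
Let two_point a b : `|a - 1| <= delta -> `|b - 1| <= delta ->
  (L b - L a) * m (Psi a) (Psi b) = pencil b (Psi a) (Psi b) - pencil a (Psi a) (Psi b).
Proof.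
move=> ha hb; rewrite (Psi_eig _ ha) (symbilC (pencil_symbil b)) (Psi_eig _ hb).
by rewrite (symbilC Hm (Psi b)); ring.
Qed.

Let prod_le a x K : `|a - 1| <= delta -> nrm d x <= K ->
  nrm d (Psi a) * nrm d x <= 2 * W * K.
Proof. by move=> ha hx; apply: ler_pM; rewrite ?nrm_ge0//; exact: Psi_le. Qed.

(** The Feynman-Hellmann formula: L' is the Rayleigh quotient of the derivative
    of the form. *)
Let L_taylor : exists C, forall a b, `|a - 1| <= delta -> `|b - 1| <= delta ->
  `|L b - L a - (b - a) * rayleigh' a| <= C * (b - a) ^+ 2.
Proof.
exists (98 * (2 * W * (2 * W)) + 38 * (2 * W * CP) + CL * (2 * W * CP)) => a b ha hb.
have h6 := mPsi ha.
have P0 : 0 < m (Psi a) (Psi a) by lra.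
set X := L b - _ - _.
have : `|X * m (Psi a) (Psi a)| <=
   (98 * (2 * W * (2 * W)) + 38 * (2 * W * CP) + CL * (2 * W * CP)) * (b - a) ^+ 2.
  have -> : X * m (Psi a) (Psi a) =
    (pencil b (Psi a) (Psi b) - pencil a (Psi a) (Psi b) - (b - a) * pencil' a (Psi a) (Psi b))
    + (b - a) * pencil' a (Psi a) (Psi b - Psi a)
    - (L b - L a) * m (Psi a) (Psi b - Psi a).
    rewrite !(symbilE (pencil'_symbil a)) !(symbilE Hm) -(two_point ha hb) /X /rayleigh'.
    by field; rewrite gt_eqF.
  have e1 := pencil_taylor (Psi a) (Psi b) ha hb.
  have e2 := pencil'_bnd ha (Psi a) (Psi b - Psi a).
  have e3 := mNN (Psi a) (Psi b - Psi a).
  have e4 := prod_le ha (Psi_lip ha hb).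
  have e5 := prod_le ha (Psi_le hb).
  have e6 := L_lip ha hb.
  apply: le_trans (ler_normB _ _) _.
  apply: le_trans (lerD (ler_normD _ _) (lexx _)) _; rewrite !normrM.
  have s2 : (b - a) ^+ 2 = `|b - a| * `|b - a| by rewrite -expr2 real_normK ?num_real.
  rewrite [leRHS]mulrDl [X in _ <= X + _]mulrDl; apply: lerD; first apply: lerD.
  - by apply: (le_trans e1); rewrite mulrAC ler_wpM2r ?sqr_ge0// ler_wpM2l.
  - rewrite s2 (_ : 38 * (2 * W * CP) * (`|b - a| * `|b - a|) =
      `|b - a| * (38 * (2 * W * (CP * `|b - a|)))); last by ring.
    by rewrite ler_wpM2l//; apply: (le_trans e2); rewrite ler_wpM2l.
  - rewrite s2 (_ : CL * (2 * W * CP) * (`|b - a| * `|b - a|) =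
      (CL * `|b - a|) * (2 * W * (CP * `|b - a|))); last by ring.
    by apply: ler_pM => //; exact: le_trans e3 _.
rewrite normrM (gtr0_norm P0) => h; apply: le_trans h.
by rewrite ler_peMr.
Qed.

(** S turns the form at a into the form at 1/a. *)
Let sym a : `|a - 1| <= delta -> `|a^-1 - 1| <= delta -> L a^-1 = L a.
Proof.
have hal x : `|x - 1| <= delta -> `|x^-1 - 1| <= delta -> L x^-1 <= L x.
  move=> ha hb; have := gs_min (HLP hb) (S (Psi x)).
  rewrite -/(L _) S_m => h.
  have : pencil x^-1 (S (Psi x)) (S (Psi x)) = pencil x (Psi x) (Psi x).
    by rewrite /pencil S_t1 S_t2 exprVn invrK addrC.
  move=> h1; move: h; rewrite h1 Psi_eig// ler_pM2r//.
  by have := mPsi ha; lra.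
move=> ha hb; apply/eqP; rewrite eq_le hal//=.
by have := hal a^-1; rewrite invrK; apply.
Qed.

(** A differentiable function invariant under a -> 1/a is critical at 1; the
    Taylor bounds at 1 + h and 1 / (1 + h) are compared directly. *)
Let rayleigh'1 : rayleigh' 1 = 0.
Proof.
have [C hC] := L_taylor; set l := rayleigh' 1.
have dp := pencil_delta_gt0.
have C0 : 0 <= `|C| by [].
apply/eqP; rewrite -normr_le0; apply/ler_addgt0Pl => e e0; rewrite addr0.
pose h := Num.min (delta / 2) (e / (10 * (`|C| + 1))).
have h0 : 0 < h.
  rewrite lt_min; apply/andP; split; first by rewrite divr_gt0.
  by rewrite divr_gt0// mulr_gt0//; lra.
have hd : h <= delta / 2 by rewrite ge_min lexx.
have he : h * (10 * (`|C| + 1)) <= e.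
  rewrite -ler_pdivlMr; first by rewrite ge_min lexx orbT.
  by rewrite mulr_gt0//; lra.
have b1 : `|(1 + h) - 1| <= delta by rewrite [1 + h]addrC addrK ger0_norm//; lra.
pose y := (1 + h)^-1.
have y0 : 0 < y by rewrite invr_gt0; lra.
have y1 : y * (1 + h) = 1 by rewrite mulVf// gt_eqF//; lra.
have y2 : y <= 1 by nra.
have y3 : 1 - h <= y by nra.
have b2 : `|(1 + h)^-1 - 1| <= delta by rewrite -/y ler_norml; apply/andP; split; lra.
have := hC 1 (1 + h) D1 b1; have := hC 1 (1 + h)^-1 D1 b2.
rewrite (sym b1 b2) -/y -/l.
set X := L (1 + h) - L 1 => k2 k1.
have kh z : z ^+ 2 <= h ^+ 2 -> C * z ^+ 2 <= `|C| * h ^+ 2.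
  move=> hz; apply: (@le_trans _ _ (`|C| * z ^+ 2)).
    by rewrite ler_wpM2r ?sqr_ge0// ler_norm.
  by rewrite ler_wpM2l.
have k3 : `|(1 + h - y) * l| <= `|C| * h ^+ 2 + `|C| * h ^+ 2.
  have -> : (1 + h - y) * l = (X - (y - 1) * l) - (X - (1 + h - 1) * l) by ring.
  apply: le_trans (ler_normB _ _) _; apply: lerD.
    apply: (le_trans k2); apply: kh; rewrite -[X in X <= _]sqrrN lerXn2r ?nnegrE//; lra.
  by apply: (le_trans k1); apply: kh; rewrite [1 + h]addrC addrK.
have k4 : h * `|l| <= h * (2 * `|C| * h).
  apply: (@le_trans _ _ `|(1 + h - y) * l|); last by apply: (le_trans k3); nra.
  rewrite [leRHS]normrM ler_wpM2r// ger0_norm; lra.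
rewrite ler_pM2l// in k4; apply: (le_trans k4); nra.
Qed.

Let L_quad : exists C, forall b, `|b - 1| <= delta -> `|L b - L 1| <= C * (b - 1) ^+ 2.
Proof.
have [C hC] := L_taylor; exists C => b hb.
by have := hC 1 b D1 hb; rewrite rayleigh'1 mulr0 subr0.
Qed.

Let Q1 u v := pencil 1 u v - L 1 * m u v.
Let HQ1 : symbil Q1.
Proof.
split=> [u v|a u v x]; rewrite /Q1; first by rewrite (symbilC (pencil_symbil 1)) (symbilC Hm).
by rewrite !(symbilE (pencil_symbil 1)) !(symbilE Hm); ring.
Qed.
Let Q1_bnd : bounded_by d Q1 (4 + L 1).
Proof.
move=> u v; rewrite /Q1; apply: le_trans (ler_normB _ _) _.
have := comb_bnd (1 ^- 2) (1 ^+ 2) u v; rewrite -/(pencil 1 u v).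
rewrite [`|L 1 * _|]normrM (ger0_norm (Lge0 D1)) expr1n invr1 normr1.
have := ler_wpM2l (Lge0 D1) (mNN u v); lra.
Qed.
Let Q1_coer r : orth m J w r -> kappa * d r r <= Q1 r r.
Proof.
exact: (gs_coercive U (th_ge0 1) (th_small D1) (pencil_near D1) (HLP D1)).
Qed.

(** chi will be the derivative of Psi at 1: it solves the eigenvalue equation
    differentiated at 1, where the derivative of L drops out. *)
Let chi_exists : exists chi, orth m J w chi /\
  forall v, orth m J w v -> Q1 chi v = - pencil' 1 (Psi 1) v.
Proof.
apply: (@riesz _ _ d Q1 _ (fun v => - pencil' 1 (Psi 1) v) kappa (4 + L 1)
  (38 * nrm d (Psi 1))) => //.
- exact: up_complete U.
- exact: orth_subspace U.
- exact: orth_closed U.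
- by move=> a u v; rewrite !(symbilE (pencil'_symbil 1)); ring.
- by move=> v; rewrite normrN -mulrA; exact: pencil'_bnd.
Qed.

Section SecondDerivative.
Variable chi : V.
Hypothesis chi_orth : orth m J w chi.
Hypothesis chi_eq : forall v, orth m J w v -> Q1 chi v = - pencil' 1 (Psi 1) v.

(** The remainder lies in the complement and solves the differentiated equation
    up to second order. *)
Let Psi_taylor : exists C, 0 <= C /\ forall b, `|b - 1| <= delta ->
  nrm d (Psi b - Psi 1 - (b - 1) *: chi) <= C * (b - 1) ^+ 2.
Proof.
have [C hC] := L_quad.
have C0 : 0 <= `|C| by [].
pose K := 98 * (2 * W) + 38 * CP + `|C| * (2 * W).
have K0 : 0 <= K.
  have W2 : 0 <= 2 * W by exact: mulr_ge0.
  by apply: addr_ge0; [apply: addr_ge0|]; apply: mulr_ge0.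
exists (K / kappa); split=> [|b hb]; first by apply: divr_ge0 => //; exact: ltW.
rewrite mulrAC.
have [e eE] : exists e, e = Psi b - Psi 1 - (b - 1) *: chi by eexists.
have pe : orth m J w e.
  rewrite eE; apply: subspaceB; [exact: orth_subspace U|exact: orthB|].
  by apply: subspaceZ => //; exact: orth_subspace U.
rewrite -eE; apply: (coer_est D1) => //; first by rewrite mulr_ge0// sqr_ge0.
rewrite -/(Q1 e e).
have -> : Q1 e e = - (pencil b (Psi b) e - pencil 1 (Psi b) e - (b - 1) * pencil' 1 (Psi b) e)
   - (b - 1) * pencil' 1 (Psi b - Psi 1) e + (L b - L 1) * m (Psi b) e.
  rewrite {1}eE !(symbilDl HQ1) !(symbilNl HQ1) (symbilZl HQ1) (chi_eq pe).
  rewrite (symbilDl (pencil'_symbil 1)) (symbilNl (pencil'_symbil 1)).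
  by rewrite /Q1 (Psi_eig _ D1) (Psi_eig _ hb); ring.
have n0 := nrm_ge0 d e.
apply: le_trans (ler_normD _ _) _.
apply: le_trans (lerD (ler_normB _ _) (lexx _)) _; rewrite normrN.
rewrite [`|(b - 1) * pencil' _ _ _|]normrM [`|(L b - L 1) * _|]normrM.
have e1 := pencil_taylor (Psi b) e D1 hb.
have e2 := pencil'_bnd D1 (Psi b - Psi 1) e.
have e3 := mNN (Psi b) e.
have e4 := ler_wpM2r n0 (Psi_lip D1 hb).
have e5 := ler_wpM2r n0 (Psi_le hb).
have e6 := hC b hb.
have s2 : (b - 1) ^+ 2 = `|b - 1| * `|b - 1| by rewrite -expr2 real_normK ?num_real.
have p2 : 0 <= (b - 1) ^+ 2 by exact: sqr_ge0.
have -> : K * (b - 1) ^+ 2 * nrm d e = 98 * (b - 1) ^+ 2 * (2 * W * nrm d e) +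
    `|b - 1| * (38 * (CP * `|b - 1| * nrm d e)) +
    (`|C| * (b - 1) ^+ 2) * (2 * W * nrm d e).
  by rewrite /K s2; ring.
apply: lerD; first apply: lerD.
- by apply: (le_trans e1); rewrite ler_wpM2l// mulr_ge0.
- by rewrite ler_wpM2l//; apply: (le_trans e2); rewrite ler_wpM2l.
- apply: ler_pM => //; last exact: le_trans e3 _.
  by apply: (le_trans e6); rewrite ler_wpM2r// ler_norm.
Qed.

Let form_derive q M : symbil q -> bounded_by d q M -> 0 <= M ->
  is_derive (1 : R) 1 (fun b => q (Psi b) (Psi b)) (2 * q (Psi 1) chi).
Proof.
move=> Hq qM M0; have [C [C0 hC]] := Psi_taylor.
apply: (@is_derive_quadratic _ _ _ _ (M * (CP * CP) + 2 * (M * (2 * W * C))) delta).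
  exact: pencil_delta_gt0.
move=> b hb.
have [e eE] : exists e, e = Psi b - Psi 1 - (b - 1) *: chi by eexists.
have [f fE] : exists f, f = Psi b - Psi 1 by eexists.
have -> : q (Psi b) (Psi b) - q (Psi 1) (Psi 1) - (b - 1) * (2 * q (Psi 1) chi) =
   q f f + 2 * q (Psi 1) e.
  rewrite fE eE !(symbilE Hq) (symbilC Hq (Psi b) (Psi 1)); ring.
apply: le_trans (ler_normD _ _) _; rewrite [leRHS]mulrDl; apply: lerD.
  apply: (le_trans (qM _ _)).
  have -> : M * (CP * CP) * (b - 1) ^+ 2 = M * ((CP * `|b - 1|) * (CP * `|b - 1|)).
    by rewrite -(real_normK (num_real (b - 1))); ring.
  rewrite ler_wpM2l//.
  by apply: ler_pM; rewrite ?nrm_ge0// fE; exact: Psi_lip.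
have -> : 2 * (M * (2 * W * C)) * (b - 1) ^+ 2 = 2 * (M * (2 * W * (C * (b - 1) ^+ 2))).
  by ring.
rewrite normrM ger0_norm// ler_wpM2l//; apply: (le_trans (qM _ _)).
rewrite ler_wpM2l//.
by apply: prod_le => //; rewrite eE; exact: hC.
Qed.

(** The derivative of the form vanishes at the ground state. *)
Let num1 : t1 (Psi 1) (Psi 1) = t2 (Psi 1) (Psi 1).
Proof.
have := rayleigh'1; rewrite /rayleigh' => /eqP.
rewrite mulf_eq0 invr_eq0 => /orP[/eqP|/eqP h]; last by have := mPsi D1; rewrite h; lra.
by rewrite /pencil' expr1n invr1 mulr1; lra.
Qed.

Let second := (8 * t1 (Psi 1) (Psi 1) + 4 * (t2 (Psi 1) chi - t1 (Psi 1) chi)) /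
  m (Psi 1) (Psi 1).

Lemma rayleigh'_derive : is_derive (1 : R) 1 rayleigh' second.
Proof.
have M1 := form_derive Ht1 t1_bnd (ler0n _ _).
have M2 := form_derive Ht2 t2_bnd (ler0n _ _).
have M3 := form_derive Hm m_bnd (ler0n _ 1).
have g0 : m (Psi 1) (Psi 1) != 0 by rewrite gt_eqF//; have := mPsi D1; lra.
have M4 := @is_deriveV _ _ _ _ _ g0 M3.
have M5 := @is_deriveV _ (@id R) 1 1 1 (oner_neq0 _) (is_derive_id _ _).
have -> : rayleigh' = ((cst (- 2) * ((fun x : R => x^-1) ^+ 3)) * (fun b => t1 (Psi b) (Psi b))
   + (cst 2 * id) * (fun b => t2 (Psi b) (Psi b))) * (fun b => (m (Psi b) (Psi b))^-1).
  by apply/funext => b; rewrite /rayleigh' /pencil' -exprVn !fctE.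
apply: is_derive_eq.
rewrite /GRing.scale /= !fctE /= num1 invr1 !expr1n.
rewrite /second num1.
by field.
Qed.

Let d1_le u v : `|d1 u v| <= nrm d u * nrm d v.
Proof. by have := d1_bnd u v; rewrite mul1r. Qed.
Let d2_le u v : `|d2 u v| <= nrm d u * nrm d v.
Proof. by have := d2_bnd u v; rewrite mul1r. Qed.

(** The source term of chi has the size of the perturbation: d1 and d2 agree on
    w, and Psi 1 is close to w. *)
Let coupling v : `|pencil' 1 (Psi 1) v| <= beta * W * nrm d v.
Proof.
have -> : pencil' 1 (Psi 1) v =
   2 * ((t2 (Psi 1) v - d2 (Psi 1) v) - (t1 (Psi 1) v - d1 (Psi 1) v)
     + (d2 (Psi 1 - w) v - d1 (Psi 1 - w) v)).
  rewrite /pencil' expr1n invr1 !(symbilE Hd1) !(symbilE Hd2) d12w; ring.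
rewrite normrM ger0_norm//.
have h1 := t1_near (Psi 1) v; have h2 := t2_near (Psi 1) v.
have h3 := d1_le (Psi 1 - w) v; have h4 := d2_le (Psi 1 - w) v.
have h5 := Psi_le D1; have n0 := nrm_ge0 d v.
have h6 : nrm d (Psi 1 - w) <= 2 * eps / kappa * W.
  rewrite mulrAC ler_pdivlMr// mulrC.
  by have := gs_near (HLP D1); rewrite /theta subrr normr0 mulr0 addr0.
have h7 := ler_wpM2r n0 h6; have h8 := ler_wpM2l eps_ge0 (ler_wpM2r n0 h5).
have k1 := ler_norm (t2 (Psi 1) v - d2 (Psi 1) v - (t1 (Psi 1) v - d1 (Psi 1) v)
     + (d2 (Psi 1 - w) v - d1 (Psi 1 - w) v)).
have k2 := ler_normD (t2 (Psi 1) v - d2 (Psi 1) v - (t1 (Psi 1) v - d1 (Psi 1) v))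
     (d2 (Psi 1 - w) v - d1 (Psi 1 - w) v).
have k3 := ler_normB (t2 (Psi 1) v - d2 (Psi 1) v) (t1 (Psi 1) v - d1 (Psi 1) v).
have k4 := ler_normB (d2 (Psi 1 - w) v) (d1 (Psi 1 - w) v).
have -> : beta * W * nrm d v = 8 * (eps * (W * nrm d v)) + 4 * (2 * eps / kappa * W * nrm d v).
  by rewrite /beta; ring.
lra.
Qed.

(** The numerator is 8 t1(Psi, Psi) + 2 pencil'(Psi, chi). The first term is
    4 (t1 + t2)(Psi, Psi), at least 2 d(Psi, Psi) and hence at least 2. The
    second is - 2 Q1(chi, chi), above - 2 because the source of chi is small. *)
Lemma second_gt0 : 0 < second.
Proof.
have M1 := mPsi D1.
rewrite divr_gt0//; last by lra.
have c1 : pencil' 1 (Psi 1) chi = 2 * (t2 (Psi 1) chi - t1 (Psi 1) chi).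
  by rewrite /pencil' expr1n invr1; ring.
have c2 := chi_eq chi_orth; have c3 := Q1_coer chi_orth.
have c4 := coupling chi; have n0 := nrm_ge0 d chi.
rewrite -(nrm_sqr (d0 chi)) in c3.
have beta0 : 0 <= beta.
  rewrite /beta; apply: mulr_ge0 => //; apply: addr_ge0 => //.
  by apply: divr_ge0 => //; exact: ltW.
have c5 : Q1 chi chi <= beta * W * nrm d chi.
  by rewrite c2; apply: le_trans c4; rewrite -normrN ler_norm.
have c6 : nrm d chi <= beta * W / kappa.
  apply: le_of_sqr_le => //; first by apply: divr_ge0; [exact: mulr_ge0|exact: ltW].
  by rewrite mulrAC ler_pdivlMr// mulrC; apply: le_trans c5.
have c7 : Q1 chi chi < 1.
  apply: (le_lt_trans c5); apply: (@le_lt_trans _ _ (beta * W * (beta * W / kappa))).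
    by apply: ler_wpM2l => //; exact: mulr_ge0.
  rewrite mulrA ltr_pdivrMr// mul1r -expr2 exprMn.
  by rewrite nrm_sqr// (up_dw U) (up_ww U) mulr1.
have c8 : d (Psi 1) (Psi 1) <= 2 * (t1 (Psi 1) (Psi 1) + t2 (Psi 1) (Psi 1)).
  have h1 := t1_near (Psi 1) (Psi 1); have h2 := t2_near (Psi 1) (Psi 1).
  rewrite -expr2 nrm_sqr// in h1; rewrite -expr2 nrm_sqr// in h2.
  have := eps_small; have := theta0_lt => e1 e2.
  have e3 : eps * d (Psi 1) (Psi 1) <= 1 / 4 * d (Psi 1) (Psi 1).
    by apply: ler_wpM2r => //; lra.
  have k1 := ler_norm (- (t1 (Psi 1) (Psi 1) - d1 (Psi 1) (Psi 1))).
  have k2 := ler_norm (- (t2 (Psi 1) (Psi 1) - d2 (Psi 1) (Psi 1))).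
  rewrite !normrN in k1 k2.
  have : d (Psi 1) (Psi 1) = d1 (Psi 1) (Psi 1) + d2 (Psi 1) (Psi 1) by [].
  lra.
have c9 := up_md U (Psi 1).
have := num1; lra.
Qed.

End SecondDerivative.
Lemma family_regular :
  [/\ forall a, `|a - 1| < delta -> derivable L a 1,
      derivable (derive1 L) (1 : R) 1, derive1 L 1 = 0 & 0 < derive1n 2 L 1].
Proof.
have [C hC] := L_taylor.
have dL a : `|a - 1| < delta -> is_derive a 1 L (rayleigh' a).
  move=> ha; apply: (@is_derive_quadratic _ _ _ _ C (delta - `|a - 1|)).
    by rewrite subr_gt0.
  move=> b hb; apply: hC; first exact: ltW.
  have -> : b - 1 = (b - a) + (a - 1) by rewrite subrKA.
  by apply: (le_trans (ler_normD _ _)); lra.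
have D1' : `|1 - 1 : R| < delta by rewrite subrr normr0; exact: pencil_delta_gt0.
have nearL : \forall a \near (1 : R), rayleigh' a = derive1 L a.
  near=> a; rewrite derive1E; have h : `|a - 1| < delta.
    by near: a; apply: cvgr_distC_lt => //; exact: pencil_delta_gt0.
  by have [_ ->] := dL a h.
have [chi [pc hc]] := chi_exists.
have d2L := near_eq_is_derive nearL (rayleigh'_derive pc hc).
split.
- by move=> a /dL[].
- by case: d2L.
- by rewrite derive1E; have [_ ->] := dL 1 D1'; exact: rayleigh'1.
- by rewrite /derive1n /= derive1E; have [_ ->] := d2L; exact: second_gt0.
Unshelve. all: by end_near. Qed.

End Family.

(** The last clause characterizes L a as the lowest eigenvalue of the pencil. *)
Theorem pencil_regular : exists L : R -> R,
  [/\ forall a, `|a - 1| < delta -> derivable L a 1,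
      derivable (derive1 L) (1 : R) 1, derive1 L 1 = 0 & 0 < derive1n 2 L 1] /\
  forall a, `|a - 1| < delta -> exists psi, [/\ 0 < m psi psi,
    forall v, pencil a psi v = L a * m psi v &
    forall u, L a * m u u <= pencil a u u].
Proof.
have [LP hLP] := exists_family.
exists (fun a => (LP a).1); split; first exact: family_regular hLP.
move=> a ha; have g := hLP a (ltW ha).
exists (LP a).2; split.
- by have := gs_m_ge1 U g; lra.
- exact: gs_eig g.
- exact: gs_min g.
Qed.

End Pencil.

(** * Square-integrable functions *)

Lemma normrM_le_sqr (R : realType) (a b : R) : `|a * b| <= a ^+ 2 + b ^+ 2.
Proof.
rewrite normrM -(real_normK (num_real a)) -(real_normK (num_real b)).
have := normr_ge0 a; have := normr_ge0 b; move: `|a| `|b| => x y y0 x0.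
by have := sqr_ge0 (x - y); nra.
Qed.

Section SquareIntegrable.
Context d (T : measurableType d) (R : realType) (mu : {measure set T -> \bar R}).
Variables (D : set T) (mD : measurable D).
Implicit Types f g h : T -> R.

Definition sqi f : Prop :=
  measurable_fun D f /\ (\int[mu]_(x in D) (f x ^+ 2)%:E < +oo)%E.

(** Functions are not identified almost everywhere, so this product is only
    positive semidefinite. *)
Definition ip f g : R := Rintegral mu D (fun x => f x * g x).

Lemma sqi_integrable f : sqi f -> mu.-integrable D (EFin \o (fun x => f x ^+ 2)).
Proof.
move=> [mf foo]; apply/integrableP; split.
  by apply/measurable_EFinP; exact: measurable_funX.
apply: le_lt_trans foo; rewrite le_eqVlt; apply/orP; left; apply/eqP.
by apply: eq_integral => x _ /=; rewrite ger0_norm// sqr_ge0.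
Qed.

Lemma integrable_sqi f : measurable_fun D f ->
  mu.-integrable D (EFin \o (fun x => f x ^+ 2)) -> sqi f.
Proof.
move=> mf /integrableP[_ foo]; split=> //; apply: le_lt_trans foo.
rewrite le_eqVlt; apply/orP; left; apply/eqP.
by apply: eq_integral => x _ /=; rewrite ger0_norm// sqr_ge0.
Qed.

Lemma sqi_dom f (g h : T -> R) : measurable_fun D f ->
  mu.-integrable D (EFin \o g) -> (forall x, D x -> f x ^+ 2 <= g x) -> sqi f.
Proof.
move=> mf ig fg; apply: integrable_sqi => //; apply: (le_integrable mD _ _ ig).
  by apply/measurable_EFinP; exact: measurable_funX.
move=> x Dx /=; rewrite lee_fin ger0_norm ?sqr_ge0//.
by apply: (le_trans (fg x Dx)); exact: ler_norm.
Qed.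

Lemma sqi_mul f g : sqi f -> sqi g -> mu.-integrable D (EFin \o (fun x => f x * g x)).
Proof.
move=> sf sg.
apply: (@le_integrable _ _ _ mu D mD _ (fun x => (f x ^+ 2)%:E + (g x ^+ 2)%:E)%E).
- by apply/measurable_EFinP; apply: measurable_funM; [exact: sf.1|exact: sg.1].
- move=> x _ /=; rewrite lee_fin [leRHS]ger0_norm ?addr_ge0 ?sqr_ge0//.
  exact: normrM_le_sqr.
- by apply: integrableD => //; exact: sqi_integrable.
Qed.

Lemma sqi0 : sqi 0.
Proof.
split; first exact: measurable_cst.
by rewrite integral0_eq ?ltry// => x _; rewrite /= expr0n.
Qed.

Lemma sqi_lin a f g : sqi f -> sqi g -> sqi (a *: f + g).
Proof.
move=> sf sg.
have mf : measurable_fun D (a *: f + g).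
  by apply: measurable_funD; [apply: measurable_funM; [exact: measurable_cst|exact: sf.1]|exact: sg.1].
apply: integrable_sqi => //.
have := integrableD mD (integrableD mD (integrableZl mD (a ^+ 2) (sqi_integrable sf))
   (integrableZl mD (2 * a) (sqi_mul sf sg))) (sqi_integrable sg).
apply: eq_integrable => // x _ /=.
rewrite -!EFinM -!EFinD; congr EFin; rewrite !fctE /GRing.scale /=; ring.
Qed.

Lemma ipC f g : ip f g = ip g f.
Proof. by apply: eq_Rintegral => x _; rewrite mulrC. Qed.

Lemma ip_lin a f g h : sqi f -> sqi g -> sqi h ->
  ip (a *: f + g) h = a * ip f h + ip g h.
Proof.
move=> sf sg sh; rewrite /ip.
have := RintegralZl a mD (sqi_mul sf sh) => <-.
rewrite -RintegralD//; last 2 first.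
- have := integrableZl mD a (sqi_mul sf sh).
  by apply: eq_integrable => // x _ /=; rewrite EFinM.
- exact: sqi_mul.
by apply: eq_Rintegral => x _; rewrite !fctE /GRing.scale /=; ring.
Qed.

Lemma ip_ge0 f : 0 <= ip f f.
Proof. by apply: Rintegral_ge0 => x _; rewrite -expr2 sqr_ge0. Qed.

Lemma ip_sqr f : sqi f -> (\int[mu]_(x in D) (f x ^+ 2)%:E)%E = (ip f f)%:E.
Proof.
move=> sf; rewrite /ip /Rintegral fineK.
  by apply: eq_integral => x _; rewrite expr2.
apply: integrable_fin_num => //; exact: sqi_mul.
Qed.

Lemma sqi_bounded f (k : T -> R) M : measurable_fun D k ->
  (forall x, D x -> `|k x| <= M) -> sqi f ->
  sqi (fun x => k x * f x) /\ ip (fun x => k x * f x) (fun x => k x * f x) <= M ^+ 2 * ip f f.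
Proof.
move=> mk kM sf.
have le x : D x -> (k x * f x) ^+ 2 <= M ^+ 2 * f x ^+ 2.
  move=> Dx; rewrite exprMn ler_wpM2r ?sqr_ge0//.
  rewrite -(real_normK (num_real (k x))) lerXn2r ?nnegrE//; last exact: kM.
  by apply: le_trans (kM x Dx).
have i1 : mu.-integrable D (EFin \o (fun x => M ^+ 2 * f x ^+ 2)).
  have := integrableZl mD (M ^+ 2) (sqi_integrable sf).
  by apply: eq_integrable => // x _ /=; rewrite EFinM.
have s1 : sqi (fun x => k x * f x).
  apply: sqi_dom i1 _ => //; first by apply: measurable_funM => //; exact: sf.1.
split => //; rewrite /ip.
have -> : M ^+ 2 * Rintegral mu D (fun x => f x * f x) = Rintegral mu D (fun x => M ^+ 2 * f x ^+ 2).
  rewrite -RintegralZl//; last exact: sqi_mul.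
apply: le_Rintegral => //; exact: sqi_mul.
Qed.

End SquareIntegrable.

Section Completeness.
Context d (T : measurableType d) (R : realType) (mu : {measure set T -> \bar R}).
Variables (D : set T) (mD : measurable D).
Local Notation sqi := (sqi mu D).
Local Notation ip := (ip mu D).
Local Notation sq f := (ip f f).

Lemma sqiB (f g : T -> R) : sqi f -> sqi g -> sqi (f - g).
Proof. by move=> sf sg; rewrite addrC -scaleN1r; exact: sqi_lin. Qed.

Section FastCauchy.
Variable g : nat -> T -> R.
Hypothesis gs : forall k, sqi (g k).
Hypothesis gfast : forall k, sq (g k.+1 - g k) <= (4 ^+ k)^-1.

Let Delta k x := g k.+1 x - g k x.
(** Since increments of squared norm 4^-k are weighted by 2^k, G is integrable.
    Where it is finite the sequence converges absolutely, by
    t <= s + t^2 / s with s = 2^-k. *)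
Let G x := (\sum_(k <oo) (2 ^+ k * Delta k x ^+ 2)%:E)%E.

Let mDelta k : measurable_fun D (Delta k).
Proof. by apply: measurable_funB; exact: (gs _).1. Qed.

Let mG : measurable_fun D G.
Proof.
apply: ge0_emeasurable_sum => [k x _ _|k _].
  by rewrite lee_fin mulr_ge0 ?sqr_ge0// exprn_ge0.
apply/measurable_EFinP; apply: measurable_funM; first exact: measurable_cst.
exact: measurable_funX.
Qed.

Let G_int : mu.-integrable D G.
Proof.
apply/integrableP; split => //.
have t0 k x : (0 <= (2 ^+ k * Delta k x ^+ 2)%:E)%E.
  by rewrite lee_fin mulr_ge0 ?sqr_ge0// exprn_ge0.
have mt k : measurable_fun D (fun x => (2 ^+ k * Delta k x ^+ 2)%:E).
  apply/measurable_EFinP; apply: measurable_funM; first exact: measurable_cst.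
  exact: measurable_funX.
rewrite (eq_integral G); last by move=> x _; rewrite gee0_abs// nneseries_ge0.
rewrite /G integral_nneseries//.
apply: (@le_lt_trans _ _ (\sum_(k <oo) (2 / (2 ^ (k + 1))%:R)%:E)%E).
  apply: lee_nneseries => [k _ _|k _]; first exact: integral_ge0.
  under eq_integral do rewrite EFinM.
  rewrite (@ge0_integralZl _ _ _ mu D mD (fun x => (Delta k x ^+ 2)%:E)); first last.
  - by rewrite lee_fin exprn_ge0.
  - by move=> x _; rewrite lee_fin sqr_ge0.
  - by apply/measurable_EFinP; exact: measurable_funX.
  have -> : (\int[mu]_(x in D) (Delta k x ^+ 2)%:E)%E = (sq (g k.+1 - g k))%:E.
    by rewrite -ip_sqr//; exact: sqiB.
  rewrite -EFinM lee_fin.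
  apply: (@le_trans _ _ (2 ^+ k * (4 ^+ k)^-1)).
    by rewrite ler_wpM2l ?exprn_ge0.
  have e4 : (4 : R) ^+ k = 2 ^+ k * 2 ^+ k by rewrite -exprMn; congr (_ ^+ _); ring.
  have n2 : (2 : R) ^+ k != 0 by rewrite expf_neq0.
  rewrite e4 addn1 expnSr natrM natrX le_eqVlt; apply/orP; left; apply/eqP; field.
  by [].
have -> : (\sum_(k <oo) (2 / (2 ^ (k + 1))%:R)%:E)%E = (2 / 2 ^+ 0 : R)%:E.
  by apply: (cvg_lim (@ereal_hausdorff R)); exact: cvg_geometric_eseries_half.
by rewrite ltry.
Qed.

Let good x := D x /\ (G x < +oo)%E.

Let good_ae : {ae mu, forall x, D x -> good x}.
Proof.
have := integrable_ae mD G_int; apply: filterS => x h Dx; split => //.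
by rewrite ltey_eq h.
Qed.

Let mgood : measurable good.
Proof.
have -> : good = D `&` [set x | (G x < +oo)%E] by [].
by apply: emeasurable_fun_infty_o.
Qed.

Let good_cvg x : good x -> cvgn (g ^~ x).
Proof.
move=> [Dx Gx].
have : cvgn (series (telescope (g ^~ x))).
  apply: normed_cvg.
  have c1 : cvgn (series (fun k => 2 / (2 ^ (k + 1))%:R : R)).
    by apply/cvg_ex; eexists; exact: cvg_geometric_series_half.
  have c2 : cvgn (series (fun k => 2 ^+ k * Delta k x ^+ 2)).
    apply: nondecreasing_is_cvgn.
      apply: nondecreasing_series => k _ _.
      by rewrite mulr_ge0 ?sqr_ge0// exprn_ge0.
    exists (fine (G x)) => _ [n _ <-].
    rewrite -lee_fin fineK; last first.
      rewrite ge0_fin_numE//; apply: nneseries_ge0 => k _ _.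
      by rewrite lee_fin mulr_ge0 ?sqr_ge0// exprn_ge0.
    rewrite /series /= -sumEFin; apply: nneseries_lim_ge => k _ _.
    by rewrite lee_fin mulr_ge0 ?sqr_ge0// exprn_ge0.
  apply: (series_le_cvg _ _ _ (is_cvg_seriesD c1 c2)) => k /=.
  - by [].
  - by rewrite addr_ge0 ?divr_ge0// mulr_ge0 ?sqr_ge0// exprn_ge0.
  change (`|Delta k x| <= 2 / (2 ^ (k + 1))%:R + 2 ^+ k * Delta k x ^+ 2).
  rewrite addn1 expnSr natrM natrX.
  move: (Delta k x) => D0; have n2 : 0 < (2 : R) ^+ k by rewrite exprn_gt0.
  have -> : 2 / (2 ^+ k * 2%:R) = (2 ^+ k)^-1 :> R by field; rewrite gt_eqF.
  rewrite -(real_normK (num_real D0)); move: `|D0| => t.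
  have i0 : 0 < ((2 : R) ^+ k)^-1 by rewrite invr_gt0.
  have e1 : ((2 : R) ^+ k)^-1 * 2 ^+ k = 1 by rewrite mulVf// gt_eqF.
  move: ((2 : R) ^+ k) (((2 : R) ^+ k)^-1) n2 i0 e1 => a b a0 b0 ab.
  have : 0 <= a * (t - b) ^+ 2 by rewrite mulr_ge0 ?sqr_ge0// ltW.
  have -> : a * (t - b) ^+ 2 = a * t ^+ 2 - 2 * (b * a) * t + b * (b * a) by ring.
  rewrite ab; have := sqr_ge0 t; nra.
rewrite telescopeK => h.
have -> : g ^~ x = (fun n => (g n x - g 0%N x) + g 0%N x) by apply/funext => n; rewrite subrK.
by apply: is_cvgD => //; exact: is_cvg_cst.
Qed.

(** The value 0 on the null set where G is infinite keeps the limit measurable. *)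
Definition fast_limit x := if pselect (good x) then lim (g n x @[n --> \oo]) else 0.

Let fast_cvg x : good x -> g ^~ x @ \oo --> fast_limit x.
Proof. by move=> gx; rewrite /fast_limit; case: pselect => // gx'; exact: good_cvg. Qed.

Let mlim : measurable_fun D fast_limit.
Proof.
apply: (@measurable_fun_cvg _ _ _ _ (fun k => (g k \_ good)%R)).
  move=> k; apply: measurable_funS measurableT _ _ => //.
  by apply/(measurable_restrictT _ mgood); apply: measurable_funS mD _ (gs k).1 => x [].
move=> x Dx; have [gx|gx] := pselect (good x).
  have -> : (fun k => g k \_ good) ^~ x = g ^~ x.
    by apply/funext => k; rewrite /= patchE mem_set.
  exact: fast_cvg.
rewrite /fast_limit; case: pselect => // gx'.
have -> : (fun k => g k \_ good) ^~ x = cst 0.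
  by apply/funext => k; rewrite /= patchE memNset.
exact: cvg_cst.
Qed.

(** Fatou's lemma. The function u will be a member of the original sequence. *)
Lemma fast_limitP (u : T -> R) (e : R) : sqi u ->
  (exists N, forall k, (N <= k)%N -> sq (g k - u) <= e) ->
  sqi (fast_limit - u) /\ sq (fast_limit - u) <= e.
Proof.
move=> su [N hN].
pose F k x := ((g k x - u x) ^+ 2)%:E.
have mF k : measurable_fun D (F k).
  apply/measurable_EFinP; apply: measurable_funX; apply: measurable_funB; first exact: (gs k).1.
  exact: su.1.
have mlu : measurable_fun D (fast_limit - u) by apply: measurable_funB => //; exact: su.1.
have h : (\int[mu]_(x in D) ((fast_limit - u) x ^+ 2)%:E <= e%:E)%E.
  apply: (@le_trans _ _ (\int[mu]_(x in D) (limn_einf (F ^~ x)))%E).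
    apply: ae_ge0_le_integral => //.
    - by move=> x _; rewrite lee_fin sqr_ge0.
    - by apply/measurable_EFinP; exact: measurable_funX.
    - move=> x _; rewrite limn_einf_lim; apply: lime_ge; first exact: is_cvg_einfs.
      apply: nearW => n; apply: le_ereal_inf_tmp => _ [k _ <-].
      by rewrite lee_fin sqr_ge0.
    - have -> : (fun x => limn_einf (F ^~ x)) = (fun x => - limn_esup (fun k => - F k x))%E.
        by apply/funext => x; rewrite /limn_einf.
      apply: measurableT_comp => //; apply: measurable_fun_limn_esup => k.
      exact: measurableT_comp.
    have := good_ae; apply: filterS => x gx Dx.
    have := fast_cvg (gx Dx) => c.
    have c1 : F ^~ x @ \oo --> ((fast_limit x - u x) ^+ 2)%:E.
      apply: cvg_EFin; first exact: nearW.
      apply: (@cvg_comp _ _ _ (fun k => g k x - u x) (fun y : R => y ^+ 2)).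
        by apply: cvgB c _; exact: cvg_cst.
      by apply: exprn_continuous.
    by rewrite (cvg_limn_einf_sup c1).1.
  have F0 k x : D x -> (0 <= F k x)%E by move=> _; rewrite lee_fin sqr_ge0.
  apply: (le_trans (fatou mu mD mF F0)).
  rewrite limn_einf_lim; apply: lime_le; first exact: is_cvg_einfs.
  exists N => // n /= Nn; apply: ge_ereal_inf; exists (\int[mu]_(x in D) F n x)%E; first by exists n => /=.
  have sn := sqiB (gs n) su.
  by rewrite /F (ip_sqr mD sn) lee_fin hN.
have slu : sqi (fast_limit - u) by split=> //; apply: (le_lt_trans h); rewrite ltry.
by split=> //; rewrite -lee_fin -ip_sqr.
Qed.

End FastCauchy.

(** The theorem of Riesz and Fischer, along a subsequence whose increments have
    squared norm at most 4^-k. *)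
Lemma sqi_complete (f : nat -> T -> R) : (forall i, sqi (f i)) ->
  (forall e, 0 < e -> exists N, forall i j, (N <= i)%N -> (N <= j)%N -> sq (f i - f j) <= e) ->
  exists2 l, sqi l &
    forall e, 0 < e -> exists N, forall i, (N <= i)%N -> sq (f i - l) <= e.
Proof.
move=> fs fc.
have p4 k : 0 < ((4 : R) ^+ k)^-1 by rewrite invr_gt0 exprn_gt0.
have [n0 hn0] := choice (fun k => fc _ (p4 k)).
pose n k := (\sum_(i < k.+1) (n0 i).+1)%N.
have nn0 k : (n0 k <= n k)%N by rewrite /n big_ord_recr /= (leq_trans (leqnSn _))// leq_addl.
have kn k : (k <= n k)%N.
  elim: k => // k IH; rewrite /n big_ord_recr /= addnS ltnS; apply: leq_trans IH _.
  exact: leq_addr.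
have nS k : (n k <= n k.+1)%N by rewrite /n [leqRHS]big_ord_recr /= leq_addr.
have nmon k j : (k <= j)%N -> (n k <= n j)%N.
  by move=> kj; rewrite -(subnK kj); elim: (_ - _)%N => // i IH; apply: (leq_trans IH (nS _)).
pose g k := f (n k).
have gs k : sqi (g k) by exact: fs.
have gf k : sq (g k.+1 - g k) <= (4 ^+ k)^-1.
  by apply: hn0; [apply: leq_trans (nS k)|]; exact: nn0.
pose l := fast_limit g.
have key i N e : sqi (f i) -> (forall j, (N <= j)%N -> sq (f j - f i) <= e) ->
    sqi (l - f i) /\ sq (l - f i) <= e.
  move=> si hj; apply: fast_limitP => //.
  by exists N => k Nk; apply: hj; apply: leq_trans (kn k).
have sym h : sq (l - h) = sq (h - l).
  by apply: eq_Rintegral => x _; rewrite !fctE; ring.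
exists l => [|e e0].
  have [N hN] := fc 1 ltr01.
  have [h _] := key N N 1 (fs N) (fun j hj => hN j N hj (leqnn N)).
  by rewrite -[l](subrK (f N)) -[l - _]scale1r; apply: sqi_lin.
have [N hN] := fc e e0; exists N => i Ni; rewrite -sym.
by have [] := key i N e (fs i) (fun j hj => hN j i hj Ni).
Qed.

End Completeness.

(** * Measurability and iterated integrals on the unit square *)

Section ContinuousMeasurable.
Context {R : realType}.

Definition box (c : R * R) (e : R) : set (R * R) :=
  `]c.1 - e, c.1 + e[ `*` `]c.2 - e, c.2 + e[.

Lemma measurable_box c e : measurable (box c e).
Proof. by apply: measurableX; exact: measurable_itv. Qed.

Lemma rat_near (x e : R) : 0 < e -> exists q : rat, `|x - ratr q| < e.
Proof.
move=> e0; have h : x - e < x + e by lra.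
have [q /= ] := rat_in_itvoo h.
by rewrite in_itv /= => /andP[h1 h2]; exists q; rewrite ltr_norml; apply/andP; split; lra.
Qed.

(** Every open set is a countable union of boxes with rational centres. *)
Lemma open_measurable_plane (U : set (R * R)) : open U -> measurable U.
Proof.
move=> oU.
pose F (i : nat * (rat * rat)) : set (R * R) :=
  let b := box (ratr i.2.1, ratr i.2.2) (i.1.+1%:R^-1) in
  if pselect (b `<=` U) then b else set0.
have -> : U = \bigcup_i F i.
  apply/seteqP; split=> [p Up|p [i _]]; last first.
    by rewrite /F; case: pselect => // h; apply: h.
  have [[A B] /= [nA nB] AB] := (@open_nbhs_nbhs _ p U (conj oU Up)).
  have /nbhs_ballP[e1 /= e10 h1] := nA; have /nbhs_ballP[e2 /= e20 h2] := nB.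
  pose e := Num.min e1 e2.
  have e0 : 0 < e by rewrite lt_min e10.
  pose n := Num.truncn (2 / e).
  have n0 : 0 < (n.+1%:R : R)^-1 by rewrite invr_gt0 ltr0n.
  have ne : (n.+1%:R : R)^-1 < e / 2.
    rewrite -[e / 2]invrK ltf_pV2 ?posrE ?ltr0n ?invr_gt0 ?divr_gt0//.
    by rewrite invf_div truncnS_gt.
  have [q1 hq1] := rat_near p.1 n0; have [q2 hq2] := rat_near p.2 n0.
  exists (n, (q1, q2)) => //; rewrite /F /=; case: pselect => [h|]; last first.
    case=> -[x y] [] /=; rewrite !in_itv /= => /andP[x1 x2] /andP[y1 y2]; apply: AB => /=.
    move: hq1 hq2; rewrite !ltr_norml => /andP[a1 a2] /andP[b1 b2].
    have ee1 : e <= e1 by rewrite ge_min lexx.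
    have ee2 : e <= e2 by rewrite ge_min lexx orbT.
    move: x1 x2 y1 y2 a1 a2 b1 b2 ne; move: (n.+1%:R^-1) (ratr q1) (ratr q2) => N r1 r2.
    move=> x1 x2 y1 y2 a1 a2 b1 b2 ne.
    have ne1 : N < e1 / 2 by apply: lt_le_trans ne _; rewrite ler_pM2r.
    have ne2 : N < e2 / 2 by apply: lt_le_trans ne _; rewrite ler_pM2r.
    clear ne ee1 ee2.
    split; [apply: h1|apply: h2]; rewrite /ball /= ltr_norml; apply/andP; split; lra.
  move: hq1 hq2; rewrite !ltr_norml => /andP[a1 a2] /andP[b1 b2].
  split; rewrite /= in_itv /=; move: a1 a2 b1 b2; clear.
    by move: (n.+1%:R^-1) (ratr q1) => N r1 *; apply/andP; split; lra.
  by move: (n.+1%:R^-1) (ratr q2) => N r1 *; apply/andP; split; lra.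
apply: countable_bigcupT_measurable => [|i]; first exact: countableP.
rewrite /F; case: pselect => h /=.
  exact: measurable_box.
exact: measurable0.
Qed.

Lemma continuous_measurable_plane (f : R * R -> R) :
  continuous f -> measurable_fun setT f.
Proof.
move=> /continuousP cf; apply: (measurability _ (RGenOpens.measurableE R)).
move=> _ [_ [a [b ->] <-]]; rewrite setTI; apply: open_measurable_plane.
exact/cf/interval_open.
Qed.

End ContinuousMeasurable.

Section Bounded.
Context {R : realType}.

(** Bounded measurable functions form an algebra of functions integrable on
    every set of finite measure, which settles the integrability conditions for
    test functions. *)
Definition bm d (T : measurableType d) (f : T -> R) : Prop :=
  measurable_fun setT f /\ exists M, forall x, `|f x| <= M.

Section Closure.
Context d (T : measurableType d).
Implicit Types f g : T -> R.

Lemma bm_cst (c : R) : bm (fun _ : T => c).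
Proof. by split; [exact: measurable_cst|exists `|c|]. Qed.

Lemma bmD f g : bm f -> bm g -> bm (fun x => f x + g x).
Proof.
move=> [mf [M hM]] [mg [N hN]]; split; first exact: measurable_funD.
by exists (M + N) => x; apply: le_trans (ler_normD _ _) _; exact: lerD.
Qed.

Lemma bmM f g : bm f -> bm g -> bm (fun x => f x * g x).
Proof.
move=> [mf [M hM]] [mg [N hN]]; split; first exact: measurable_funM.
by exists (M * N) => x; rewrite normrM; exact: ler_pM.
Qed.

Lemma bmN f : bm f -> bm (fun x => - f x).
Proof.
move=> [mf [M hM]]; split; first exact: measurableT_comp.
by exists M => x; rewrite normrN.
Qed.

Lemma bmB f g : bm f -> bm g -> bm (fun x => f x - g x).
Proof. by move=> hf hg; apply: bmD => //; exact: bmN. Qed.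

Lemma bmX f n : bm f -> bm (fun x => f x ^+ n).
Proof.
move=> hf; elim: n => [|n IH]; first exact: bm_cst.
by under eq_fun do rewrite exprS; exact: bmM.
Qed.

Lemma bm_integrable (mu : {measure set T -> \bar R}) (D : set T) f :
  measurable D -> (mu D < +oo)%E -> bm f -> mu.-integrable D (EFin \o f).
Proof.
move=> mD fD [mf [M hM]]; apply: measurable_bounded_integrable => //.
  exact: measurable_funTS.
exists M; split; first exact: num_real.
by move=> K MK x _; apply: (le_trans (hM x)); exact: ltW.
Qed.

Lemma bm_int (mu : {measure set T -> \bar R}) (D : set T) f :
  measurable D -> (mu D < +oo)%E -> bm f ->
  (\int[mu]_(x in D) (f x)%:E)%E = (Rintegral mu D f)%:E.
Proof.
by move=> mD fD bf; rewrite /Rintegral fineK// integrable_fin_num// bm_integrable.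
Qed.

End Closure.

Lemma bm_comp d d' (T : measurableType d) (T' : measurableType d') (f : T -> R) (g : T' -> T) :
  measurable_fun setT g -> bm f -> bm (fun x => f (g x)).
Proof. by move=> mg [mf [M hM]]; split; [exact: measurableT_comp|exists M]. Qed.

End Bounded.

(** Lebesgue measure lives on [measurableTypeR R], a copy of R whose measurable
    sets are the Borel sets; the statements about it are typed over this copy. *)
Notation plane R := (measurableTypeR R * measurableTypeR R)%type.
Notation bm1 f := (@bm _ _ (measurableTypeR _) f).
Notation bm2 G := (@bm _ _ (measurableTypeR _ * measurableTypeR _)%type G).

Section Square.
Context {R : realType}.
Local Notation leb := (@lebesgue_measure R).

Definition I12 : set R := `](- (1 / 2)), 1 / 2[.
Definition sq1 : set (R * R) := I12 `*` I12.

Lemma mI12 : measurable (I12 : set (measurableTypeR R)). Proof. exact: measurable_itv. Qed.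
Lemma msq1 : measurable (sq1 : set (plane R)). Proof. by apply: measurableX; exact: mI12. Qed.

Lemma leb_I12 : leb I12 = 1%E.
Proof.
rewrite lebesgue_measure_itv /= lte_fin ifT; last by lra.
by rewrite -EFinB; congr EFin; lra.
Qed.

Lemma mu2_sq1 : mu2 R sq1 = 1%E.
Proof.
transitivity (leb I12 * leb I12)%E; last by rewrite !leb_I12 mule1.
by apply: product_measure1E; exact: mI12.
Qed.

Lemma leb_fin : (leb I12 < +oo)%E. Proof. by rewrite leb_I12 ltry. Qed.
Lemma mu2_fin : (mu2 R sq1 < +oo)%E. Proof. by rewrite mu2_sq1 ltry. Qed.

Section Fub.
Variable G : R * R -> R.
Hypothesis bG : bm2 G.

Let Gr : R * R -> R := fun p => \1_I12 p.1 * (\1_I12 p.2 * G p).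

Let mGr : measurable_fun [set: plane R] Gr.
Proof.
have mi : measurable_fun [set: measurableTypeR R] (\1_I12 : R -> R) by apply: measurable_indic; exact: mI12.
apply: measurable_funM; first exact: (measurableT_comp mi measurable_fst).
by apply: measurable_funM; [exact: (measurableT_comp mi measurable_snd)|exact: bG.1].
Qed.

Let GrE : (EFin \o Gr) = (EFin \o G) \_ sq1.
Proof.
apply/funext => -[x y]; rewrite /Gr patchE /= !indicE.
case: ifPn => [/set_mem[/= h1 h2]|]; first by rewrite !mem_set// !mul1r.
have [xI|xI] := boolP (x \in I12); last by rewrite mul0r.
have [yI|yI] := boolP (y \in I12); last by rewrite mul0r mulr0.
by move=> /negP; rewrite inE; case; split; exact: set_mem.
Qed.

Let iGr : (mu2 R).-integrable setT (EFin \o Gr).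
Proof.
rewrite GrE; apply/(integrable_mkcond _ msq1).1.
exact: (bm_integrable msq1 mu2_fin bG).
Qed.

Lemma bm_slice1 y : bm1 (fun x => G (x, y)).
Proof. by apply: bm_comp bG; exact: measurable_pair2. Qed.
Lemma bm_slice2 x : bm1 (fun y => G (x, y)).
Proof. by apply: bm_comp bG; exact: measurable_pair1. Qed.

Let in1 y : (\int[leb]_x (Gr (x, y))%:E = ((EFin \o (fun y => Rintegral leb I12 (fun x => G (x, y)))) \_ I12) y)%E.
Proof.
rewrite patchE; case: ifPn => yI.
  rewrite /= -(bm_int mI12 leb_fin (bm_slice1 y)) [RHS]integral_mkcond.
  apply: eq_integral => x _; rewrite patchE /Gr /= !indicE yI mul1r.
  by case: ifP => _; rewrite ?mul1r ?mul0r.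
by rewrite integral0_eq// => x _; rewrite /Gr /= [\1_I12 y]indicE (negbTE yI) mul0r mulr0.
Qed.

Let in2 x : (\int[leb]_y (Gr (x, y))%:E = ((EFin \o (fun x => Rintegral leb I12 (fun y => G (x, y)))) \_ I12) x)%E.
Proof.
rewrite patchE; case: ifPn => xI.
  rewrite /= -(bm_int mI12 leb_fin (bm_slice2 x)) [RHS]integral_mkcond.
  apply: eq_integral => y _; rewrite patchE /Gr /= !indicE xI mul1r.
  by case: ifP => _; rewrite ?mul1r ?mul0r.
by rewrite integral0_eq// => y _; rewrite /Gr /= [\1_I12 x]indicE (negbTE xI) mul0r.
Qed.

Lemma fubini_slice2 :
  leb.-integrable I12 (EFin \o (fun x => Rintegral leb I12 (fun y => G (x, y)))) /\
  Rintegral (mu2 R) sq1 G = Rintegral leb I12 (fun x => Rintegral leb I12 (fun y => G (x, y))).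
Proof.
split.
  apply/(integrable_mkcond _ mI12).2.
  have := integrable_fubini_F iGr; apply: eq_integrable => // y _.
  by rewrite -in2.
rewrite /Rintegral integral_mkcond -GrE -(integral12_prod_meas1 iGr) [in RHS]integral_mkcond.
by congr fine; apply: eq_integral => y _; rewrite -in2.
Qed.

Lemma fubini_eq1 :
  Rintegral (mu2 R) sq1 G = Rintegral leb I12 (fun y => Rintegral leb I12 (fun x => G (x, y))).
Proof.
rewrite /Rintegral integral_mkcond -GrE -(integral21_prod_meas1 iGr) [in RHS]integral_mkcond.
by congr fine; apply: eq_integral => y _; rewrite -in1.
Qed.

End Fub.

Lemma fubini_slice1 (G : R * R -> R) : bm2 G ->
  leb.-integrable I12 (EFin \o (fun y => Rintegral leb I12 (fun x => G (x, y)))) /\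
  Rintegral (mu2 R) sq1 G = Rintegral leb I12 (fun y => Rintegral leb I12 (fun x => G (x, y))).
Proof.
move=> bG; split; last exact: fubini_eq1.
have bG' : bm2 (fun p => G (p.2, p.1)).
  by apply: bm_comp bG; apply: measurable_fun_pair; [exact: measurable_snd|exact: measurable_fst].
by have [] := fubini_slice2 bG'.
Qed.
End Square.

(** * The Dirichlet energy on an interval *)

Section OneDim.
Context {R : realType}.
Local Notation leb := (@lebesgue_measure R).
Implicit Types (F f u du g : R -> R).

Lemma is_derive_continuous f (x df : R) : is_derive x (1 : R) f df -> {for x, continuous f}.
Proof. by move=> [h _]; apply/differentiable_continuous/derivable1_diffP. Qed.

Lemma is_derive_within (a b : R) F f : (forall x, a <= x <= b -> is_derive x (1 : R) F (f x)) ->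
  {within `[a, b], continuous F}.
Proof.
move=> h; apply: derivable_within_continuous => x; rewrite in_itv /= => hx.
by case: (h x hx).
Qed.

Lemma is_derive_mono (a b : R) F f : a <= b ->
  (forall x, a <= x <= b -> is_derive x (1 : R) F (f x)) ->
  (forall x, a <= x <= b -> 0 <= f x) -> F a <= F b.
Proof.
move=> ab hF f0; rewrite -subr_ge0.
have h' x : x \in `]a, b[ -> is_derive x (1 : R) F (f x).
  by rewrite in_itv /= => /andP[h1 h2]; apply: hF; rewrite !ltW.
have [c cab ->] := MVT_segment ab h' (is_derive_within hF).
rewrite in_itv /= in cab; apply: mulr_ge0; [exact: f0|lra].
Qed.

Lemma ftc (a b : R) F f : a < b -> (forall x, a <= x <= b -> is_derive x (1 : R) F (f x)) ->
  continuous f -> Rintegral leb `]a, b[ f = F b - F a.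
Proof.
move=> ab hF cf.
have ic : leb.-integrable `[a, b] (EFin \o f).
  by apply: continuous_compact_integrable; [exact: segment_compact|exact: continuous_subspaceT].
have io : leb.-integrable `]a, b] (EFin \o f).
  by apply: integrableS ic => //; apply: subset_itv; rewrite bnd_simp.
have ioo : leb.-integrable `]a, b[ (EFin \o f).
  by apply: integrableS ic => //; apply: subset_itv; rewrite bnd_simp.
rewrite (Rintegral_itv_bndo_bndc ioo) (Rintegral_itv_obnd_cbnd io).
rewrite /Rintegral (@continuous_FTC2 _ _ F)//.
- exact: continuous_subspaceT.
- split.
  + by move=> x; rewrite in_itv /= => /andP[h1 h2]; have [] := hF x; rewrite ?ltW.
  + by apply/cvg_at_right_filter/(is_derive_continuous (hF a _)); rewrite lexx ltW.
  + by apply/cvg_at_left_filter/(is_derive_continuous (hF b _)); rewrite lexx ltW.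
- move=> x; rewrite in_itv /= => /andP[h1 h2]; rewrite derive1E.
  by have [|_ ->] := hF x; rewrite ?ltW.
Qed.

(** The interval is larger than the one of use, to avoid one-sided derivatives. *)
Lemma antiderivative g : continuous g ->
  exists H : R -> R, forall x : R, -1 < x < 1 -> is_derive x (1 : R) H (g x).
Proof.
move=> cg; exists (fun x => Rintegral leb `[-1, x] g) => x /andP[h1 h2].
have ic : leb.-integrable `[-1, 1] (EFin \o g).
  by apply: continuous_compact_integrable; [exact: segment_compact|exact: continuous_subspaceT].
have [d1 d2] := continuous_FTC1_closed h2 ic h1 (cg x).
split; first exact: d1.
by rewrite -derive1E; exact: d2.
Qed.

(** The ground state of the Dirichlet problem on the unit interval. *)
Definition kc (x : R) : R := cos (pi * x).
Definition ks (x : R) : R := sin (pi * x).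

Global Instance is_derive_kc (x : R) : is_derive x (1 : R) kc (- pi * ks x).
Proof.
have h : is_derive x (1 : R) ( *%R pi : R -> R) pi.
  have -> : ( *%R pi : R -> R) = pi *: (@id R) by apply/funext => y.
  by apply: is_derive_eq; rewrite /GRing.scale /= mulr1.
have := @is_derive1_comp _ _ _ x _ _ (is_derive_cos (pi * x)) h.
by rewrite mulNr mulrC -mulNr.
Qed.

Global Instance is_derive_ks (x : R) : is_derive x (1 : R) ks (pi * kc x).
Proof.
have h : is_derive x (1 : R) ( *%R pi : R -> R) pi.
  have -> : ( *%R pi : R -> R) = pi *: (@id R) by apply/funext => y.
  by apply: is_derive_eq; rewrite /GRing.scale /= mulr1.
have := @is_derive1_comp _ _ _ x _ _ (is_derive_sin (pi * x)) h.
by rewrite mulrC.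
Qed.

Lemma kc_gt0 x : - (1 / 2) < x < 1 / 2 -> 0 < kc x.
Proof.
move=> /andP[h1 h2]; apply: cos_gt0_pihalf; have := pi_gt0 R => p0.
by apply/andP; split; nra.
Qed.

Lemma kc_ks x : kc x ^+ 2 + ks x ^+ 2 = 1. Proof. exact: cos2Dsin2. Qed.

Section Gap1.
Variables (u du : R -> R) (rho : R).
Hypothesis hu : forall x, is_derive x (1 : R) u (du x).
Hypothesis cdu : continuous du.
Hypothesis rho_lt : rho < 1 / 2.
Hypothesis supp : forall x, rho <= `|x| -> u x = 0.

Let cu : continuous u.
Proof. by move=> x; exact: is_derive_continuous (hu x). Qed.

Let norm_half : `|1 / 2 : R| = 1 / 2. Proof. by rewrite ger0_norm. Qed.
Let u_right : u (1 / 2) = 0. Proof. by apply: supp; rewrite norm_half ltW. Qed.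
Let u_left : u (- (1 / 2)) = 0. Proof. by apply: supp; rewrite normrN norm_half ltW. Qed.

Lemma integral_derive0 : Rintegral leb I12 du = 0.
Proof.
rewrite /I12 (@ftc _ _ u)//; last by lra.
by rewrite u_right u_left subrr.
Qed.

Let g x := du x ^+ 2 - pi ^+ 2 * u x ^+ 2.
Let cg : continuous g.
Proof.
move=> x; apply: cvgB; first by apply: cvgM; exact: cdu.
by apply: cvgM; [exact: cvg_cst|apply: cvgM; exact: cu].
Qed.

Let near_supp (z : R) : 1 / 2 <= `|z| -> \forall t \near z, rho <= `|t|.
Proof.
move=> hz; near=> t; have : `|z - t| < 1 / 2 - rho.
  by near: t; apply: cvgr_dist_lt => //; rewrite subr_gt0.
have := lerB_dist z t; lra.
Unshelve. all: by end_near. Qed.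

(** The excess of the energy over its least value pi^2 |u|^2. *)
Definition deficit1 : R := Rintegral leb I12 g.

(** A pointwise form of the spectral gap. With T = ks / kc, Jacobi's identity
    u'^2 - pi^2 u^2 = (u' + pi T u)^2 - (pi T u^2)' shows that the excess
    dominates the integral of (u' + pi T u)^2 over [x, y]. As
    (u / kc)' = (u' + pi T u) / kc, the inequality of Cauchy and Schwarz (by
    way of the parameter s) bounds the squared increment of u / kc by the excess
    times the integral of 1 / kc^2, which is (T y - T x) / pi. Multiplication
    by the squares of kc x and kc y brings this last factor below 1. *)
Lemma deficit1P x y : - (1 / 2) < x -> x <= y -> y < 1 / 2 ->
  (u x * kc y - u y * kc x) ^+ 2 <= deficit1.
Proof.
move=> hx xy hy.
have [H hH] := antiderivative cg.
have E : deficit1 = H (1 / 2) - H (- (1 / 2)).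
  by apply: ftc => [|z hz|]; [lra|apply: hH; lra|exact: cg].
pose P z := H z + pi * (ks z / kc z) * u z ^+ 2.
have Pin (z : R) : - (1 / 2) < z < 1 / 2 -> is_derive z (1 : R) P ((du z + pi * (ks z / kc z) * u z) ^+ 2).
  move=> hz; have kz := kc_gt0 hz.
  have dH : is_derive z (1 : R) H (g z) by apply: hH; lra.
  have dk := @is_deriveV _ kc z _ 1 (lt0r_neq0 kz) (is_derive_kc z).
  have -> : P = H + (cst pi * (ks * (fun z => (kc z)^-1))) * u ^+ 2.
    by apply/funext => t; rewrite /P !fctE.
  apply: is_derive_eq; rewrite /GRing.scale /= !fctE /g.
  by have kn := lt0r_neq0 kz; field.
have Pend (z : R) : 1 / 2 <= `|z| -> -1 < z < 1 -> is_derive z (1 : R) P 0.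
  move=> hz hz1; have dH := hH z hz1.
  have z0 : u z = 0 by apply: supp; exact: le_trans (ltW rho_lt) hz.
  have g0 : g z = 0.
    rewrite /g z0 expr0n mulr0 subr0.
    suff -> : du z = 0 by rewrite expr0n.
    have [_ <-] := hu z.
    rewrite (@near_eq_derive _ _ _ u (cst 0)) ?derive_cst//.
    by near=> t; apply: supp; near: t; exact: near_supp.
  rewrite -g0; apply: (@near_eq_is_derive _ _ _ H) dH.
  by near=> t; rewrite /P supp ?expr0n ?mulr0 ?addr0//; near: t; exact: near_supp.
have hx1 : x < 1 / 2 by lra.
have hy1 : - (1 / 2) < y by lra.
pose p z := if `|z| < 1 / 2 then (du z + pi * (ks z / kc z) * u z) ^+ 2 else 0.
have dP (z : R) : - (1 / 2) <= z <= 1 / 2 -> is_derive z (1 : R) P (p z).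
  move=> hz; rewrite /p; case: ltP => h; last by apply: Pend => //; lra.
  by apply: Pin; move: h; rewrite ltr_norml.
have p0 z : 0 <= p z by rewrite /p; case: ifP => // _; exact: sqr_ge0.
have P1 : 0 <= P x - P (- (1 / 2)).
  rewrite subr_ge0; apply: (@is_derive_mono _ _ _ p); first exact: ltW.
    by move=> z hz; apply: dP; lra.
  by move=> z _; exact: p0.
have P2 : 0 <= P (1 / 2) - P y.
  rewrite subr_ge0; apply: (@is_derive_mono _ _ _ p); first exact: ltW.
    by move=> z hz; apply: dP; lra.
  by move=> z _; exact: p0.
have PH : P (1 / 2) - P (- (1/2)) = deficit1.
  by rewrite E /P u_right u_left !expr0n !mulr0 !addr0.
have kx := @kc_gt0 x ltac:(lra); have ky := @kc_gt0 y ltac:(lra).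
pose D := kc x * kc y.
have D0 : 0 < D by exact: mulr_gt0.
pose A := u y / kc y - u x / kc x.
pose B := (ks y / kc y - ks x / kc x) / pi.
have key s : 2 * s * A - s ^+ 2 * B <= P y - P x.
  pose F z := P z - 2 * s * (u z / kc z) + s ^+ 2 / pi * (ks z / kc z).
  suff : F x <= F y.
    rewrite /F /A /B; set a1 := u x / _; set a2 := u y / _.
    set b1 := ks x / _; set b2 := ks y / _.
    have -> : s ^+ 2 * ((b2 - b1) / pi) = s ^+ 2 / pi * b2 - s ^+ 2 / pi * b1 by ring.
    lra.
  apply: (@is_derive_mono _ _ _ (fun z => (du z + pi * (ks z / kc z) * u z - s / kc z) ^+ 2)) => //.
    move=> z hz; have hz1 : - (1 / 2) < z < 1 / 2 by lra.
    have kz := kc_gt0 hz1; have dPz := Pin z hz1.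
    have dk := @is_deriveV _ kc z _ 1 (lt0r_neq0 kz) (is_derive_kc z).
    have -> : F = P - cst (2 * s) * (u * (fun z => (kc z)^-1)) +
        cst (s ^+ 2 / pi) * (ks * (fun z => (kc z)^-1)).
      by apply/funext => t; rewrite /F !fctE.
    apply: is_derive_eq; rewrite /GRing.scale /= !fctE.
    have := kc_ks z; have kn := lt0r_neq0 kz; move: (ks z) (kc z) kn => s1 k kn ek.
    have pn : pi != 0 :> R by rewrite gt_eqF// pi_gt0.
    have e2 : s ^+ 2 / k ^+ 2 = s ^+ 2 / k ^+ 2 * (k ^+ 2 + s1 ^+ 2) by rewrite ek mulr1.
    have -> : (du z + pi * (s1 / k) * u z - s / k) ^+ 2 =
      (du z + pi * (s1 / k) * u z) ^+ 2 - 2 * (du z + pi * (s1 / k) * u z) * (s / k) + s ^+ 2 / k ^+ 2.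
      by field.
    by rewrite e2; move: (@pi R) pn => q qn; field; rewrite kn qn.
  by move=> z _; exact: sqr_ge0.
have BD : B * D ^+ 2 <= 1.
  have pg := pi_ge2 R.
  rewrite /B mulrAC ler_pdivrMr; last by lra.
  rewrite mul1r; apply: le_trans pg.
  have -> : (ks y / kc y - ks x / kc x) * D ^+ 2 = (ks y * kc y) * kc x ^+ 2 - (ks x * kc x) * kc y ^+ 2.
    by rewrite /D; field; rewrite !gt_eqF.
  have := kc_ks x; have := kc_ks y.
  move: (kc x) (ks x) (kc y) (ks y) => a b c d e1 e2.
  have h z t : z ^+ 2 + t ^+ 2 = 1 -> `|t * z| <= 1 :> R.
    move=> e; rewrite ler_norml; have := sqr_ge0 (z + t); have := sqr_ge0 (z - t).
    by rewrite sqrrB sqrrD => *; apply/andP; split; nra.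
  have k1 := le_trans (ler_norm _) (h _ _ e1).
  have k2 : - (b * a) <= 1 by apply: le_trans (h _ _ e2); rewrite -normrN ler_norm.
  have := sqr_ge0 a; have := sqr_ge0 b; have := sqr_ge0 c; have := sqr_ge0 d; nra.
have -> : u x * kc y - u y * kc x = - (A * D).
  by rewrite /A /D; field; rewrite !gt_eqF.
rewrite sqrrN.
have h := key (A * D ^+ 2).
have h2 : 0 <= (A * D) ^+ 2 * (1 - B * D ^+ 2) by rewrite mulr_ge0 ?sqr_ge0// subr_ge0.
have h3 : 2 * (A * D ^+ 2) * A - (A * D ^+ 2) ^+ 2 * B = (A * D) ^+ 2 + (A * D) ^+ 2 * (1 - B * D ^+ 2) by ring.
lra.
Unshelve. all: by end_near. Qed.

End Gap1.
End OneDim.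

(** * The spectral gap of the unit square *)

Section Slices.
Context {R : realType}.
Implicit Types (f : R * R -> R) (p : R * R).

Let quotient1 f p : (fun h : R => h^-1 *: (f (h *: e1 + p) - f p)) =
  (fun h : R => h^-1 *: (f (h *: (1 : R) + p.1, p.2) - f (p.1, p.2))).
Proof.
apply/funext => h; congr (_ *: (f _ - f _)); last by case: p.
by rewrite /e1; case: p => x y /=; congr (_, _); rewrite /= scaler0 add0r.
Qed.
Let quotient2 f p : (fun h : R => h^-1 *: (f (h *: e2 + p) - f p)) =
  (fun h : R => h^-1 *: (f (p.1, h *: (1 : R) + p.2) - f (p.1, p.2))).
Proof.
apply/funext => h; congr (_ *: (f _ - f _)); last by case: p.
by rewrite /e2; case: p => x y /=; congr (_, _); rewrite /= scaler0 add0r.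
Qed.

Lemma derivable_slice1 f p : derivable f p e1 = derivable (fun t => f (t, p.2)) p.1 1.
Proof. by rewrite /derivable quotient1. Qed.
Lemma derivable_slice2 f p : derivable f p e2 = derivable (fun t => f (p.1, t)) p.2 1.
Proof. by rewrite /derivable quotient2. Qed.
Lemma derive_slice1 f p : 'D_e1 f p = 'D_1 (fun t => f (t, p.2)) p.1.
Proof. by rewrite /derive quotient1. Qed.
Lemma derive_slice2 f p : 'D_e2 f p = 'D_1 (fun t => f (p.1, t)) p.2.
Proof. by rewrite /derive quotient2. Qed.

End Slices.

Section C1.
Context {R : realType}.
Implicit Types (f g F : R * R -> R).

Record C1 f : Prop := MkC1 {
  C1_cont : continuous f;
  C1_der1 : forall p, derivable f p e1;
  C1_der2 : forall p, derivable f p e2;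
  C1_cont1 : continuous (fun p => 'D_e1 f p);
  C1_cont2 : continuous (fun p => 'D_e2 f p) }.

(** The margin below 1/2 makes the derivatives vanish near the boundary, too. *)
Definition in_box f : Prop := exists2 rho : R, rho < 1 / 2 &
  forall p : R * R, rho <= `|p.1| \/ rho <= `|p.2| -> f p = 0.

Lemma C1_is_derive1 f x y : C1 f -> is_derive x (1 : R) (fun t => f (t, y)) ('D_e1 f (x, y)).
Proof.
move=> cf; split; first by rewrite -(derivable_slice1 f (x, y)); exact: C1_der1.
by rewrite derive_slice1.
Qed.
Lemma C1_is_derive2 f x y : C1 f -> is_derive y (1 : R) (fun t => f (x, t)) ('D_e2 f (x, y)).
Proof.
move=> cf; split; first by rewrite -(derivable_slice2 f (x, y)); exact: C1_der2.
by rewrite derive_slice2.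
Qed.

Lemma continuous_slice1 f y : continuous f -> continuous (fun t => f (t, y)).
Proof.
move=> cf t.
apply: (@continuous2_cvg _ _ _ _ (nbhs t) _ id (cst y) (fun a b => f (a, b)) t y).
- have -> : (fun z => f (z.1, z.2)) = f by apply/funext => -[].
  exact: cf.
- exact: cvg_id.
- exact: cvg_cst.
Qed.
Lemma continuous_slice2 f x : continuous f -> continuous (fun t => f (x, t)).
Proof.
move=> cf t.
apply: (@continuous2_cvg _ _ _ _ (nbhs t) _ (cst x) id (fun a b => f (a, b)) x t).
- have -> : (fun z => f (z.1, z.2)) = f by apply/funext => -[].
  exact: cf.
- exact: cvg_cst.
- exact: cvg_id.
Qed.

Lemma derive_tensor1 (g h dg : R -> R) p : (forall x, is_derive x (1 : R) g (dg x)) ->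
  is_derive p e1 (fun p => g p.1 * h p.2) (dg p.1 * h p.2).
Proof.
move=> hg; have H : is_derive p.1 (1 : R) (fun t => g t * h p.2) (dg p.1 * h p.2).
  have -> : (fun t => g t * h p.2) = (h p.2) *: g by apply/funext => t; rewrite mulrC.
  by apply: is_derive_eq; rewrite /GRing.scale /= mulrC.
by case: H => H1 H2; split; rewrite ?derivable_slice1// derive_slice1.
Qed.
Lemma derive_tensor2 (g h dh : R -> R) p : (forall x, is_derive x (1 : R) h (dh x)) ->
  is_derive p e2 (fun p => g p.1 * h p.2) (g p.1 * dh p.2).
Proof.
move=> hg; have H : is_derive p.2 (1 : R) (fun t => g p.1 * h t) (g p.1 * dh p.2).
  have -> : (fun t => g p.1 * h t) = (g p.1) *: h by [].
  exact: is_derive_eq.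
by case: H => H1 H2; split; rewrite ?derivable_slice2// derive_slice2.
Qed.

Lemma continuous_tensor (g h : R -> R) : continuous g -> continuous h ->
  continuous (fun p : R * R => g p.1 * h p.2).
Proof.
move=> cg ch p; apply: cvgM.
  by apply: (@continuous_comp _ _ _ fst g); [exact: cvg_fst|exact: cg].
by apply: (@continuous_comp _ _ _ snd h); [exact: cvg_snd|exact: ch].
Qed.

Lemma C1_tensor (g h dg dh : R -> R) : (forall x, is_derive x (1 : R) g (dg x)) ->
  (forall x, is_derive x (1 : R) h (dh x)) -> continuous dg -> continuous dh ->
  C1 (fun p => g p.1 * h p.2).
Proof.
move=> hg hh cdg cdh.
have cg : continuous g by move=> x; exact: is_derive_continuous (hg x).
have ch : continuous h by move=> x; exact: is_derive_continuous (hh x).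
split.
- exact: continuous_tensor.
- by move=> p; case: (derive_tensor1 h p hg).
- by move=> p; case: (derive_tensor2 g p hh).
- have -> : (fun p => 'D_e1 (fun p => g p.1 * h p.2) p) = (fun p => dg p.1 * h p.2).
    by apply/funext => p; case: (derive_tensor1 h p hg).
  exact: continuous_tensor.
- have -> : (fun p => 'D_e2 (fun p => g p.1 * h p.2) p) = (fun p => g p.1 * dh p.2).
    by apply/funext => p; case: (derive_tensor2 g p hh).
  exact: continuous_tensor.
Qed.

Lemma C1_mul_derive1 f g p : C1 f -> C1 g ->
  'D_e1 (fun p => f p * g p) p = f p * 'D_e1 g p + g p * 'D_e1 f p.
Proof.
by move=> cf cg; rewrite -[LHS]/('D_e1 (f * g) p) deriveM//; [exact: C1_der1|exact: C1_der1].
Qed.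
Lemma C1_mul_derive2 f g p : C1 f -> C1 g ->
  'D_e2 (fun p => f p * g p) p = f p * 'D_e2 g p + g p * 'D_e2 f p.
Proof.
by move=> cf cg; rewrite -[LHS]/('D_e2 (f * g) p) deriveM//; [exact: C1_der2|exact: C1_der2].
Qed.

Lemma C1M f g : C1 f -> C1 g -> C1 (fun p => f p * g p).
Proof.
move=> cf cg; split.
- by move=> p; apply: cvgM; [exact: C1_cont cf p|exact: C1_cont cg p].
- by move=> p; apply: derivableM; exact: C1_der1.
- by move=> p; apply: derivableM; exact: C1_der2.
- have -> : (fun p => 'D_e1 (fun p => f p * g p) p) = (fun p => f p * 'D_e1 g p + g p * 'D_e1 f p).
    by apply/funext => p; rewrite C1_mul_derive1.
  by move=> p; apply: cvgD; apply: cvgM; [exact: C1_cont cf p|exact: C1_cont1 cg p|exact: C1_cont cg p|exact: C1_cont1 cf p].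
- have -> : (fun p => 'D_e2 (fun p => f p * g p) p) = (fun p => f p * 'D_e2 g p + g p * 'D_e2 f p).
    by apply/funext => p; rewrite C1_mul_derive2.
  by move=> p; apply: cvgD; apply: cvgM; [exact: C1_cont cf p|exact: C1_cont2 cg p|exact: C1_cont cg p|exact: C1_cont2 cf p].
Qed.

Lemma in_boxM f g : in_box f -> in_box (fun p => g p * f p).
Proof. by move=> [rho h1 h2]; exists rho => // p /h2 ->; rewrite mulr0. Qed.

Lemma near_out_box f p : in_box f -> 1 / 2 <= `|p.1| \/ 1 / 2 <= `|p.2| ->
  \forall q \near p, f q = 0.
Proof.
move=> [rho h1 h2] hp.
have d0 : 0 < 1 / 2 - rho by rewrite subr_gt0.
case: hp => hp; near=> q; apply: h2; [left|right].
  have : `|p.1 - q.1| < 1 / 2 - rho.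
    by near: q; apply: (@cvgr_dist_lt _ _ _ (nbhs p)) => //; exact: cvg_fst.
  by have := lerB_dist p.1 q.1; lra.
have : `|p.2 - q.2| < 1 / 2 - rho.
  by near: q; apply: (@cvgr_dist_lt _ _ _ (nbhs p)) => //; exact: cvg_snd.
by have := lerB_dist p.2 q.2; lra.
Unshelve. all: by end_near. Qed.

Lemma derive_out_box f e p : in_box f -> 1 / 2 <= `|p.1| \/ 1 / 2 <= `|p.2| -> 'D_e f p = 0.
Proof.
move=> bf hp; rewrite (@near_eq_derive _ _ _ f (cst 0)) ?derive_cst//.
exact: near_out_box.
Qed.

Lemma bm2_box f : continuous f ->
  (forall p, 1 / 2 <= `|p.1| \/ 1 / 2 <= `|p.2| -> f p = 0) -> bm2 f.
Proof.
move=> cf h; split; first exact: continuous_measurable_plane.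
pose K : set (R * R) := `[- (1 / 2), 1 / 2] `*` `[- (1 / 2), 1 / 2].
have cK : compact K by apply: compact_setX; exact: segment_compact.
have K0 : K !=set0 by exists (0, 0); split; rewrite /= in_itv /=; lra.
have cn : {within K, continuous (fun p => `|f p|)}.
  by apply: continuous_subspaceT => p; apply: cvg_norm; exact: cf.
have [c cK1 hc] := compact_EVT_max K0 cK cn.
exists `|f c| => p.
have [h1|h1] := leP (1 / 2) `|p.1|; first by rewrite h ?normr0//; left.
have [h2|h2] := leP (1 / 2) `|p.2|; first by rewrite h ?normr0//; right.
apply: hc; rewrite inE; move: h1 h2; rewrite !ltr_norml => h1 h2.
by split; rewrite /= in_itv /=; lra.
Qed.

Lemma C1_bm f : C1 f -> in_box f -> [/\ bm2 f, bm2 (fun p => 'D_e1 f p) & bm2 (fun p => 'D_e2 f p)].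
Proof.
move=> cf bf; split; apply: bm2_box.
- exact: C1_cont.
- by move=> p hp; have /nbhs_singleton := near_out_box bf hp.
- exact: C1_cont1.
- by move=> p; exact: derive_out_box.
- exact: C1_cont2.
- by move=> p; exact: derive_out_box.
Qed.

Lemma int_derive1_eq0 f : C1 f -> in_box f -> Rintegral (mu2 R) sq1 (fun p => 'D_e1 f p) = 0.
Proof.
move=> cf bf; have [_ b1 _] := C1_bm cf bf; have [rho r1 r2] := bf.
have h y : Rintegral (@lebesgue_measure R) I12 (fun x => 'D_e1 f (x, y)) = 0.
  apply: (@integral_derive0 _ (fun t => f (t, y)) (fun x => 'D_e1 f (x, y)) rho).
  - by move=> x; exact: C1_is_derive1.
  - exact: (continuous_slice1 (C1_cont1 cf)).
  - exact: r1.
  - by move=> x hx; apply: r2; left.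
rewrite (fubini_slice1 b1).2 (@eq_Rintegral _ _ _ _ _ (cst 0)) => [|y _]; last exact: h.
by rewrite /Rintegral integral0.
Qed.

Lemma int_derive2_eq0 f : C1 f -> in_box f -> Rintegral (mu2 R) sq1 (fun p => 'D_e2 f p) = 0.
Proof.
move=> cf bf; have [_ _ b1] := C1_bm cf bf; have [rho r1 r2] := bf.
have h x : Rintegral (@lebesgue_measure R) I12 (fun y => 'D_e2 f (x, y)) = 0.
  apply: (@integral_derive0 _ (fun t => f (x, t)) (fun y => 'D_e2 f (x, y)) rho).
  - by move=> y; exact: C1_is_derive2.
  - exact: (continuous_slice2 (C1_cont2 cf)).
  - exact: r1.
  - by move=> y hy; apply: r2; right.
rewrite (fubini_slice2 b1).2 (@eq_Rintegral _ _ _ _ _ (cst 0)) => [|x _]; last exact: h.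
by rewrite /Rintegral integral0.
Qed.

Section BmIntegral.
Context d (T : measurableType d) (mu : {measure set T -> \bar R}) (D : set T).
Hypotheses (mD : measurable D) (fD : (mu D < +oo)%E).
Implicit Types u v : T -> R.

Lemma bm_RintD u v : bm u -> bm v ->
  Rintegral mu D (fun x => u x + v x) = Rintegral mu D u + Rintegral mu D v.
Proof. by move=> bu bv; rewrite RintegralD//; exact: bm_integrable. Qed.
Lemma bm_RintB u v : bm u -> bm v ->
  Rintegral mu D (fun x => u x - v x) = Rintegral mu D u - Rintegral mu D v.
Proof. by move=> bu bv; rewrite RintegralB//; exact: bm_integrable. Qed.
Lemma bm_RintZ a u : bm u -> Rintegral mu D (fun x => a * u x) = a * Rintegral mu D u.
Proof. by move=> bu; rewrite RintegralZl//; exact: bm_integrable. Qed.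

End BmIntegral.

Lemma I12_cst (c : R) : Rintegral (@lebesgue_measure R) I12 (fun _ => c) = c.
Proof.
etransitivity; first exact: (Rintegral_cst _ mI12 c).
transitivity (c * fine (@lebesgue_measure R I12)); first by [].
by rewrite leb_I12 /= mulr1.
Qed.

Lemma affine_integral (f : R -> R) (c : R) :
  (@lebesgue_measure R).-integrable I12 (EFin \o f) ->
  (@lebesgue_measure R).-integrable I12 (EFin \o (fun x => 2 * f x + c)) /\
  Rintegral (@lebesgue_measure R) I12 (fun x => 2 * f x + c) =
  2 * Rintegral (@lebesgue_measure R) I12 f + c.
Proof.
move=> fi; have i1 : (@lebesgue_measure R).-integrable I12 (EFin \o (fun x => 2 * f x)).
  by have := integrableZl mI12 2 fi; apply: eq_integrable => //; exact: mI12.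
have i2 : (@lebesgue_measure R).-integrable I12 (EFin \o (fun _ => c)).
  by apply: (bm_integrable mI12 leb_fin); exact: bm_cst.
split.
  by have := integrableD mI12 i1 i2; apply: eq_integrable => //; exact: mI12.
rewrite RintegralD//; try exact: mI12.
rewrite RintegralZl//; try exact: mI12.
by rewrite I12_cst.
Qed.

Lemma gap2_arith (a1 a2 n V Y q : R) :
  2 * (n * V - Y ^+ 2) <= 2 * (a2 - q * n) + 2 * (a1 - q * n) ->
  n * V - Y ^+ 2 <= a1 + a2 - 2 * q * n.
Proof. lra. Qed.

Section Gap2.
Variable F : R * R -> R.
Hypotheses (cF : C1 F) (bF : in_box F).
Local Notation leb := (@lebesgue_measure R).
Local Notation int2 := (Rintegral (mu2 R) sq1).

Definition wf (p : R * R) : R := kc p.1 * kc p.2.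

Let E1 y := deficit1 (fun x => F (x, y)) (fun x => 'D_e1 F (x, y)).
Let E2 x := deficit1 (fun y => F (x, y)) (fun y => 'D_e2 F (x, y)).

Let E1P x x' y : I12 x -> I12 x' -> (F (x, y) * kc x' - F (x', y) * kc x) ^+ 2 <= E1 y.
Proof.
rewrite /I12 /= !in_itv /= => /andP[h1 h2] /andP[h3 h4]; have [rho r1 r2] := bF.
have main a b : - (1 / 2) < a -> a <= b -> b < 1 / 2 ->
    (F (a, y) * kc b - F (b, y) * kc a) ^+ 2 <= E1 y.
  move=> ha ab hb; apply: (@deficit1P _ (fun x => F (x, y)) _ rho) => //.
  - by move=> t; exact: C1_is_derive1.
  - exact: (continuous_slice1 (C1_cont1 cF)).
  - by move=> t ht; apply: r2; left.
have [xx|xx] := leP x x'; first exact: main.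
rewrite -sqrrN opprB; apply: main => //; exact: ltW.
Qed.

Let E2P x y y' : I12 y -> I12 y' -> (F (x, y) * kc y' - F (x, y') * kc y) ^+ 2 <= E2 x.
Proof.
rewrite /I12 /= !in_itv /= => /andP[h1 h2] /andP[h3 h4]; have [rho r1 r2] := bF.
have main a b : - (1 / 2) < a -> a <= b -> b < 1 / 2 ->
    (F (x, a) * kc b - F (x, b) * kc a) ^+ 2 <= E2 x.
  move=> ha ab hb; apply: (@deficit1P _ (fun y => F (x, y)) _ rho) => //.
  - by move=> t; exact: C1_is_derive2.
  - exact: (continuous_slice2 (C1_cont2 cF)).
  - by move=> t ht; apply: r2; right.
have [xx|xx] := leP y y'; first exact: main.
rewrite -sqrrN opprB; apply: main => //; exact: ltW.
Qed.

Let kc_le1 (x : R) : `|kc x| <= 1.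
Proof. by rewrite ler_norml; apply/andP; split; [exact: cos_geN1|exact: cos_le1]. Qed.

(** The two points are joined through (x', y), by a horizontal and a vertical
    segment. *)
Let pair_bound x y x' y' : I12 x -> I12 y -> I12 x' -> I12 y' ->
  (F (x, y) * wf (x', y') - F (x', y') * wf (x, y)) ^+ 2 <= 2 * E1 y + 2 * E2 x'.
Proof.
move=> hx hy hx' hy'; rewrite /wf /=.
have e1 := E1P y hx hx'; have e2 := E2P x' hy hy'.
set a := F (x, y) * kc x' - F (x', y) * kc x in e1.
set b := F (x', y) * kc y' - F (x', y') * kc y in e2.
have -> : F (x, y) * (kc x' * kc y') - F (x', y') * (kc x * kc y) = kc y' * a + kc x * b.
  by rewrite /a /b; ring.
have sq (t c : R) : (kc t * c) ^+ 2 <= c ^+ 2.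
  rewrite exprMn ler_piMl ?sqr_ge0// -(real_normK (num_real (kc t))).
  by apply: exprn_ile1 => //; exact: kc_le1.
have := sq y' a; have := sq x b; have := sqr_ge0 (kc y' * a - kc x * b).
move: (kc y' * a) (kc x * b) => A B; nra.
Qed.

Let cw : continuous wf.
Proof.
apply: continuous_tensor => x; exact: is_derive_continuous (is_derive_kc x).
Qed.

Let bw : bm2 wf.
Proof.
split; first exact: continuous_measurable_plane.
by exists 1 => p; rewrite normrM mulr_ile1//; exact: kc_le1.
Qed.

Let b0 : bm2 F. Proof. by have [] := C1_bm cF bF. Qed.
Let b1 : bm2 (fun p => 'D_e1 F p). Proof. by have [] := C1_bm cF bF. Qed.
Let b2 : bm2 (fun p => 'D_e2 F p). Proof. by have [] := C1_bm cF bF. Qed.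

Let m := int2 (fun p => F p ^+ 2).
Let W := int2 (fun p => wf p ^+ 2).
Let X := int2 (fun p => F p * wf p).
Let G1 p := 'D_e1 F p ^+ 2 - pi ^+ 2 * F p ^+ 2.
Let G2 p := 'D_e2 F p ^+ 2 - pi ^+ 2 * F p ^+ 2.
Let bG1 : bm2 G1.
Proof. by apply: bmB; [exact: bmX|apply: bmM; [exact: bm_cst|exact: bmX]]. Qed.
Let bG2 : bm2 G2.
Proof. by apply: bmB; [exact: bmX|apply: bmM; [exact: bm_cst|exact: bmX]]. Qed.

Let H q := m * wf q ^+ 2 - 2 * X * (F q * wf q) + W * F q ^+ 2.
Let bH : bm2 H.
Proof.
apply: bmD; last by apply: bmM; [exact: bm_cst|exact: bmX].
apply: bmB; apply: bmM; [exact: bm_cst|exact: bmX|exact: bm_cst|exact: bmM].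
Qed.

Let HE q : int2 (fun p => (F p * wf q - F q * wf p) ^+ 2) = H q.
Proof.
have -> : (fun p => (F p * wf q - F q * wf p) ^+ 2) = (fun p =>
   wf q ^+ 2 * F p ^+ 2 - 2 * (wf q * F q) * (F p * wf p) + F q ^+ 2 * wf p ^+ 2).
  by apply/funext => p; ring.
have c1 : bm2 (fun p => wf q ^+ 2 * F p ^+ 2) by apply: bmM; [exact: bm_cst|exact: bmX].
have c2 : bm2 (fun p => 2 * (wf q * F q) * (F p * wf p)) by apply: bmM; [exact: bm_cst|exact: bmM].
have c3 : bm2 (fun p => F q ^+ 2 * wf p ^+ 2) by apply: bmM; [exact: bm_cst|exact: bmX].
rewrite (bm_RintD msq1 mu2_fin (bmB c1 c2) c3) (bm_RintB msq1 mu2_fin c1 c2).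
rewrite (bm_RintZ msq1 mu2_fin _ (bmX 2 b0)) (bm_RintZ msq1 mu2_fin _ (bmX 2 bw)).
rewrite (bm_RintZ msq1 mu2_fin _ (bmM b0 bw)) -/m -/W -/X /H; ring.
Qed.

Let first_integration x' y' : I12 x' -> I12 y' -> H (x', y') <= 2 * int2 G1 + 2 * E2 x'.
Proof.
move=> hx' hy'; rewrite -HE.
set P := fun p => (F p * wf (x', y') - F (x', y') * wf p) ^+ 2.
have bP : bm2 P.
  by apply: (bmX 2); apply: bmB; apply: bmM; [exact: b0|exact: bm_cst|exact: bm_cst|exact: bw].
have [i1 ->] := fubini_slice1 bP; have [i2 ->] := fubini_slice1 bG1.
have [i3 <-] := affine_integral (2 * E2 x') i2.
apply: le_Rintegral => //; first exact: mI12.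
move=> y hy.
have bPy : bm1 (fun x => P (x, y)) by exact: bm_slice1.
apply: (@le_trans _ _ (Rintegral leb I12 (fun _ => 2 * E1 y + 2 * E2 x'))).
  apply: le_Rintegral; first exact: mI12.
  - exact: (bm_integrable mI12 leb_fin bPy).
  - by apply: (bm_integrable mI12 leb_fin); exact: bm_cst.
  - by move=> x hx; exact: pair_bound.
by rewrite I12_cst.
Qed.

(** Integrate [pair_bound] over both points of the square. The left-hand side
    becomes 2 (m W - X^2), and each one-dimensional excess is integrated over a
    set of measure 1. *)
Lemma gap2 : m * W - X ^+ 2 <=
  int2 (fun p => 'D_e1 F p ^+ 2) + int2 (fun p => 'D_e2 F p ^+ 2) - 2 * pi ^+ 2 * m.
Proof.
have e1 : int2 G1 = int2 (fun p => 'D_e1 F p ^+ 2) - pi ^+ 2 * m.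
  have c1 : bm2 (fun p => pi ^+ 2 * F p ^+ 2) by apply: bmM; [exact: bm_cst|exact: bmX].
  transitivity (int2 (fun p => 'D_e1 F p ^+ 2) - int2 (fun p => pi ^+ 2 * F p ^+ 2)).
    exact: (bm_RintB msq1 mu2_fin (bmX 2 b1) c1).
  by congr (_ - _); exact: (bm_RintZ msq1 mu2_fin (pi ^+ 2) (bmX 2 b0)).
have e2 : int2 G2 = int2 (fun p => 'D_e2 F p ^+ 2) - pi ^+ 2 * m.
  have c1 : bm2 (fun p => pi ^+ 2 * F p ^+ 2) by apply: bmM; [exact: bm_cst|exact: bmX].
  transitivity (int2 (fun p => 'D_e2 F p ^+ 2) - int2 (fun p => pi ^+ 2 * F p ^+ 2)).
    exact: (bm_RintB msq1 mu2_fin (bmX 2 b2) c1).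
  by congr (_ - _); exact: (bm_RintZ msq1 mu2_fin (pi ^+ 2) (bmX 2 b0)).
have h1 : int2 H = 2 * (m * W - X ^+ 2).
  have c1 : bm2 (fun p => m * wf p ^+ 2) by apply: bmM; [exact: bm_cst|exact: bmX].
  have c2 : bm2 (fun p => 2 * X * (F p * wf p)) by apply: bmM; [exact: bm_cst|exact: bmM].
  have c3 : bm2 (fun p => W * F p ^+ 2) by apply: bmM; [exact: bm_cst|exact: bmX].
  rewrite (bm_RintD msq1 mu2_fin (bmB c1 c2) c3) (bm_RintB msq1 mu2_fin c1 c2).
  rewrite (bm_RintZ msq1 mu2_fin _ (bmX 2 b0)) (bm_RintZ msq1 mu2_fin _ (bmX 2 bw)).
  by rewrite (bm_RintZ msq1 mu2_fin _ (bmM b0 bw)) -/m -/W -/X; ring.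
have h2 : int2 H <= 2 * int2 G2 + 2 * int2 G1.
  have [i1 ->] := fubini_slice2 bH; have [i2 ->] := fubini_slice2 bG2.
  have [i3 <-] := affine_integral (2 * int2 G1) i2.
  apply: le_Rintegral => //; first exact: mI12.
  move=> x hx.
  apply: (@le_trans _ _ (Rintegral leb I12 (fun _ => 2 * E2 x + 2 * int2 G1))).
    apply: le_Rintegral; first exact: mI12.
    - by apply: (bm_integrable mI12 leb_fin); exact: bm_slice2.
    - by apply: (bm_integrable mI12 leb_fin); exact: bm_cst.
    - by move=> y hy; rewrite addrC; exact: first_integration.
  by rewrite I12_cst.
by apply: gap2_arith; rewrite -h1; apply: (le_trans h2); rewrite e1 e2.
Qed.

End Gap2.
End C1.

(** * Smooth functions of one real variable *)

Section Smooth1.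
Context {R : realType}.
Implicit Types (f g h df dg : R -> R).

Fixpoint Dk (k : nat) f : Prop :=
  if k is k'.+1 then exists2 df, (forall x : R, is_derive x (1 : R) f (df x)) & Dk k' df
  else True.

Definition smooth1 f := forall k, Dk k f.

Lemma DkS k f : Dk k.+1 f -> Dk k f.
Proof. by elim: k f => // k IH f [df hf /IH h]; exists df. Qed.

Lemma Dk_cst k (c : R) : Dk k (fun _ => c).
Proof.
elim: k c => // k IH c; exists (fun _ => 0); last exact: IH.
by move=> x; exact: is_derive_cst.
Qed.

Lemma Dk_lin k f g (a b : R) : Dk k f -> Dk k g -> Dk k (fun x => a * f x + b * g x).
Proof.
elim: k f g => // k IH f g [df hf kf] [dg hg kg].
exists (fun x => a * df x + b * dg x); last exact: IH.
move=> x; have h1 := hf x; have h2 := hg x.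
exact: (@is_deriveD _ _ _ (a \*: f) (b \*: g) x 1 (a *: df x) (b *: dg x)).
Qed.

Lemma DkM k f g : Dk k f -> Dk k g -> Dk k (fun x => f x * g x).
Proof.
elim: k f g => // k IH f g hf hg; have f0 := DkS hf; have g0 := DkS hg.
case: hf => df hf kf; case: hg => dg hg kg.
exists (fun x => 1 * (f x * dg x) + 1 * (g x * df x)).
  move=> x; have h1 := hf x; have h2 := hg x; rewrite !mul1r.
  exact: (@is_deriveM _ _ f g x 1 (df x) (dg x)).
by apply: Dk_lin; exact: IH.
Qed.

Lemma Dk_comp k f g : Dk k f -> Dk k g -> Dk k (fun x => f (g x)).
Proof.
elim: k f g => // k IH f g hf hg; have g0 := DkS hg.
case: hf => df hf kf; case: hg => dg hg kg.
exists (fun x => df (g x) * dg x); last by apply: DkM => //; exact: IH.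
by move=> x; have h1 := hf (g x); have h2 := hg x; exact: is_derive1_comp.
Qed.

Lemma Dk_id k : Dk k (fun x => x).
Proof. by case: k => // k; exists (fun _ => 1); [move=> x; exact: is_derive_id|exact: Dk_cst]. Qed.

Lemma smooth1_derive f : smooth1 f -> exists2 df, (forall x : R, is_derive x (1 : R) f (df x)) & smooth1 df.
Proof.
move=> sf; have [df hf _] := sf 1%N; exists df => // k.
have [dg hg kg] := sf k.+1; suff -> : df = dg by [].
by apply/funext => x; have [_ <-] := hf x; have [_ <-] := hg x.
Qed.

Lemma smooth1_seq f : smooth1 f -> exists d : nat -> R -> R, d 0%N = f /\
  forall n x, is_derive x (1 : R) (d n) (d n.+1 x).
Proof.
move=> sf; pose S := {f | smooth1 f}.
have /choice[nx hn] : forall s : S, exists t : S, forall x : R, is_derive x (1 : R) (sval s) (sval t x).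
  by move=> [g sg]; have [dg h1 h2] := smooth1_derive sg; exists (exist _ dg h2).
pose d n := iter n nx (exist _ f sf : S).
by exists (fun n => sval (d n)); split => // n x; exact: hn.
Qed.

Lemma smooth1_kc : smooth1 kc.
Proof.
move=> k; suff : Dk k kc /\ Dk k ks by case.
elim: k => // k [h1 h2]; split.
  exists (fun x => (- pi) * ks x + 0 * ks x); last exact: Dk_lin.
  by move=> x; rewrite mul0r addr0; exact: is_derive_kc.
exists (fun x => pi * kc x + 0 * kc x); last exact: Dk_lin.
by move=> x; rewrite mul0r addr0; exact: is_derive_ks.
Qed.

(** The functions t^-j e^(-1/t), extended by 0: derivatives of members of the
    family are combinations of members. *)
Definition hb (j : nat) (t : R) : R := if 0 < t then t ^- j * expR (- t^-1) else 0.

Lemma powX_le_exp n (s : R) : 0 <= s -> s ^+ n.+1 * expR (- s) <= n.+1`!%:R.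
Proof.
move=> s0; have := expR_ge1Dxn n s0; rewrite expRN ler_pdivrMr ?expR_gt0// => h.
have f0 : 0 < (n.+1)`!%:R :> R by rewrite ltr0n fact_gt0.
rewrite mulrC -ler_pdivrMr//; lra.
Qed.

Lemma hb_ge0 j t : 0 <= hb j t.
Proof.
rewrite /hb; case: ifP => // t0.
by rewrite mulr_ge0 ?expR_ge0// invr_ge0 exprn_ge0// ltW.
Qed.

(** Flatness at 0, from e^s >= s^n / n! with s = 1/t. *)
Lemma hb_le j n t : hb j t <= (j + n).+1`!%:R * `|t| ^+ n.+1.
Proof.
rewrite /hb; case: ifP => t0; last by rewrite mulr_ge0// exprn_ge0.
rewrite gtr0_norm//.
have s0 : 0 <= t^-1 by rewrite invr_ge0 ltW.
have := powX_le_exp (j + n) s0.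
have -> : t^-1 ^+ (j + n).+1 = t ^- j * t ^- n.+1.
  by rewrite -addnS exprVn exprD invfM.
rewrite mulrAC ler_pdivrMr; last by rewrite exprn_gt0.
by [].
Qed.

Lemma is_derive_hb j (t : R) : is_derive t (1 : R) (hb j) (hb j.+2 t - j%:R * hb j.+1 t).
Proof.
have [t0|t0|->] := ltgtP t 0.
- have h : forall k, hb k t = 0 by move=> k; rewrite /hb ltNge ltW.
  have c0 : is_derive t (1 : R) (cst (0 : R)) (0 : R) by exact: is_derive_cst.
  rewrite !h mulr0 subr0; apply: (near_eq_is_derive _ c0).
  by near=> z; rewrite /hb ifF//; apply/negbTE; rewrite -leNgt ltW//; near: z; exact: lt_nbhsl.
- have tn : t != 0 by rewrite gt_eqF.
  have di := @is_deriveV _ (@id R) t 1 1 tn (is_derive_id _ _).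
  have dx := @is_deriveX _ _ _ j t 1 _ di.
  have dn := @is_deriveN _ _ _ _ t 1 _ di.
  have de := @is_derive1_comp _ _ _ t _ _ (is_derive_expR (- t^-1)) dn.
  have dm := is_deriveM dx de.
  have e : \near t, ((fun y : R => y^-1) ^+ j * (expR \o (- (fun y : R => y^-1)))) t = hb j t.
    near=> z; have z0 : 0 < z by near: z; exact: lt_nbhsr.
    by rewrite /hb z0 -exprVn !fctE.
  have := near_eq_is_derive e dm; rewrite /hb t0.
  move=> H; apply: (is_derive_eq H); rewrite /GRing.scale /= !fctE.
  move: (expR (- t^-1)) => E.
  case: j {H dx dm e} => [|j]; first by field.
  by rewrite /= -!exprVn !exprS; field.
- have h k : hb k (0 : R) = 0 by rewrite /hb ltxx.
  rewrite !h mulr0 subr0.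
  apply: (@is_derive_quadratic _ _ _ _ ((j + 1).+1`!%:R) 1) => // b _.
  rewrite h !subr0 mulr0 subr0 ger0_norm ?hb_ge0//.
  by rewrite -(real_normK (num_real b)); exact: hb_le.
Unshelve. all: by end_near. Qed.

Lemma smooth1_hb j : smooth1 (hb j).
Proof.
move=> k; elim: k j => // k IH j; exists (fun x => 1 * hb j.+2 x + (- j%:R) * hb j.+1 x).
  by move=> x; rewrite mul1r mulNr; exact: is_derive_hb.
exact: Dk_lin.
Qed.

End Smooth1.

(** * Real test functions *)

Section TestFunctions.
Context {R : realType}.
Implicit Types (f g : R * R -> R) (u : R * R -> R[i]) (Omega K : set (R * R)).

Lemma Ck_lin k (a : R) f g : Ck k f -> Ck k g -> Ck k (fun p => a * f p + g p).
Proof.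
elim: k f g => [|k IH] f g /= [cf hf] [cg hg].
  by split=> // p; apply: cvgD; [apply: cvgM; [exact: cvg_cst|exact: cf]|exact: cg].
split; first by move=> p; apply: cvgD; [apply: cvgM; [exact: cvg_cst|exact: cf]|exact: cg].
case: hf => f1 f2 f3 f4; case: hg => g1 g2 g3 g4.
have d e p : derivable f p e -> derivable g p e ->
    is_derive p e (fun p => a * f p + g p) (a * 'D_e f p + 'D_e g p).
  move=> df dg; have hf := derivableP df; have hg := derivableP dg.
  exact: (@is_deriveD _ _ _ (a \*: f) g p e (a *: 'D_e f p) ('D_e g p)).
split.
- by move=> p; case: (d e1 p (f1 p) (g1 p)).
- by move=> p; case: (d e2 p (f2 p) (g2 p)).
- have -> : (fun p => 'D_e1 (fun p => a * f p + g p) p) = (fun p => a * 'D_e1 f p + 'D_e1 g p).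
    by apply/funext => p; case: (d e1 p (f1 p) (g1 p)).
  exact: IH.
- have -> : (fun p => 'D_e2 (fun p => a * f p + g p) p) = (fun p => a * 'D_e2 f p + 'D_e2 g p).
    by apply/funext => p; case: (d e2 p (f2 p) (g2 p)).
  exact: IH.
Qed.

Lemma smooth_lin (a : R) f g : smooth f -> smooth g -> smooth (fun p => a * f p + g p).
Proof. by move=> sf sg k; exact: Ck_lin. Qed.

Lemma Ck_cst k (c : R) : Ck k (fun _ => c).
Proof.
elim: k c => [|k IH] c; split=> //; try by move=> p; exact: cvg_cst.
have d e : (fun p => 'D_e (fun _ : R * R => c) p) = (fun _ => 0).
  by apply/funext => p; exact: derive_cst.
by split; rewrite ?d//; try exact: IH; move=> p; exact: derivable_cst.
Qed.

Lemma smooth_C1 f : smooth f -> C1 f.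
Proof. by move=> /(_ 1%N) /= [c [d1 d2 [c1 _] [c2 _]]]; exact: (MkC1 c d1 d2 c1 c2). Qed.

Lemma derive_lin (e : R * R) (a : R) f g p : derivable f p e -> derivable g p e ->
  'D_e (fun p => a * f p + g p) p = a * 'D_e f p + 'D_e g p.
Proof.
move=> df dg; have hf := derivableP df; have hg := derivableP dg.
by have [_] := @is_deriveD _ _ _ (a \*: f) g p e (a *: 'D_e f p) ('D_e g p) _ _.
Qed.

Lemma smooth_tensor (g h : R -> R) : smooth1 g -> smooth1 h ->
  smooth (fun p => g p.1 * h p.2).
Proof.
move=> /smooth1_seq[d [<- hd]] /smooth1_seq[e [<- he]] k.
suff gen i j : Ck k (fun p => d i p.1 * e j p.2) by exact: gen.
elim: k i j => [|k IH] i j.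
  split=> //; apply: continuous_tensor => x; [exact: is_derive_continuous (hd i x)|].
  exact: is_derive_continuous (he j x).
split.
  apply: continuous_tensor => x; [exact: is_derive_continuous (hd i x)|].
  exact: is_derive_continuous (he j x).
split.
- by move=> p; case: (derive_tensor1 (e j) p (hd i)).
- by move=> p; case: (derive_tensor2 (d i) p (he j)).
- have -> : (fun p => 'D_e1 (fun p => d i p.1 * e j p.2) p) = (fun p => d i.+1 p.1 * e j p.2).
    by apply/funext => p; case: (derive_tensor1 (e j) p (hd i)).
  exact: IH.
- have -> : (fun p => 'D_e2 (fun p => d i p.1 * e j p.2) p) = (fun p => d i p.1 * e j.+1 p.2).
    by apply/funext => p; case: (derive_tensor2 (d i) p (he j)).
  exact: IH.
Qed.

(** The compact set need not be the support, so that linear combinations are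
    immediate. *)
Definition rtest Omega f : Prop := smooth f /\
  exists K, [/\ compact K, K `<=` Omega & forall p, ~ K p -> f p = 0].

Lemma rtest_lin Omega (a : R) f g : rtest Omega f -> rtest Omega g ->
  rtest Omega (fun p => a * f p + g p).
Proof.
move=> [sf [K [cK KO K0]]] [sg [L [cL LO L0]]]; split; first exact: smooth_lin.
exists (K `|` L); split; first exact: compactU.
  by move=> p [/KO|/LO].
by move=> p /not_orP[/K0 -> /L0 ->]; rewrite mulr0 addr0.
Qed.

Lemma rtest0 Omega : rtest Omega (fun _ => 0).
Proof. by split=> [k|]; [exact: Ck_cst|exists set0; split=> //; exact: compact0]. Qed.

Lemma rtestN Omega f : rtest Omega f -> rtest Omega (fun p => - f p).
Proof.
move=> rf; have := rtest_lin (-1) rf (rtest0 Omega); congr rtest.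
by apply/funext => p; rewrite mulN1r addr0.
Qed.

Lemma test_functionP Omega u : test_function Omega u <->
  rtest Omega (fun p => complex.Re (u p)) /\ rtest Omega (fun p => complex.Im (u p)).
Proof.
split=> [[sr si cK KO]|[[sr [K [cK KO K0]]] [si [L [cL LO L0]]]]].
  have z p : ~ closure [set p | u p != 0] p -> u p = 0.
    by move=> h; apply/eqP/negPn/negP => un; apply: h; exact: subset_closure.
  by split; split=> //; exists (closure [set p | u p != 0]); split=> // p /z ->.
have cKL : compact (K `|` L) by exact: compactU.
have clKL : closed (K `|` L) by apply: compact_closed cKL; exact: norm_hausdorff.
have sub : closure [set p | u p != 0] `<=` K `|` L.
  rewrite [X in _ `<=` X](closure_id _).1//; apply: closure_subset => p /= up.
  apply: contrapT => /not_orP[/K0 h1 /L0 h2]; move: up.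
  by move: h1 h2; case: (u p) => a b /= -> ->; rewrite eqxx.
split=> //.
- by apply: subclosed_compact cKL sub; exact: closed_closure.
- by move=> p /sub[/KO|/LO].
Qed.

(** A compact subset of the open square keeps a distance from its boundary. *)
Lemma rtest_in_box f : rtest sq1 f -> in_box f.
Proof.
move=> [_ [K [cK KO K0]]].
have [Kn|] := pselect (K !=set0); last first.
  move=> Kn; exists 0; first by [].
  by move=> p _; apply: K0 => Kp; apply: Kn; exists p.
have cn1 : {within K, continuous (fun p : R * R => `|p.1|)}.
  by apply: continuous_subspaceT => p; apply: cvg_norm; exact: cvg_fst.
have cn2 : {within K, continuous (fun p : R * R => `|p.2|)}.
  by apply: continuous_subspaceT => p; apply: cvg_norm; exact: cvg_snd.
have [c cK1 hc] := compact_EVT_max Kn cK cn1.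
have [e eK1 he] := compact_EVT_max Kn cK cn2.
pose M := Num.max `|c.1| `|e.2|.
have M2 : M < 1 / 2.
  have [+ _] := KO c (set_mem cK1); have [_] := KO e (set_mem eK1).
  rewrite /I12 /= !in_itv /= => /andP[h1 h2] /andP[h3 h4].
  by rewrite gt_max !ltr_norml h1 h2 h3 h4.
exists ((M + 1 / 2) / 2); first by lra.
move=> p hp; apply: K0 => Kp.
have h1 : `|p.1| <= M by rewrite le_max hc// mem_set.
have h2 : `|p.2| <= M by rewrite le_max he ?orbT// mem_set.
by case: hp => hp; lra.
Qed.

End TestFunctions.

(** * The form domain of the unit square *)

Notation sq2 f := (@sqi _ _ _ (mu2 _) sq1 f).
Notation ip2 f g := (@ip _ _ _ (mu2 _) sq1 f g).

Section Fields.
Variable R : realType.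

(** A complex function as the pair of its real part (at true) and its imaginary
    part (at false): the Hilbert spaces below are real. *)
Definition cfield := (bool -> R * R -> R).
HB.instance Definition _ := GRing.Lmodule.on cfield.
(** A function followed by the two components of its gradient. *)
Definition triple := (cfield * cfield * cfield)%type.
HB.instance Definition _ := GRing.Lmodule.on triple.

Implicit Types (f g h : cfield) (x y : triple).

Definition sqc f : Prop := forall b, sq2 (f b).
Definition ipc f g : R := ip2 (f true) (g true) + ip2 (f false) (g false).

Lemma sqc_lin (a : R) f g : sqc f -> sqc g -> sqc (a *: f + g).
Proof. by move=> sf sg b; exact: (sqi_lin msq1 a (sf b) (sg b)). Qed.
Lemma sqc0 : sqc 0. Proof. by move=> b; exact: sqi0. Qed.
Lemma sqcB f g : sqc f -> sqc g -> sqc (f - g).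
Proof. by move=> sf sg; rewrite addrC -scaleN1r; exact: sqc_lin. Qed.
Lemma ipcC f g : ipc f g = ipc g f.
Proof. by congr (_ + _); exact: ipC. Qed.
Lemma ipc_lin (a : R) f g h : sqc f -> sqc g -> sqc h ->
  ipc (a *: f + g) h = a * ipc f h + ipc g h.
Proof.
move=> sf sg sh; rewrite /ipc.
rewrite (ip_lin msq1 a (sf true) (sg true) (sh true)).
by rewrite (ip_lin msq1 a (sf false) (sg false) (sh false)); ring.
Qed.
Lemma ipc_ge0 f : 0 <= ipc f f. Proof. by rewrite addr_ge0// ip_ge0. Qed.

Definition jet (phi : cfield) : triple :=
  (phi, fun b p => 'D_e1 (phi b) p, fun b p => 'D_e2 (phi b) p).

Definition sqt x : Prop := [/\ sqc x.1.1, sqc x.1.2 & sqc x.2].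

Definition nsq x : R := ipc x.1.1 x.1.1 + (ipc x.1.2 x.1.2 + ipc x.2 x.2).

Definition ctest (phi : cfield) : Prop := forall b, rtest sq1 (phi b).

(** The closure of the test functions in the Sobolev norm. The gradient is part
    of the data, and turns out to be the weak gradient in [W0_ibp1]. *)
Definition W0 x : Prop := sqt x /\
  forall e : R, 0 < e -> exists2 phi, ctest phi & nsq (x - jet phi) < e.

Lemma lin11 (a : R) x y : (a *: x + y).1.1 = a *: x.1.1 + y.1.1. Proof. by []. Qed.
Lemma lin12 (a : R) x y : (a *: x + y).1.2 = a *: x.1.2 + y.1.2. Proof. by []. Qed.
Lemma lin2 (a : R) x y : (a *: x + y).2 = a *: x.2 + y.2. Proof. by []. Qed.

Lemma sqt_lin (a : R) x y : sqt x -> sqt y -> sqt (a *: x + y).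
Proof.
move=> [x1 x2 x3] [y1 y2 y3]; rewrite /sqt lin11 lin12 lin2.
exact: (And3 (sqc_lin a x1 y1) (sqc_lin a x2 y2) (sqc_lin a x3 y3)).
Qed.

Lemma ctest_lin (a : R) phi psi : ctest phi -> ctest psi -> ctest (a *: phi + psi).
Proof. by move=> h1 h2 b; exact: rtest_lin. Qed.

Lemma jet_lin (a : R) phi psi : ctest phi -> ctest psi ->
  jet (a *: phi + psi) = a *: jet phi + jet psi.
Proof.
move=> h1 h2; rewrite /jet; congr (_, _, _); apply/funext => b; apply/funext => p.
  by apply: derive_lin; apply: C1_der1; apply: smooth_C1; [exact: (h1 b).1|exact: (h2 b).1].
by apply: derive_lin; apply: C1_der2; apply: smooth_C1; [exact: (h1 b).1|exact: (h2 b).1].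
Qed.

Lemma bm2_sqi (f : R * R -> R) : bm2 f -> sq2 f.
Proof.
move=> bf; apply: integrable_sqi; first by apply: measurable_funTS; exact: bf.1.
exact: (bm_integrable msq1 mu2_fin (bmX 2 bf)).
Qed.

Lemma sqt_jet phi : ctest phi -> sqt (jet phi).
Proof.
move=> h; split=> b; have [b0 b1 b2] := C1_bm (smooth_C1 (h b).1) (rtest_in_box (h b)); exact: bm2_sqi.
Qed.

Lemma ipc_lin_le (a : R) f g : sqc f -> sqc g ->
  ipc (a *: f + g) (a *: f + g) <= 2 * (a ^+ 2 * ipc f f + ipc g g).
Proof.
move=> sf sg; have sh := sqc_lin a sf sg; have sh' := sqc_lin (- a) sf sg.
have := ipc_ge0 (- a *: f + g).
rewrite (ipc_lin _ sf sg sh) (ipc_lin _ sf sg sh').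
rewrite (ipcC f (a *: f + g)) (ipcC g (a *: f + g)) (ipcC f (- a *: f + g)) (ipcC g (- a *: f + g)).
rewrite (ipc_lin _ sf sg sf) (ipc_lin _ sf sg sg) (ipc_lin _ sf sg sf) (ipc_lin _ sf sg sg).
rewrite (ipcC g f); move: (ipc f f) (ipc f g) (ipc g g) => A B C; lra.
Qed.

Lemma nsq_lin_le (a : R) x y : sqt x -> sqt y ->
  nsq (a *: x + y) <= 2 * (a ^+ 2 * nsq x + nsq y).
Proof.
move=> [x1 x2 x3] [y1 y2 y3]; rewrite /nsq lin11 lin12 lin2.
have := ipc_lin_le a x1 y1; have := ipc_lin_le a x2 y2; have := ipc_lin_le a x3 y3.
move: (ipc (a *: x.1.1 + _) _) (ipc (a *: x.1.2 + _) _) (ipc (a *: x.2 + _) _).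
move: (ipc x.1.1 x.1.1) (ipc x.1.2 x.1.2) (ipc x.2 x.2).
move: (ipc y.1.1 y.1.1) (ipc y.1.2 y.1.2) (ipc y.2 y.2) => *; lra.
Qed.

Lemma nsq0 : nsq 0 = 0.
Proof.
have h : ipc 0 0 = 0.
  have := ipc_lin 1 sqc0 sqc0 sqc0; rewrite scaler0 addr0 mul1r; lra.
by rewrite /nsq /= h !addr0.
Qed.

Lemma W0_jet phi : ctest phi -> W0 (jet phi).
Proof.
move=> h; split; first exact: sqt_jet.
by move=> e e0; exists phi => //; rewrite subrr nsq0.
Qed.

Lemma sqtB x y : sqt x -> sqt y -> sqt (x - y).
Proof. by move=> sx sy; rewrite addrC -scaleN1r; exact: sqt_lin. Qed.

Lemma W0_zero : W0 0.
Proof.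
have h : ctest 0 by move=> b; exact: rtest0.
suff -> : 0 = jet 0 :> triple by exact: W0_jet.
by rewrite /jet; congr (_, _, _); apply/funext => b; apply/funext => p; rewrite derive_cst.
Qed.

Lemma W0_lin (a : R) x y : W0 x -> W0 y -> W0 (a *: x + y).
Proof.
move=> [sx hx] [sy hy]; split; first exact: sqt_lin.
move=> e e0; have k0 : 0 < 4 * (a ^+ 2 + 1).
  by rewrite mulr_gt0// ltr_wpDl ?sqr_ge0.
have [phi tp hp] := hx (e / (4 * (a ^+ 2 + 1))) ltac:(by rewrite divr_gt0).
have [psi ts hs] := hy (e / (4 * (a ^+ 2 + 1))) ltac:(by rewrite divr_gt0).
exists (a *: phi + psi); first exact: ctest_lin.
rewrite jet_lin//.
have -> : a *: x + y - (a *: jet phi + jet psi) = a *: (x - jet phi) + (y - jet psi).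
  by rewrite scalerBr opprD addrACA.
apply: le_lt_trans (nsq_lin_le a (sqtB sx (sqt_jet tp)) (sqtB sy (sqt_jet ts))) _.
have p0 : 0 <= a ^+ 2 by exact: sqr_ge0.
move: hp hs; set N1 := nsq _; set N2 := nsq _; set e' := e / _ => hp hs.
have ee : e = 4 * (a ^+ 2 + 1) * e' by rewrite /e' mulrC divfK// gt_eqF.
have e'0 : 0 < e' by rewrite divr_gt0.
have := ler_wpM2l p0 (ltW hp); rewrite ee; nra.
Qed.

Definition inV : {pred triple} := fun x => `[< W0 x >].
Lemma inV_submod : submod_closed inV.
Proof.
split; first by apply/asboolP; exact: W0_zero.
by move=> a u v; rewrite !unfold_in => /asboolP h /asboolP h'; apply/asboolP; exact: W0_lin.
Qed.
HB.instance Definition _ := GRing.isSubmodClosed.Build R triple inV inV_submod.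
Record V := MkV { vval : triple; vvalP : vval \in inV }.
HB.instance Definition _ := [isSub for vval].
HB.instance Definition _ := [Choice of V by <:].
HB.instance Definition _ := [SubChoice_isSubLmodule of V by <:].

Lemma VP (u : V) : W0 (vval u). Proof. by have /asboolP := vvalP u. Qed.
Definition toV x (h : W0 x) : V := @MkV x (asboolT h).
Definition jetV phi (h : ctest phi) : V := toV (W0_jet h).

Definition mV (u v : V) : R := ipc (vval u).1.1 (vval v).1.1.
Definition d1V (u v : V) : R := ipc (vval u).1.2 (vval v).1.2.
Definition d2V (u v : V) : R := ipc (vval u).2 (vval v).2.
Definition dV u v := d1V u v + d2V u v.
Definition nV u v := mV u v + dV u v.

Lemma symbil_of (F : V -> cfield) : (forall u, sqc (F u)) ->
  (forall (a : R) u v, F (a *: u + v) = a *: F u + F v) ->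
  symbil (fun u v => ipc (F u) (F v)).
Proof.
move=> sF lF; split=> [u v|a u v x]; first exact: ipcC.
by rewrite lF ipc_lin.
Qed.

Lemma mV_symbil : symbil mV.
Proof. by apply: symbil_of => // u; case: (VP u) => -[]. Qed.
Lemma d1V_symbil : symbil d1V.
Proof. by apply: (@symbil_of (fun u => (vval u).1.2)) => // u; case: (VP u) => -[]. Qed.
Lemma d2V_symbil : symbil d2V.
Proof. by apply: (@symbil_of (fun u => (vval u).2)) => // u; case: (VP u) => -[]. Qed.
Lemma symbilD q1 q2 : @symbil R V q1 -> symbil q2 -> symbil (fun u v => q1 u v + q2 u v).
Proof.
move=> h1 h2; split=> [u v|c u v x]; first by rewrite (symbilC h1) (symbilC h2).
by rewrite !(symbilE h1) !(symbilE h2); ring.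
Qed.
Lemma dV_symbil : symbil dV. Proof. exact: symbilD d1V_symbil d2V_symbil. Qed.
Lemma nV_symbil : symbil nV. Proof. exact: symbilD mV_symbil dV_symbil. Qed.
Lemma mV_ge0 u : 0 <= mV u u. Proof. exact: ipc_ge0. Qed.
Lemma d1V_ge0 u : 0 <= d1V u u. Proof. exact: ipc_ge0. Qed.
Lemma d2V_ge0 u : 0 <= d2V u u. Proof. exact: ipc_ge0. Qed.
Lemma dV_ge0 u : 0 <= dV u u. Proof. by rewrite addr_ge0// ipc_ge0. Qed.
Lemma nV_ge0 u : 0 <= nV u u. Proof. by rewrite addr_ge0 ?dV_ge0// ipc_ge0. Qed.

Lemma denseV (u : V) (e : R) : 0 < e -> exists phi (h : ctest phi),
  nV (u - jetV h) (u - jetV h) < e.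
Proof. by move=> e0; have [phi h hn] := (VP u).2 e e0; exists phi, h. Qed.

(** A bounded form is continuous, so its sign is decided on test functions. *)
Lemma dense_form_ge0 (q : V -> V -> R) M : symbil q -> bounded_by nV q M ->
  (forall phi (h : ctest phi), 0 <= q (jetV h) (jetV h)) -> forall u, 0 <= q u u.
Proof.
move=> Hq qM hq u; rewrite leNgt; apply/negP => neg.
have n0 := nrm_ge0 nV u.
pose e := Num.min 1 (- q u u / (2 * (`|M| + 1) * (nrm nV u + 1))).
have K0 : 0 < 2 * (`|M| + 1) * (nrm nV u + 1).
  by rewrite !mulr_gt0// ltr_wpDl.
have e0 : 0 < e by rewrite lt_min ltr01 divr_gt0// oppr_gt0.
have [phi [h hn]] := denseV u (exprn_gt0 2 e0).
set t := jetV h in hn; have := hq phi h; rewrite -/t.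
have [r rE] : exists r, r = u - t by eexists.
have -> : t = u - r by rewrite rE subKr.
rewrite -rE in hn.
have nr : nrm nV r <= e.
  rewrite -ler_sqr ?nnegrE ?nrm_ge0 ?ltW//; rewrite nrm_sqr ?nV_ge0//; exact: ltW.
rewrite !(symbilE Hq) (symbilC Hq r u).
have h1 := qM u r; have h2 := qM r r.
have nr0 := nrm_ge0 nV r.
have e1 : e <= 1 by rewrite ge_min lexx.
have e2 : e * (2 * (`|M| + 1) * (nrm nV u + 1)) <= - q u u.
  by rewrite -ler_pdivlMr// ge_min lexx orbT.
have a1 : - q u r <= `|M| * (nrm nV u * e).
  apply: (@le_trans _ _ `|q u r|); first by rewrite -normrN ler_norm.
  apply: (le_trans h1); apply: (@le_trans _ _ (`|M| * (nrm nV u * nrm nV r))).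
    by rewrite ler_wpM2r ?mulr_ge0// ler_norm.
  by rewrite ler_wpM2l// ler_wpM2l.
have a2 : q r r <= `|M| * e.
  apply: (le_trans (ler_norm _)); apply: (le_trans h2).
  apply: (@le_trans _ _ (`|M| * (nrm nV r * nrm nV r))).
    by rewrite ler_wpM2r ?mulr_ge0// ler_norm.
  by rewrite ler_wpM2l//; nra.
have M0 : 0 <= `|M| by [].
nra.
Qed.

Lemma dense_form_eq0 (q : V -> V -> R) M w : symbil q -> bounded_by nV q M ->
  (forall phi (h : ctest phi), q w (jetV h) = 0) -> forall u, q w u = 0.
Proof.
move=> Hq qM hq u; apply/eqP; rewrite -normr_le0; apply/ler_addgt0Pl => e e0; rewrite addr0.
have n0 := nrm_ge0 nV w.
have K0 : 0 < `|M| * nrm nV w + 1 by rewrite ltr_wpDl// mulr_ge0.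
have e1 : 0 < e / (`|M| * nrm nV w + 1) by rewrite divr_gt0.
have [phi [h hn]] := denseV u (exprn_gt0 2 e1).
have -> : q w u = q w (u - jetV h) by rewrite !(symbilE Hq) hq subr0.
set r := u - _ in hn *.
have nr : nrm nV r <= e / (`|M| * nrm nV w + 1).
  rewrite -ler_sqr ?nnegrE ?nrm_ge0 ?ltW//; rewrite nrm_sqr ?nV_ge0//; exact: ltW.
apply: (le_trans (qM _ _)).
apply: (@le_trans _ _ (`|M| * nrm nV w * (e / (`|M| * nrm nV w + 1)))).
  apply: (@le_trans _ _ (`|M| * (nrm nV w * nrm nV r))).
    by rewrite ler_wpM2r ?ler_norm// mulr_ge0// nrm_ge0.
  by rewrite -mulrA ler_wpM2l// ler_wpM2l.
rewrite mulrA ler_pdivrMr// mulrC ler_wpM2l ?ltW//; lra.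
Qed.

End Fields.

(** * Cutting off the ground state *)

Section GroundStateApprox.
Context {R : realType}.
Implicit Types (x t : R) (n : nat).

(** The ground state vanishes at the endpoints to first order; this compensates
    for the steep cut-off. *)
Lemma kc_le x : - (1 / 2) < x < 1 / 2 -> kc x <= 2 * pi * (1 / 4 - x ^+ 2).
Proof.
have half (y : R) : y <= 1 / 2 -> kc y <= pi * (1 / 2 - y).
  move=> hy; suff : kc y - pi * (1 / 2 - y) <= kc (1 / 2) - pi * (1 / 2 - 1 / 2).
    by rewrite /kc mulrA mulr1 cos_pihalf subrr mulr0 subrr subr_le0.
  have dF (z : R) : is_derive z (1 : R) (kc - pi \*: (cst (1 / 2) - (@id R))) (- pi * ks z + pi).
    apply: is_derive_eq; rewrite /GRing.scale /=; ring.
  have nn (z : R) : y <= z <= 1 / 2 -> 0 <= - pi * ks z + pi.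
    move=> _; have := sin_le1 (pi * z); rewrite -/(ks z) => h; have := pi_gt0 R; nra.
  exact: (is_derive_mono hy (fun z _ => dF z) nn).
move=> /andP[h1 h2].
have pi0 := pi_gt0 R.
have a1 := half x (ltW h2).
have a2 : kc x <= pi * (1 / 2 + x).
  have := half (- x) ltac:(lra); rewrite opprK; congr (_ <= _).
  by rewrite /kc mulrN cosN.
have [x0|x0] := leP 0 x.
  apply: (le_trans a1); rewrite -subr_ge0.
  have -> : 2 * pi * (1 / 4 - x ^+ 2) - pi * (1 / 2 - x) = pi * (2 * x * (1 / 2 - x)) by field.
  by apply: mulr_ge0; [lra|apply: mulr_ge0; lra].
apply: (le_trans a2); rewrite -subr_ge0.
have -> : 2 * pi * (1 / 4 - x ^+ 2) - pi * (1 / 2 + x) = pi * (2 * (- x) * (1 / 2 + x)) by field.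
by apply: mulr_ge0; [lra|apply: mulr_ge0; lra].
Qed.

(** The cut-off hb 0 (bt n x) vanishes within distance 1 / (n + 3) of the
    endpoints and tends to 1 inside; bda n is the derivative of ba n. *)
Definition bt n x : R := (1 / 4 - x ^+ 2) * (n.+3)%:R - 1.
Definition ba n x : R := kc x * hb 0 (bt n x).
Definition bda n x : R := - pi * ks x * hb 0 (bt n x) - kc x * (2 * x) * ((n.+3)%:R * hb 2 (bt n x)).

Lemma is_derive_ba n x : is_derive x (1 : R) (ba n) (bda n x).
Proof.
have d1 : is_derive x (1 : R) (bt n) (- 2 * x * (n.+3)%:R).
  have -> : bt n = (n.+3)%:R \*: (cst (1 / 4) - (@id R) ^+ 2) - cst 1.
    by apply/funext => r; rewrite /bt !fctE /GRing.scale /= mulrC.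
  apply: is_derive_eq; rewrite /GRing.scale /=; ring.
have d2 := @is_derive1_comp _ _ _ x _ _ (is_derive_hb 0 (bt n x)) d1.
have := is_deriveM (is_derive_kc x) d2.
have -> : kc * (hb 0 \o bt n) = ba n by apply/funext => r; rewrite /ba !fctE.
move=> H; apply: (is_derive_eq H); rewrite /GRing.scale /= /bda mul0r subr0; ring.
Qed.

Lemma smooth1_ba n : smooth1 (ba n).
Proof.
move=> k; apply: DkM; first exact: smooth1_kc.
apply: Dk_comp; first exact: smooth1_hb.
have -> : bt n = (fun x => (- (n.+3)%:R) * (x * x) + ((n.+3)%:R / 4 - 1) * 1).
  by apply/funext => x; rewrite /bt; field.
apply: Dk_lin; last exact: Dk_cst.
by apply: DkM; exact: Dk_id.
Qed.

Lemma hb_le0 j t : t <= 0 -> hb j t = 0.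
Proof. by move=> h; rewrite /hb ltNge h. Qed.

Lemma hb0_le1 t : hb 0 t <= 1.
Proof.
rewrite /hb; case: ifP => // t0; rewrite expr0 invr1 mul1r expR_le1 oppr_le0 invr_ge0.
exact: ltW.
Qed.

Lemma hb2E t : 0 < t -> (t + 1) * hb 2 t = (t^-1 + t^-1 ^+ 2) * expR (- t^-1).
Proof. by move=> t0; rewrite /hb t0 -!exprVn; field; rewrite gt_eqF. Qed.

Lemma ba_supp n x : 1 / 2 - (n.+3)%:R^-1 <= `|x| -> ba n x = 0.
Proof.
move=> h; rewrite /ba hb_le0 ?mulr0//; rewrite /bt.
have n0 : 0 < (n.+3)%:R :> R by rewrite ltr0n.
have e0 : 0 < (n.+3)%:R^-1 :> R by rewrite invr_gt0.
have e1 : (n.+3)%:R^-1 <= 1 / 2 :> R.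
  by rewrite -[1 / 2]invrK lef_pV2 ?posrE// ?invr_gt0// invf_div divr1 ler_nat.
rewrite subr_le0 -ler_pdivlMr// mul1r.
rewrite -(real_normK (num_real x)); move: h; move: (n.+3%:R^-1) e0 e1 => e e0 e1 h.
have : 0 <= 1 / 2 - e by lra.
have := normr_ge0 x; move: h; move: `|x| => y; nra.
Qed.

Lemma kc_le1 x : `|kc x| <= 1.
Proof. by rewrite ler_norml; apply/andP; split; [exact: cos_geN1|exact: cos_le1]. Qed.
Lemma ks_le1 x : `|ks x| <= 1.
Proof. by rewrite ler_norml; apply/andP; split; [exact: sin_geN1|exact: sin_le1]. Qed.

Lemma ba_le n x : `|ba n x| <= 1.
Proof.
rewrite normrM mulr_ile1//; first exact: kc_le1.
by rewrite ger0_norm ?hb_ge0 ?hb0_le1.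
Qed.

(** The derivative of the cut-off is large only where 1/4 - x^2, and with it kc,
    is small: the product is a bounded function of bt n x. *)
Lemma bt_hb2 n x : - (1 / 2) < x < 1 / 2 ->
  kc x * ((n.+3)%:R * hb 2 (bt n x)) <= 6 * pi.
Proof.
move=> hx; have k0 := kc_gt0 hx; have kl := kc_le hx; have pi0 := pi_gt0 R.
have [t0|t0] := leP (bt n x) 0; first by rewrite hb_le0 ?mulr0//; lra.
have h0 : 0 <= (n.+3)%:R * hb 2 (bt n x) by rewrite mulr_ge0// hb_ge0.
apply: (le_trans (ler_wpM2r h0 kl)).
have -> : 2 * pi * (1 / 4 - x ^+ 2) * (n.+3%:R * hb 2 (bt n x)) =
    2 * pi * ((bt n x + 1) * hb 2 (bt n x)) by rewrite /bt; ring.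
rewrite hb2E//; have s0 : 0 <= (bt n x)^-1 by rewrite invr_ge0 ltW.
have := powX_le_exp 0 s0; have := powX_le_exp 1 s0.
rewrite expr1 (_ : 1`!%:R = 1 :> R)// (_ : 2`!%:R = 2 :> R)//.
set A := _^-1 * expR _; set B := _ ^+ 2 * expR _ => hB hA.
have p2 : 0 <= 2 * pi :> R by lra.
have AB : A + B <= 3 by lra.
have -> : 6 * pi = 2 * pi * 3 :> R by ring.
rewrite [X in 2 * pi * X <= _](_ : _ = A + B); last by rewrite /A /B mulrDl.
exact: ler_wpM2l.
Qed.

Lemma bda_le n x : - (1 / 2) < x < 1 / 2 -> `|bda n x| <= 7 * pi.
Proof.
move=> hx; have pi0 := pi_gt0 R; have k0 := kc_gt0 hx.
rewrite /bda; apply: le_trans (ler_normB _ _) _.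
have a1 : `|- pi * ks x * hb 0 (bt n x)| <= pi.
  rewrite -mulrA normrM normrN (gtr0_norm pi0); apply: ler_piMr; first exact: ltW.
  rewrite normrM mulr_ile1//; first exact: ks_le1.
  by rewrite ger0_norm ?hb_ge0 ?hb0_le1.
have a2 : `|kc x * (2 * x) * (n.+3%:R * hb 2 (bt n x))| <= 6 * pi.
  rewrite -mulrA mulrCA normrM.
  have h0 : 0 <= kc x * ((n.+3)%:R * hb 2 (bt n x)) by rewrite !mulr_ge0// ?hb_ge0// ltW.
  rewrite (ger0_norm h0); apply: le_trans (bt_hb2 n hx).
  rewrite ler_piMl// ler_norml; lra.
lra.
Qed.

Section Pointwise.
Variable x : R.
Hypothesis hx : - (1 / 2) < x < 1 / 2.

Let q0 : 0 < 1 / 4 - x ^+ 2.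
Proof.
have -> : 1 / 4 - x ^+ 2 = (1 / 2 - x) * (1 / 2 + x) by field.
by move: hx => /andP[h1 h2]; apply: mulr_gt0; lra.
Qed.

Lemma bt_inv_cvg : (bt n x)^-1 @[n --> \oo] --> (0 : R).
Proof.
apply/cvgrPdist_lt => e e0.
near=> n.
have h : (1 + e^-1) / (1 / 4 - x ^+ 2) < n%:R.
  by near: n; exact: nbhs_infty_gtr.
have b0 : e^-1 < bt n x.
  rewrite ltr_pdivrMr// in h; rewrite /bt.
  have n3 : n%:R <= (n.+3)%:R :> R by rewrite ler_nat -addn3 leq_addr.
  have := ler_wpM2r (ltW q0) n3; lra.
have ei : 0 < e^-1 by rewrite invr_gt0.
have bp : 0 < bt n x by apply: lt_trans b0.
rewrite sub0r normrN gtr0_norm ?invr_gt0// -[e]invrK ltf_pV2 ?posrE//.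
Unshelve. all: by end_near. Qed.

Lemma bt_gt0_near : \forall n \near \oo, 0 < bt n x.
Proof.
near=> n.
have h : 1 / (1 / 4 - x ^+ 2) < n%:R by near: n; exact: nbhs_infty_gtr.
rewrite ltr_pdivrMr// in h; rewrite /bt.
have n3 : n%:R <= (n.+3)%:R :> R by rewrite ler_nat -addn3 leq_addr.
have := ler_wpM2r (ltW q0) n3; lra.
Unshelve. all: by end_near. Qed.

Lemma expR_bt_cvg : expR (- (bt n x)^-1) @[n --> \oo] --> (1 : R).
Proof.
rewrite -expR0 -[X in expR X]oppr0; apply: continuous_cvg; first exact: continuous_expR.
by apply: cvgN; exact: bt_inv_cvg.
Qed.

Lemma hb0_cvg : hb 0 (bt n x) @[n --> \oo] --> (1 : R).
Proof.
apply: cvg_trans expR_bt_cvg; apply: near_eq_cvg; near=> n.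
have b0 : 0 < bt n x by near: n; exact: bt_gt0_near.
by rewrite /hb b0 expr0 invr1 mul1r.
Unshelve. all: by end_near. Qed.

Lemma hb2_cvg : (n.+3)%:R * hb 2 (bt n x) @[n --> \oo] --> (0 : R).
Proof.
have h : (1 / 4 - x ^+ 2)^-1 * (((bt n x)^-1 + (bt n x)^-1 ^+ 2) * expR (- (bt n x)^-1))
    @[n --> \oo] --> (1 / 4 - x ^+ 2)^-1 * ((0 + 0 * 0) * 1).
  apply: cvgM; first exact: cvg_cst.
  apply: cvgM; last exact: expR_bt_cvg.
  apply: cvgD; first exact: bt_inv_cvg.
  by apply: cvgM; exact: bt_inv_cvg.
rewrite mulr0 addr0 mul0r mulr0 in h.
apply: cvg_trans h; apply: near_eq_cvg; near=> n.
have b0 : 0 < bt n x by near: n; exact: bt_gt0_near.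
have qn : 1 / 4 - x ^+ 2 != 0 by rewrite gt_eqF.
rewrite -hb2E// /bt subrK; move: (hb 2 _) => E; by rewrite -mulrA mulKf.
Unshelve. all: by end_near. Qed.

Lemma ba_cvg : ba n x @[n --> \oo] --> kc x.
Proof. by rewrite -[X in _ --> X]mulr1; apply: cvgM; [exact: cvg_cst|exact: hb0_cvg]. Qed.

Lemma bda_cvg : bda n x @[n --> \oo] --> - pi * ks x.
Proof.
rewrite -[X in _ --> X]subr0 -[X in _ --> X - _]mulr1 -[X in _ --> _ - X](mulr0 (kc x * (2 * x))).
apply: cvgB; apply: cvgM; [exact: cvg_cst|exact: hb0_cvg|exact: cvg_cst|exact: hb2_cvg].
Qed.

End Pointwise.

Lemma dominated_ip (F : nat -> R * R -> R) (M : R) : (forall n, bm2 (F n)) ->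
  (forall n p, sq1 p -> `|F n p| <= M) ->
  (forall p, sq1 p -> F n p @[n --> \oo] --> (0 : R)) ->
  ip2 (F n) (F n) @[n --> \oo] --> (0 : R).
Proof.
move=> bF hM hc.
have key : (fun n => \int[mu2 R]_(p in sq1) (F n p ^+ 2)%:E)%E @ \oo -->
   (\int[mu2 R]_(p in sq1) (0%:E))%E.
  apply: (@dominated_cvg _ _ _ (mu2 R) sq1 msq1 (fun n p => (F n p ^+ 2)%:E) _ (fun _ => (M ^+ 2)%:E)) => //.
  - move=> n; apply/measurable_EFinP; apply: measurable_funTS; exact: (bmX 2 (bF n)).1.
  - move=> p hp; apply: cvg_EFin; first exact: nearW.
    by rewrite -[X in _ --> X](mulr0 0); apply: cvgM; exact: hc.
  - exact: (bm_integrable msq1 mu2_fin (bm_cst _ (M ^+ 2))).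
  - move=> n p hp; rewrite /= lee_fin ger0_norm ?sqr_ge0//.
    rewrite -(real_normK (num_real (F n p))) lerXn2r ?nnegrE//; last exact: hM.
    by apply: le_trans (hM n p hp).
rewrite integral0 in key.
have : (fun n => (ip2 (F n) (F n))%:E) @ \oo --> (0 : R)%:E.
  apply: cvg_trans key; apply: near_eq_cvg; near=> n.
  by rewrite (ip_sqr msq1 (bm2_sqi (bF n))).
by move/fine_cvg.
Unshelve. all: by end_near. Qed.

End GroundStateApprox.

(** * The ground state of the unit square *)

Lemma three_thirds (R : realType) (e : R) : e / 3 + (e / 3 + e / 3) = e.
Proof. by field. Qed.

Section GroundState.
Context {R : realType}.
Local Notation cfield := (cfield R).
Local Notation triple := (triple R).
Local Notation V := (V R).

Lemma continuous_kc : continuous (kc : R -> R).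
Proof. by move=> x; exact: is_derive_continuous (is_derive_kc x). Qed.
Lemma continuous_ks : continuous (ks : R -> R).
Proof. by move=> x; exact: is_derive_continuous (is_derive_ks x). Qed.

Lemma bm2_tensor (g h : R -> R) : continuous g -> continuous h ->
  (forall x, `|g x| <= 1) -> (forall x, `|h x| <= 1) -> bm2 (fun p => g p.1 * h p.2).
Proof.
move=> cg ch bg bh; split.
  by apply: continuous_measurable_plane; exact: continuous_tensor.
by exists 1 => p; rewrite normrM mulr_ile1.
Qed.

Lemma bm2_kckc : bm2 (fun p : R * R => kc p.1 * kc p.2).
Proof. by apply: bm2_tensor; [exact: continuous_kc|exact: continuous_kc|exact: kc_le1|exact: kc_le1]. Qed.
Lemma bm2_kskc : bm2 (fun p : R * R => ks p.1 * kc p.2).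
Proof. by apply: bm2_tensor; [exact: continuous_ks|exact: continuous_kc|exact: ks_le1|exact: kc_le1]. Qed.
Lemma bm2_kcks : bm2 (fun p : R * R => kc p.1 * ks p.2).
Proof. by apply: bm2_tensor; [exact: continuous_kc|exact: continuous_ks|exact: kc_le1|exact: ks_le1]. Qed.

Definition realf (f : R * R -> R) : cfield := fun b p => if b then f p else 0.

(** The ground state of the square, normalized in L2, and its gradient. *)
Definition w0 (p : R * R) : R := 2 * (kc p.1 * kc p.2).
Definition w1 (p : R * R) : R := - (2 * pi) * (ks p.1 * kc p.2).
Definition w2 (p : R * R) : R := - (2 * pi) * (kc p.1 * ks p.2).
Definition wX : triple := (realf w0, realf w1, realf w2).

Let bw0 : bm2 w0. Proof. by apply: bmM; [exact: bm_cst|exact: bm2_kckc]. Qed.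
Let bw1 : bm2 w1. Proof. by apply: bmM; [exact: bm_cst|exact: bm2_kskc]. Qed.
Let bw2 : bm2 w2. Proof. by apply: bmM; [exact: bm_cst|exact: bm2_kcks]. Qed.

Lemma sqc_realf (f : R * R -> R) : bm2 f -> sqc (realf f).
Proof. by move=> bf [] /=; apply: bm2_sqi => //; exact: bm_cst. Qed.

Definition aw n (p : R * R) : R := (2 * ba n p.1) * ba n p.2.

Let d2ba n (x : R) : is_derive x (1 : R) (fun x => 2 * ba n x) (2 * bda n x).
Proof.
have h := is_derive_ba n x.
exact: (@is_deriveZ _ _ _ (ba n) 2 x 1 (bda n x)).
Qed.

Lemma rtest_aw n : rtest sq1 (aw n).
Proof.
have s2 : smooth1 (fun x : R => 2 * ba n x).
  by move=> k; apply: DkM; [exact: Dk_cst|exact: smooth1_ba].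
split; first exact: (smooth_tensor s2 (smooth1_ba n)).
have [e [e0 eE]] : exists e : R, 0 < e /\ e = (n.+3)%:R^-1 by exists (n.+3)%:R^-1; rewrite invr_gt0.
pose rho : R := 1 / 2 - e.
exists (`[- rho, rho] `*` `[- rho, rho]); split.
- by apply: compact_setX; exact: segment_compact.
- move=> p [] /=; rewrite /I12 !in_itv /= /rho => /andP[a1 a2] /andP[a3 a4].
  by split; rewrite /I12 /= in_itv /=; apply/andP; split; lra.
move=> p hp; rewrite /aw.
have [h1|h1] := leP rho `|p.1|; first by rewrite ba_supp ?mulr0 ?mul0r// -eE.
have [h2|h2] := leP rho `|p.2|; first by rewrite [ba n p.2]ba_supp ?mulr0// -eE.
exfalso; apply: hp; move: h1 h2; rewrite !ltr_norml => /andP[a1 a2] /andP[a3 a4].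
by split; rewrite /= in_itv /=; apply/andP; split; exact: ltW.
Qed.

Lemma derive1_aw n p : 'D_e1 (aw n) p = (2 * bda n p.1) * ba n p.2.
Proof. by case: (derive_tensor1 (ba n) p (d2ba n)). Qed.
Lemma derive2_aw n p : 'D_e2 (aw n) p = (2 * ba n p.1) * bda n p.2.
Proof. by case: (derive_tensor2 (fun x => 2 * ba n x) p (is_derive_ba n)). Qed.

Lemma ctest_realf (f : R * R -> R) : rtest sq1 f -> ctest (realf f).
Proof. by move=> rf []; [exact: rf|exact: rtest0]. Qed.

Lemma jet_realf (f : R * R -> R) : jet (realf f) =
  (realf f, realf (fun p => 'D_e1 f p), realf (fun p => 'D_e2 f p)).
Proof.
by rewrite /jet; congr (_, _, _); apply/funext => -[]; apply/funext => p //=; exact: derive_cst.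
Qed.

Lemma ipc_realf (f g : R * R -> R) : ipc (realf f) (realf g) = ip2 f g.
Proof.
rewrite /ipc /=; have -> : realf f false = 0 by [].
have h : ip2 (0 : R * R -> R) (realf g false) = 0.
  rewrite /ip /Rintegral integral0_eq// => p _; by rewrite mul0r.
by rewrite h addr0.
Qed.

Lemma realfB (f g : R * R -> R) : realf f - realf g = realf (fun p => f p - g p).
Proof. by apply/funext => -[]; apply/funext => p //=; rewrite !fctE /= subr0. Qed.

Lemma nsq_realf3 (f0 f1 f2 g0 g1 g2 : R * R -> R) :
  nsq ((realf f0, realf f1, realf f2) - (realf g0, realf g1, realf g2)) =
  ip2 (fun p => f0 p - g0 p) (fun p => f0 p - g0 p) +
  (ip2 (fun p => f1 p - g1 p) (fun p => f1 p - g1 p) +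
   ip2 (fun p => f2 p - g2 p) (fun p => f2 p - g2 p)).
Proof.
rewrite -!ipc_realf -!realfB; reflexivity.
Qed.

Lemma nsq_realf_lt (f0 f1 f2 g0 g1 g2 : R * R -> R) (e : R) :
  ip2 (fun p => f0 p - g0 p) (fun p => f0 p - g0 p) < e / 3 ->
  ip2 (fun p => f1 p - g1 p) (fun p => f1 p - g1 p) < e / 3 ->
  ip2 (fun p => f2 p - g2 p) (fun p => f2 p - g2 p) < e / 3 ->
  nsq ((realf f0, realf f1, realf f2) - (realf g0, realf g1, realf g2)) < e.
Proof.
rewrite nsq_realf3 => s0 s1 s2.
by apply: lt_le_trans (ltrD s0 (ltrD s1 s2)) _; rewrite three_thirds.
Qed.

Let aw_bm n := C1_bm (smooth_C1 (rtest_aw n).1) (rtest_in_box (rtest_aw n)).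

Let I12E (x : R) : I12 x -> - (1 / 2) < x < 1 / 2.
Proof. by rewrite /I12 /= in_itv. Qed.

(** The cut-off ground states aw n converge, by dominated convergence: their
    gradients are bounded uniformly in n. *)
Lemma W0_wX : W0 wX.
Proof.
split; first by split; exact: sqc_realf.
move=> e e0.
have c0 : ip2 (fun p => w0 p - aw n p) (fun p => w0 p - aw n p) @[n --> \oo] --> (0 : R).
  apply: (@dominated_ip _ (fun n p => w0 p - aw n p) 4).
  - by move=> n; have [h _ _] := aw_bm n; exact: (bmB bw0 h).
  - move=> n p _; apply: le_trans (ler_normB _ _) _.
    have a1 : `|kc p.1 * kc p.2 : R| <= 1 by rewrite normrM mulr_ile1//; exact: kc_le1.
    have a2 : `|ba n p.1 * ba n p.2 : R| <= 1 by rewrite normrM mulr_ile1//; exact: ba_le.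
    rewrite /w0 /aw -(mulrA 2 (ba n p.1)) normrM [X in _ + X]normrM (ger0_norm (ler0n _ 2)).
    by move: a1 a2; move: (`|kc _ * _|) (`|ba _ _ * _|) => A B; lra.
  - move=> p [h1 h2]; rewrite -(subrr (w0 p)); apply: cvgB; first exact: cvg_cst.
    rewrite /w0 mulrA; apply: cvgM; last exact: (ba_cvg (I12E h2)).
    by apply: cvgM; [exact: cvg_cst|exact: (ba_cvg (I12E h1))].
have bnd n (x y : R) : I12 x -> `|- (2 * pi) * (ks x * kc y) - 2 * bda n x * ba n y| <= 16 * pi.
  move=> hx; have pi0 := pi_gt0 R; apply: le_trans (ler_normB _ _) _.
  have a1 : `|- (2 * pi) * (ks x * kc y)| <= 2 * pi.
    rewrite !normrM normrN normrM (ger0_norm (ler0n _ 2)) (gtr0_norm pi0).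
    apply: ler_piMr; first by rewrite mulr_ge0// ltW.
    by apply: mulr_ile1 => //; [exact: ks_le1|exact: kc_le1].
  have a2 : `|2 * bda n x * ba n y| <= 14 * pi.
    rewrite normrM [`|2 * bda n x|]normrM (ger0_norm (ler0n _ 2)).
    have := bda_le n (I12E hx); have := ba_le n y.
    have := normr_ge0 (bda n x); have := normr_ge0 (ba n y).
    move: `|bda n x| `|ba n y| (@pi R) => A B q; nra.
  apply: (le_trans (lerD a1 a2)); rewrite -mulrDl (_ : 2 + 14 = 16 :> R)//; lra.
have c1 : ip2 (fun p => w1 p - 'D_e1 (aw n) p) (fun p => w1 p - 'D_e1 (aw n) p) @[n --> \oo] --> (0 : R).
  apply: (@dominated_ip _ (fun n p => w1 p - 'D_e1 (aw n) p) (16 * pi)).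
  - by move=> n; have [_ h _] := aw_bm n; exact: (bmB bw1 h).
  - by move=> n p [h1 h2]; rewrite derive1_aw; exact: bnd.
  - move=> p [h1 h2]; rewrite -(subrr (w1 p)); apply: cvgB; first exact: cvg_cst.
    under eq_fun do rewrite derive1_aw.
    have -> : w1 p = 2 * (- pi * ks p.1) * kc p.2 by rewrite /w1; ring.
    apply: cvgM; last exact: (ba_cvg (I12E h2)).
    by apply: cvgM; [exact: cvg_cst|exact: (bda_cvg (I12E h1))].
have c2 : ip2 (fun p => w2 p - 'D_e2 (aw n) p) (fun p => w2 p - 'D_e2 (aw n) p) @[n --> \oo] --> (0 : R).
  apply: (@dominated_ip _ (fun n p => w2 p - 'D_e2 (aw n) p) (16 * pi)).
  - by move=> n; have [_ _ h] := aw_bm n; exact: (bmB bw2 h).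
  - move=> n p [h1 h2]; rewrite derive2_aw /w2 (mulrC (kc _)) (mulrAC 2); exact: bnd.
  - move=> p [h1 h2]; rewrite -(subrr (w2 p)); apply: cvgB; first exact: cvg_cst.
    under eq_fun do rewrite derive2_aw.
    have -> : w2 p = 2 * kc p.1 * (- pi * ks p.2) by rewrite /w2; ring.
    apply: cvgM; last exact: (bda_cvg (I12E h2)).
    by apply: cvgM; [exact: cvg_cst|exact: (ba_cvg (I12E h1))].
have e3 : 0 < e / 3 by rewrite divr_gt0.
have small (s : nat -> R) : s n @[n --> \oo] --> (0 : R) -> \forall n \near \oo, s n < e / 3.
  move=> hs; near=> n.
  have : `|s n| < e / 3 by near: n; apply: cvgr0_norm_lt.
  by apply: le_lt_trans; exact: ler_norm.
have n0 := small _ c0; have n1 := small _ c1; have n2 := small _ c2.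
have [n [s0 [s1 s2]]] := filter_ex (filterI n0 (filterI n1 n2)).
exists (realf (aw n)); first by apply: ctest_realf; exact: rtest_aw.
rewrite jet_realf; exact: (nsq_realf_lt s0 s1 s2).
Unshelve. all: by end_near. Qed.

End GroundState.

(** * Completeness, and multiplication by i *)

Section Complete.
Context {R : realType}.
Local Notation cfield := (cfield R).
Local Notation triple := (triple R).
Local Notation V := (V R).

Lemma sqc_complete (f : nat -> cfield) : (forall i, sqc (f i)) ->
  (forall e, 0 < e -> exists N, forall i j, (N <= i)%N -> (N <= j)%N -> ipc (f i - f j) (f i - f j) <= e) ->
  exists2 l, sqc l &
    forall e, 0 < e -> exists N, forall i, (N <= i)%N -> ipc (f i - l) (f i - l) <= e.
Proof.
move=> sf hf.
have h b : exists2 l, sq2 l & forall e : R, 0 < e -> exists N, forall i, (N <= i)%N ->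
    ip2 (f i b - l) (f i b - l) <= e.
  apply: (@sqi_complete _ _ _ _ _ msq1 (fun i => f i b)) => [i|e e0]; first exact: sf.
  have [N hN] := hf e e0; exists N => i j hi hj; apply: le_trans (hN i j hi hj).
  case: b; rewrite /ipc; [rewrite lerDl|rewrite lerDr]; exact: ip_ge0.
have [lt slt hlt] := h true; have [lf slf hlf] := h false.
exists (fun b => if b then lt else lf); first by case.
move=> e e0; have e2 : 0 < e / 2 by rewrite divr_gt0.
have [N hN] := hlt _ e2; have [M hM] := hlf _ e2.
exists (maxn N M) => i; rewrite geq_max => /andP[hi hi'].
by rewrite [leRHS](splitr e); exact: lerD (hN i hi) (hM i hi').
Qed.

Lemma sqt_complete (x : nat -> triple) : (forall i, sqt (x i)) ->
  (forall e, 0 < e -> exists N, forall i j, (N <= i)%N -> (N <= j)%N -> nsq (x i - x j) <= e) ->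
  exists2 l, sqt l & forall e, 0 < e -> exists N, forall i, (N <= i)%N -> nsq (x i - l) <= e.
Proof.
move=> sx hx.
have p0 (y : triple) : [/\ ipc y.1.1 y.1.1 <= nsq y, ipc y.1.2 y.1.2 <= nsq y & ipc y.2 y.2 <= nsq y].
  have := ipc_ge0 y.1.1; have := ipc_ge0 y.1.2; have := ipc_ge0 y.2; rewrite /nsq.
  move: (ipc y.1.1 _) (ipc y.1.2 _) (ipc y.2 _) => A B C *; split; lra.
have [l1 s1 h1] := @sqc_complete (fun i => (x i).1.1) (fun i => let: And3 h _ _ := sx i in h)
  (fun e e0 => let: ex_intro N hN := hx e e0 in
    ex_intro _ N (fun i j hi hj => le_trans (let: And3 h _ _ := p0 (x i - x j) in h) (hN i j hi hj))).
have [l2 s2 h2] := @sqc_complete (fun i => (x i).1.2) (fun i => let: And3 _ h _ := sx i in h)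
  (fun e e0 => let: ex_intro N hN := hx e e0 in
    ex_intro _ N (fun i j hi hj => le_trans (let: And3 _ h _ := p0 (x i - x j) in h) (hN i j hi hj))).
have [l3 s3 h3] := @sqc_complete (fun i => (x i).2) (fun i => let: And3 _ _ h := sx i in h)
  (fun e e0 => let: ex_intro N hN := hx e e0 in
    ex_intro _ N (fun i j hi hj => le_trans (let: And3 _ _ h := p0 (x i - x j) in h) (hN i j hi hj))).
exists (l1, l2, l3); first by [].
move=> e e0; have e3 : 0 < e / 3 by rewrite divr_gt0.
have [N1 H1] := h1 _ e3; have [N2 H2] := h2 _ e3; have [N3 H3] := h3 _ e3.
exists (maxn N1 (maxn N2 N3)) => i; rewrite !geq_max => /andP[i1 /andP[i2 i3]].
by rewrite -[leRHS](three_thirds e); exact: lerD (H1 i i1) (lerD (H2 i i2) (H3 i i3)).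
Qed.

Lemma W0_closed (x : nat -> triple) l : (forall i, W0 (x i)) -> sqt l ->
  (forall e, 0 < e -> exists N, forall i, (N <= i)%N -> nsq (x i - l) <= e) -> W0 l.
Proof.
move=> Wx sl hl; split=> // e e0; have e4 : 0 < e / 8 by rewrite divr_gt0.
have [N /(_ N (leqnn N)) hN] := hl _ e4; have [sx /(_ _ e4)[phi tphi hphi]] := Wx N.
exists phi => //.
have -> : l - jet phi = (-1) *: (x N - l) + (x N - jet phi).
  by rewrite scaleN1r opprB addrA subrK.
apply: (le_lt_trans (nsq_lin_le (-1) (sqtB sx sl) (sqtB sx (sqt_jet tphi)))).
by move: hN hphi; move: (nsq (x N - l)) (nsq (x N - jet phi)) => A B; lra.
Qed.

Lemma complete_dV : (forall u : V, mV u u <= dV u u) -> @complete_form R V (@dV R).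
Proof.
move=> md x cx.
have nE (u : V) : nsq (vval u) = mV u u + dV u u by [].
have [l sl hl] : exists2 l, sqt l &
    forall e, 0 < e -> exists N, forall i, (N <= i)%N -> nsq (vval (x i) - l) <= e.
  apply: sqt_complete => [i|e e0]; first exact: (VP (x i)).1.
  have e2 : 0 < Num.sqrt (e / 2) by rewrite sqrtr_gt0 divr_gt0.
  have [N hN] := cx _ e2; exists N => i j hi hj.
  have {}hN : dV (x i - x j) (x i - x j) <= e / 2.
    have := ltW (hN i j hi hj); rewrite -ler_sqr ?nnegrE ?nrm_ge0 ?sqrtr_ge0//.
    by rewrite nrm_sqr ?dV_ge0// sqr_sqrtr// divr_ge0// ltW.
  have -> : vval (x i) - vval (x j) = vval (x i - x j) by [].
  by rewrite nE [leRHS](splitr e); exact: lerD (le_trans (md _) hN) hN.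
exists (toV (W0_closed (fun i => VP (x i)) sl hl)) => e e0.
have e2 : 0 < e ^+ 2 / 2 by rewrite divr_gt0// exprn_gt0.
have [N hN] := hl _ e2; exists N => i hi.
rewrite -ltr_sqr ?nnegrE ?nrm_ge0 ?(ltW e0)// nrm_sqr ?dV_ge0//.
apply: le_lt_trans (_ : e ^+ 2 / 2 < _); last by have := exprn_gt0 2 e0; lra.
apply: le_trans (hN i hi).
by rewrite -[X in nsq X]/(vval (x i - toV (W0_closed (fun i => VP (x i)) sl hl))) nE lerDr mV_ge0.
Qed.

End Complete.

Section Rotation.
Context {R : realType}.
Local Notation cfield := (cfield R).
Local Notation triple := (triple R).
Local Notation V := (V R).

(** Multiplication by i. *)
Definition imul (f : cfield) : cfield := fun b p => if b then - f false p else f true p.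
Definition imult (x : triple) : triple := (imul x.1.1, imul x.1.2, imul x.2).

Lemma imul_lin (a : R) (f g : cfield) : imul (a *: f + g) = a *: imul f + imul g.
Proof.
apply/funext => -[]; apply/funext => p //=.
by rewrite -[LHS]/(- (a * f false p + g false p)) -[RHS]/(a * - f false p + - g false p); ring.
Qed.

Lemma imult_lin (a : R) (x y : triple) : imult (a *: x + y) = a *: imult x + imult y.
Proof. by rewrite /imult lin11 lin12 lin2 !imul_lin. Qed.

Lemma imultB (x y : triple) : imult (x - y) = imult x - imult y.
Proof. by rewrite addrC -scaleN1r imult_lin scaleN1r addrC. Qed.

Lemma imulK (f : cfield) : imul (imul f) = - f.
Proof. by apply/funext => -[]. Qed.

Lemma sqc_imul (f : cfield) : sqc f -> sqc (imul f).
Proof.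
move=> sf [] /=; last exact: sf.
have := sqi_lin msq1 (-1) (sf false) (sqi0 _ _).
by congr (sq2 _); apply/funext => p; rewrite addr0 scaleN1r.
Qed.

Lemma ipc_imul (f g : cfield) : ipc (imul f) (imul g) = ipc f g.
Proof.
rewrite /ipc addrC; congr (_ + _).
by congr (Rintegral _ _ _); apply/funext => p; rewrite /= mulrNN.
Qed.

Lemma jet_imul (phi : cfield) : ctest phi -> jet (imul phi) = imult (jet phi).
Proof.
move=> tphi; rewrite /jet /imult /=; congr (_, _, _); apply/funext => -[] //.
  apply/funext => p; rewrite -[LHS]/('D_e1 (- phi false) p).
  by rewrite deriveN//; exact: (C1_der1 (smooth_C1 (tphi false).1)).
apply/funext => p; rewrite -[LHS]/('D_e2 (- phi false) p).
  by rewrite deriveN//; exact: (C1_der2 (smooth_C1 (tphi false).1)).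
Qed.

Lemma ctest_imul (phi : cfield) : ctest phi -> ctest (imul phi).
Proof. by move=> h []; [apply: rtestN; exact: h|exact: h]. Qed.

Lemma nsq_imult (x : triple) : nsq (imult x) = nsq x.
Proof. by rewrite /nsq /= !ipc_imul. Qed.

Lemma W0_imult (x : triple) : W0 x -> W0 (imult x).
Proof.
move=> [[s1 s2 s3] hx]; split.
  by split; exact: sqc_imul.
move=> e e0; have [phi tphi hphi] := hx e e0; exists (imul phi); first exact: ctest_imul.
rewrite (jet_imul tphi) -imultB nsq_imult; exact: hphi.
Qed.

Definition JV (u : V) : V := toV (W0_imult (VP u)).

Lemma JVE u : vval (JV u) = imult (vval u). Proof. by []. Qed.

Lemma JV_lin (a : R) (u v : V) : JV (a *: u + v) = a *: JV u + JV v.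
Proof. by apply: val_inj; rewrite /= -imult_lin. Qed.

Lemma JV_cplx : cplx_struct JV.
Proof.
split; first exact: JV_lin.
by move=> u; apply: val_inj; rewrite /= /imult /= !imulK.
Qed.

Lemma preserves_mV : preserves JV (@mV R).
Proof. by move=> u v; rewrite /mV /= ipc_imul. Qed.

End Rotation.

(** * Bounded forms, and the norm of the ground state *)

Section BoundedForms.
Context {R : realType} {V : lmodType R}.
Implicit Types (d q : V -> V -> R).

Lemma bounded_dom d q : symbil q -> (forall u, 0 <= q u u) ->
  (forall u, q u u <= d u u) -> bounded_by d q 1.
Proof.
move=> Hq q0 qd u v; rewrite mul1r; apply: (le_trans (cauchy_schwarz Hq q0 u v)).
by apply: ler_pM; rewrite ?sqrtr_ge0// ler_wsqrtr.
Qed.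

Lemma bounded_comb d q1 q2 (a b M N : R) : bounded_by d q1 M -> bounded_by d q2 N ->
  bounded_by d (fun u v => a * q1 u v + b * q2 u v) (`|a| * M + `|b| * N).
Proof.
move=> h1 h2 u v; apply: (le_trans (ler_normD _ _)); rewrite !normrM mulrDl -!mulrA.
by apply: lerD; exact: ler_wpM2l.
Qed.

Lemma bounded_rank1 d q w M : bounded_by d q M -> symbil q ->
  bounded_by d (fun u v => q u w * q v w) ((M * nrm d w) ^+ 2).
Proof.
move=> h Hq u v; rewrite normrM.
apply: (@le_trans _ _ ((M * (nrm d u * nrm d w)) * (M * (nrm d v * nrm d w)))).
  by apply: ler_pM.
by rewrite le_eqVlt; apply/orP; left; apply/eqP; ring.
Qed.

Lemma symbil_rank1 q w : symbil q -> symbil (fun u v => q u w * q v w).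
Proof.
move=> Hq; split=> [u v|a u v x]; first by rewrite mulrC.
by rewrite !(symbilE Hq); ring.
Qed.

End BoundedForms.

Section Spectrum.
Context {R : realType}.
Local Notation cfield := (cfield R).
Local Notation triple := (triple R).
Local Notation V := (V R).
Local Notation leb := (@lebesgue_measure R).
Local Notation int2 := (Rintegral (mu2 R) sq1).

Definition wV : V := toV (@W0_wX R).

Let pi0 : (pi : R) != 0. Proof. by rewrite gt_eqF// pi_gt0. Qed.

Lemma int_kc2 : Rintegral leb I12 (fun x => kc x ^+ 2) = 1 / 2.
Proof.
have h (x : R) : is_derive x (1 : R) (fun x : R => x / 2 + kc x * ks x / (2 * pi)) (kc x ^+ 2).
  have h1 := is_derive_kc x; have h2 := is_derive_ks x.
  apply: is_derive_eq; rewrite /GRing.scale /=.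
  have := kc_ks x; move: (@pi R) pi0 => q q0; move: (kc x) (ks x) => A B AB.
  have -> : A ^+ 2 = (1 + A ^+ 2 - B ^+ 2) / 2 by lra.
  by field.
rewrite /I12 (@ftc _ _ _ (fun x : R => x / 2 + kc x * ks x / (2 * pi)))//.
- have z : kc (1 / 2) = 0 :> R by rewrite /kc mulrA mulr1 cos_pihalf.
  have z' : kc (- (1 / 2)) = 0 :> R by rewrite /kc mulrN cosN mulrA mulr1 cos_pihalf.
  by rewrite z z' !mul0r; lra.
- lra.
- by move=> x; apply: cvgM; exact: continuous_kc.
Qed.

Lemma int_wf2 : int2 (fun p => wf p ^+ 2) = 1 / 4.
Proof.
have [_ ->] := fubini_slice1 (bmX 2 (@bm2_kckc R)).
have e (y : R) : Rintegral leb I12 (fun x => wf (x, y) ^+ 2) = 1 / 2 * kc y ^+ 2.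
  rewrite -int_kc2 mulrC.
  transitivity (Rintegral leb I12 (fun x => kc y ^+ 2 * kc x ^+ 2)).
    by congr (Rintegral _ _ _); apply/funext => x; rewrite /wf exprMn mulrC.
  apply: bm_RintZ; first exact: mI12.
  - exact: leb_fin.
  - by apply: bmX; split; [apply: continuous_measurable_fun; exact: continuous_kc|exists 1; exact: kc_le1].
transitivity (Rintegral leb I12 (fun y => 1 / 2 * kc y ^+ 2)).
  by congr (Rintegral _ _ _); apply/funext => x; exact: e.
rewrite bm_RintZ ?int_kc2; [lra|exact: mI12|exact: leb_fin|].
by apply: bmX; split; [apply: continuous_measurable_fun; exact: continuous_kc|exists 1; exact: kc_le1].
Qed.

Lemma ipc_realf_r (f : cfield) (g : R * R -> R) : ipc f (realf g) = ip2 (f true) g.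
Proof.
rewrite /ipc; have -> : ip2 (f false) (realf g false) = 0.
  by rewrite /ip /Rintegral integral0_eq// => p _; rewrite /= mulr0.
by rewrite addr0.
Qed.

Lemma mV_ww : mV wV wV = 1.
Proof.
rewrite /mV /= ipc_realf_r /ip /=.
transitivity (int2 (fun p => 4 * wf p ^+ 2)).
  by congr (Rintegral _ _ _); apply/funext => p; rewrite /w0 /wf; ring.
rewrite bm_RintZ ?int_wf2; [lra|exact: msq1|exact: mu2_fin|exact: (bmX 2 (@bm2_kckc R))].
Qed.

End Spectrum.

(** * The eigenvalue equation of the ground state *)

Section Weak.
Context {R : realType}.
Local Notation int2 := (Rintegral (mu2 R) sq1).
Implicit Types f g : R * R -> R.

Let bm_box_mul f g : continuous f -> continuous g ->
  (forall p, 1 / 2 <= `|p.1| \/ 1 / 2 <= `|p.2| -> g p = 0) -> bm2 (fun p => f p * g p).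
Proof.
move=> cf cg g0; apply: bm2_box; first by move=> p; apply: cvgM; [exact: cf|exact: cg].
by move=> p hp; rewrite g0 ?mulr0.
Qed.

Lemma ibp1 f g : C1 f -> C1 g -> in_box g ->
  ip2 f (fun p => 'D_e1 g p) = - int2 (fun p => 'D_e1 f p * g p) .
Proof.
move=> cf cg bg.
have := int_derive1_eq0 (C1M cf cg) (in_boxM f bg).
have -> : (fun p => 'D_e1 (fun p => f p * g p) p) = (fun p => f p * 'D_e1 g p + g p * 'D_e1 f p).
  by apply/funext => p; exact: C1_mul_derive1.
have B1 : bm2 (fun p => f p * 'D_e1 g p).
  apply: bm_box_mul; [exact: C1_cont cf|exact: C1_cont1 cg|].
  by move=> p; exact: derive_out_box.
have B2 : bm2 (fun p => g p * 'D_e1 f p).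
  have -> : (fun p => g p * 'D_e1 f p) = (fun p => 'D_e1 f p * g p) by apply/funext => p; rewrite mulrC.
  apply: bm_box_mul; [exact: C1_cont1 cf|exact: C1_cont cg|].
  by move=> p hp; have /nbhs_singleton := near_out_box bg hp.
move=> e; apply/eqP; rewrite -addr_eq0; apply/eqP; rewrite -[RHS]e.
have -> : int2 (fun p => 'D_e1 f p * g p) = int2 (fun p => g p * 'D_e1 f p).
  by congr (Rintegral _ _ _); apply/funext => p; rewrite mulrC.
exact: (esym (bm_RintD msq1 mu2_fin B1 B2)).
Qed.

Lemma ibp2 f g : C1 f -> C1 g -> in_box g ->
  ip2 f (fun p => 'D_e2 g p) = - int2 (fun p => 'D_e2 f p * g p) .
Proof.
move=> cf cg bg.
have := int_derive2_eq0 (C1M cf cg) (in_boxM f bg).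
have -> : (fun p => 'D_e2 (fun p => f p * g p) p) = (fun p => f p * 'D_e2 g p + g p * 'D_e2 f p).
  by apply/funext => p; exact: C1_mul_derive2.
have B1 : bm2 (fun p => f p * 'D_e2 g p).
  apply: bm_box_mul; [exact: C1_cont cf|exact: C1_cont2 cg|].
  by move=> p; exact: derive_out_box.
have B2 : bm2 (fun p => g p * 'D_e2 f p).
  have -> : (fun p => g p * 'D_e2 f p) = (fun p => 'D_e2 f p * g p) by apply/funext => p; rewrite mulrC.
  apply: bm_box_mul; [exact: C1_cont2 cf|exact: C1_cont cg|].
  by move=> p hp; have /nbhs_singleton := near_out_box bg hp.
move=> e; apply/eqP; rewrite -addr_eq0; apply/eqP; rewrite -[RHS]e.
have -> : int2 (fun p => 'D_e2 f p * g p) = int2 (fun p => g p * 'D_e2 f p).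
  by congr (Rintegral _ _ _); apply/funext => p; rewrite mulrC.
exact: (esym (bm_RintD msq1 mu2_fin B1 B2)).
Qed.

End Weak.

Section Unperturbed.
Context {R : realType}.
Local Notation cfield := (cfield R).
Local Notation triple := (triple R).
Local Notation V := (V R).
Local Notation wV := (@wV R).
Local Notation mV := (@mV R).
Local Notation d1V := (@d1V R).
Local Notation d2V := (@d2V R).
Local Notation dV := (@dV R).
Local Notation nV := (@nV R).
Local Notation int2 := (Rintegral (mu2 R) sq1).

Lemma mV_bounded : bounded_by nV mV 1.
Proof.
apply: bounded_dom; [exact: mV_symbil|exact: mV_ge0|].
by move=> u; rewrite /nV lerDl dV_ge0.
Qed.
Lemma dV_bounded : bounded_by nV dV 1.
Proof.
apply: bounded_dom; [exact: dV_symbil|exact: dV_ge0|].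
by move=> u; rewrite /nV lerDr mV_ge0.
Qed.
Lemma d1V_bounded : bounded_by nV d1V 1.
Proof.
apply: bounded_dom; [exact: d1V_symbil|exact: d1V_ge0|].
move=> u; have := d2V_ge0 u; have := mV_ge0 u; rewrite /nV /dV.
by move: (mV u u) (d1V u u) (d2V u u) => A B C; lra.
Qed.
Lemma d2V_bounded : bounded_by nV d2V 1.
Proof.
apply: bounded_dom; [exact: d2V_symbil|exact: d2V_ge0|].
move=> u; have := d1V_ge0 u; have := mV_ge0 u; rewrite /nV /dV.
by move: (mV u u) (d1V u u) (d2V u u) => A B C; lra.
Qed.

Let dw1 (x : R) : is_derive x (1 : R) (fun x => - (2 * pi) * ks x) (- (2 * pi ^+ 2) * kc x).
Proof.
have h := is_derive_ks x.
have := @is_deriveZ _ _ _ ks (- (2 * pi)) x 1 (pi * kc x) h.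
by congr is_derive; rewrite /GRing.scale /= mulrA mulNr -mulrA expr2.
Qed.

Let cpk : continuous (fun x : R => - (2 * pi ^+ 2) * kc x).
Proof. by move=> x; apply: cvgM; [exact: cvg_cst|exact: continuous_kc]. Qed.
Let cps : continuous (fun x : R => - pi * ks x).
Proof. by move=> x; apply: cvgM; [exact: cvg_cst|exact: continuous_ks]. Qed.

Let w1E : w1 = (fun p : R * R => - (2 * pi) * ks p.1 * kc p.2).
Proof. by apply/funext => p; rewrite /w1 mulrA. Qed.
Let w2E : w2 = (fun p : R * R => kc p.1 * (- (2 * pi) * ks p.2)).
Proof. by apply/funext => p; rewrite /w2 mulrCA mulrA. Qed.

Lemma C1_w1 : C1 (@w1 R).
Proof. by rewrite w1E; exact: (C1_tensor dw1 (@is_derive_kc R) cpk cps). Qed.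
Lemma C1_w2 : C1 (@w2 R).
Proof. by rewrite w2E; exact: (C1_tensor (@is_derive_kc R) dw1 cps cpk). Qed.
Lemma derive_w1 (p : R * R) : 'D_e1 w1 p = - pi ^+ 2 * w0 p.
Proof.
rewrite w1E; have [_ ->] := derive_tensor1 kc p dw1.
by rewrite /w0; move: (@pi R) => q; ring.
Qed.
Lemma derive_w2 (p : R * R) : 'D_e2 w2 p = - pi ^+ 2 * w0 p.
Proof.
rewrite w2E; have [_ ->] := derive_tensor2 kc p dw1.
by rewrite /w0; move: (@pi R) => q; ring.
Qed.

Let bw0 : bm2 (@w0 R).
Proof. by apply: bmM; [exact: bm_cst|exact: bm2_kckc]. Qed.

Let weak_eq (A X : R) : A = - (- pi ^+ 2 * X) -> 1 * A + - pi ^+ 2 * X = 0.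
Proof. by move=> ->; move: (@pi R) => q; ring. Qed.

(** The second derivative of w in each direction is - pi^2 w, so that both
    directional energies agree at w; the smallness of the coupling in
    [second_gt0] rests on this. *)
Lemma d1V_w v : d1V wV v = pi ^+ 2 * mV wV v.
Proof.
apply/eqP; rewrite -subr_eq0; apply/eqP.
have <- : 1 * d1V wV v + - pi ^+ 2 * mV wV v = d1V wV v - pi ^+ 2 * mV wV v by rewrite mul1r mulNr.
apply: (dense_form_eq0 (symbil_comb 1 (- pi ^+ 2) (@d1V_symbil R) (@mV_symbil R))
  (bounded_comb 1 (- pi ^+ 2) d1V_bounded mV_bounded)) => phi h.
apply: weak_eq.
have e1 : d1V wV (jetV h) = ip2 w1 (fun p => 'D_e1 (phi true) p).
  transitivity (ip2 (fun p => 'D_e1 (phi true) p) w1); last exact: ipC.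
  transitivity (ipc (fun b p => 'D_e1 (phi b) p) (realf w1)); first exact: ipcC.
  exact: ipc_realf_r.
have e2 : mV wV (jetV h) = ip2 w0 (phi true).
  transitivity (ip2 (phi true) w0); last exact: ipC.
  transitivity (ipc phi (realf w0)); first exact: ipcC.
  exact: ipc_realf_r.
have ct := smooth_C1 (h true).1; have bt := rtest_in_box (h true).
rewrite e1 (ibp1 C1_w1 ct bt) e2; congr (- _).
transitivity (int2 (fun p => - pi ^+ 2 * (w0 p * phi true p))).
  by congr (Rintegral _ _ _); apply/funext => p; rewrite derive_w1; exact: esym (mulrA _ _ _).
have [b0 _ _] := C1_bm ct bt.
exact: (bm_RintZ msq1 mu2_fin (- pi ^+ 2) (bmM bw0 b0)).
Qed.

Lemma d2V_w v : d2V wV v = pi ^+ 2 * mV wV v.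
Proof.
apply/eqP; rewrite -subr_eq0; apply/eqP.
have <- : 1 * d2V wV v + - pi ^+ 2 * mV wV v = d2V wV v - pi ^+ 2 * mV wV v by rewrite mul1r mulNr.
apply: (dense_form_eq0 (symbil_comb 1 (- pi ^+ 2) (@d2V_symbil R) (@mV_symbil R))
  (bounded_comb 1 (- pi ^+ 2) d2V_bounded mV_bounded)) => phi h.
apply: weak_eq.
have e1 : d2V wV (jetV h) = ip2 w2 (fun p => 'D_e2 (phi true) p).
  transitivity (ip2 (fun p => 'D_e2 (phi true) p) w2); last exact: ipC.
  transitivity (ipc (fun b p => 'D_e2 (phi b) p) (realf w2)); first exact: ipcC.
  exact: ipc_realf_r.
have e2 : mV wV (jetV h) = ip2 w0 (phi true).
  transitivity (ip2 (phi true) w0); last exact: ipC.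
  transitivity (ipc phi (realf w0)); first exact: ipcC.
  exact: ipc_realf_r.
have ct := smooth_C1 (h true).1; have bt := rtest_in_box (h true).
rewrite e1 (ibp2 C1_w2 ct bt) e2; congr (- _).
transitivity (int2 (fun p => - pi ^+ 2 * (w0 p * phi true p))).
  by congr (Rintegral _ _ _); apply/funext => p; rewrite derive_w2; exact: esym (mulrA _ _ _).
have [b0 _ _] := C1_bm ct bt.
exact: (bm_RintZ msq1 mu2_fin (- pi ^+ 2) (bmM bw0 b0)).
Qed.

End Unperturbed.

(** * The spectral gap on the form domain *)

Lemma gap_arith (R : realType) (q n1 n2 a1 a2 b1 b2 X1 X2 : R) :
  n1 * (1 / 4) - X1 ^+ 2 <= a1 + a2 - 2 * q * n1 ->
  n2 * (1 / 4) - X2 ^+ 2 <= b1 + b2 - 2 * q * n2 ->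
  0 <= 1 * (1 * (a1 + b1 + (a2 + b2)) + - (2 * q + 1 / 4) * (n1 + n2)) +
    (1 / 4) * (1 * (2 * X1 * (2 * X1)) + 1 * (2 * X2 * (2 * X2))).
Proof. by move=> h1 h2; nra. Qed.

Section Gap.
Context {R : realType}.
Local Notation cfield := (cfield R).
Local Notation triple := (triple R).
Local Notation V := (V R).
Local Notation wV := (@wV R).
Local Notation mV := (@mV R).
Local Notation dV := (@dV R).
Local Notation nV := (@nV R).
Local Notation JV := (@JV R).
Local Notation int2 := (Rintegral (mu2 R) sq1).

Let bw : bm2 (@wf R). Proof. exact: bm2_kckc. Qed.

Lemma ip_w0 (f : R * R -> R) : bm2 f -> ip2 f w0 = 2 * int2 (fun p => f p * wf p).
Proof.
move=> bf; rewrite -(bm_RintZ msq1 mu2_fin 2 (bmM bf bw)).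
by congr (Rintegral _ _ _); apply/funext => p; rewrite /w0 /wf mulrCA.
Qed.

Lemma ip_sq (f : R * R -> R) : ip2 f f = int2 (fun p => f p ^+ 2).
Proof. by congr (Rintegral _ _ _); apply/funext => p; rewrite expr2. Qed.

Lemma mV_w (u : V) : mV u wV = ip2 ((vval u).1.1 true) w0.
Proof. exact: ipc_realf_r. Qed.

Lemma mV_Jw (u : V) : mV u (JV wV) = ip2 ((vval u).1.1 false) w0.
Proof.
rewrite /mV JVE /imult /= /ipc.
have -> : ip2 ((vval u).1.1 true) (imul (realf w0) true) = 0.
  by rewrite /ip /Rintegral integral0_eq// => p _; rewrite /= oppr0 mulr0.
by rewrite add0r.
Qed.

(** Nonnegativity of this form is the spectral gap: the rank-one terms vanish on
    the complement of w. The unit coefficients match [symbil_comb]. *)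
Definition gap_form (u v : V) : R :=
  1 * (1 * dV u v + - (2 * pi ^+ 2 + 1 / 4) * mV u v) +
  (1 / 4) * (1 * (mV u wV * mV v wV) + 1 * (mV u (JV wV) * mV v (JV wV))).

(** On test functions this is [gap2] for the real and for the imaginary part;
    density does the rest. *)
Lemma gap_form_ge0 u : 0 <= gap_form u u.
Proof.
have Hm := @mV_symbil R.
have S := symbil_comb 1 (1 / 4) (symbil_comb 1 (- (2 * pi ^+ 2 + 1 / 4)) (@dV_symbil R) Hm)
  (symbil_comb 1 1 (symbil_rank1 wV Hm) (symbil_rank1 (JV wV) Hm)).
have B := bounded_comb 1 (1 / 4) (bounded_comb 1 (- (2 * pi ^+ 2 + 1 / 4)) (@dV_bounded R) (@mV_bounded R))
  (bounded_comb 1 1 (bounded_rank1 wV (@mV_bounded R) Hm) (bounded_rank1 (JV wV) (@mV_bounded R) Hm)).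
apply: (dense_form_ge0 S B) => phi h.
have ct := smooth_C1 (h true).1; have bt := rtest_in_box (h true).
have cf := smooth_C1 (h false).1; have bf := rtest_in_box (h false).
have [b0 _ _] := C1_bm ct bt; have [b0' _ _] := C1_bm cf bf.
rewrite mV_w mV_Jw (ip_w0 b0) (ip_w0 b0').
have := gap2 ct bt; have := gap2 cf bf; rewrite int_wf2 -!ip_sq => g2 g1.
exact: (gap_arith g1 g2).
Qed.

Lemma mV_JwJw : mV (JV wV) (JV wV) = 1.
Proof. by rewrite preserves_mV mV_ww. Qed.

Lemma mV_coord_le (u z : V) : mV z z = 1 -> mV u z ^+ 2 <= mV u u.
Proof.
move=> z1; have := cauchy_schwarz (@mV_symbil R) (@mV_ge0 R) u z.
rewrite z1 sqrtr1 mulr1 -ler_sqr ?nnegrE ?sqrtr_ge0// sqr_sqrtr ?mV_ge0//.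
by rewrite real_normK// num_real.
Qed.

Let arith_gap (D q M a b : R) : a = 0 -> b = 0 ->
  0 <= 1 * (1 * D + - (2 * q + 1 / 4) * M) + (1 / 4) * (1 * (a * a) + 1 * (b * b)) ->
  (2 * q + 1 / 4) * M <= D.
Proof. by move=> -> -> h; lra. Qed.

Let arith_md (D p M a b : R) : 2 <= p -> 0 <= M -> a ^+ 2 <= M -> b ^+ 2 <= M ->
  0 <= 1 * (1 * D + - (2 * p ^+ 2 + 1 / 4) * M) + (1 / 4) * (1 * (a * a) + 1 * (b * b)) ->
  M <= D.
Proof.
move=> p2 M0 ha hb h; have pp : 4 <= p ^+ 2 by nra.
have : 4 * M <= p ^+ 2 * M by exact: ler_wpM2r.
by move: (p ^+ 2 * M) (erefl (p ^+ 2 * M)) => X XE; move: h; rewrite -!expr2; nra.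
Qed.

Lemma unperturbed_square : unperturbed (fun u v => d1V u v + d2V u v) mV JV wV (2 * pi ^+ 2) (1 / 4).
Proof.
have md u : mV u u <= dV u u.
  apply: (arith_md (@pi_ge2 R) (mV_ge0 u) (mV_coord_le u mV_ww) (mV_coord_le u mV_JwJw)).
  exact: gap_form_ge0.
split.
- exact: dV_symbil.
- exact: dV_ge0.
- exact: complete_dV.
- exact: mV_symbil.
- exact: mV_ge0.
- exact: md.
- exact: JV_cplx.
- exact: preserves_mV.
- exact: mV_ww.
- by move=> v; rewrite d1V_w d2V_w -mulrDl -mulr2n mulr_natl.
- by rewrite mulr_gt0// exprn_gt0// pi_gt0.
- by rewrite divr_gt0.
- move=> u h1 h2; apply: (arith_gap h1 h2); exact: gap_form_ge0.
Qed.

End Gap.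

(** * Measure-preserving maps of the plane *)

Section MeasurePreserving.
Context d (X : measurableType d) (R : realType) (mu : {measure set X -> \bar R}).
Variables (phi : X -> X) (D : set X).
Hypotheses (mphi : measurable_fun setT phi) (mD : measurable D).
Hypothesis pres : forall A, measurable A -> mu (phi @^-1` A) = mu A.

Lemma mp_domain : measurable (phi @^-1` D).
Proof. by rewrite -(setTI (_ @^-1` _)); exact: mphi. Qed.

Lemma mp_measurable d' (Y : measurableType d') (f : X -> Y) :
  measurable_fun D f -> measurable_fun (phi @^-1` D) (f \o phi).
Proof.
move=> mf; apply: (measurable_comp (F := D)) => //; first by move=> _ [x Dx <-].
exact: measurable_funTS.
Qed.

Lemma mp_ge0_integral (f : X -> \bar R) : measurable_fun D f -> (forall x, D x -> (0 <= f x)%E) ->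
  (\int[mu]_(x in phi @^-1` D) f (phi x) = \int[mu]_(x in D) f x)%E.
Proof.
move=> mf f0; have <- := ge0_integral_pushforward mphi mu mD mf _; last first.
  by move=> y /set_mem; exact: f0.
have h := @eq_measure_integral _ _ _ D mu (measure_function_pushforward__canonical__measure_function_Measure mu mphi) f.
by rewrite h// => A mA _ /=; rewrite /pushforward pres.
Qed.

(** Positive and negative part are transported separately, so that no
    integrability enters. *)
Lemma mp_integral (f : X -> \bar R) : measurable_fun D f ->
  (\int[mu]_(x in phi @^-1` D) f (phi x) = \int[mu]_(x in D) f x)%E.
Proof.
move=> mf; rewrite integralE [RHS]integralE.
congr (_ - _)%E; rewrite -[RHS]mp_ge0_integral.
- by apply: eq_integral => x _; rewrite ?funeposE ?funenegE.
- exact: measurable_funepos.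
- by move=> x _; exact: funepos_ge0.
- by apply: eq_integral => x _; rewrite ?funeposE ?funenegE.
- exact: measurable_funeneg.
- by move=> x _; exact: funeneg_ge0.
Qed.

Lemma mp_Rintegral (f : X -> R) : measurable_fun D f ->
  Rintegral mu (phi @^-1` D) (f \o phi) = Rintegral mu D f.
Proof.
move=> mf; rewrite /Rintegral -(mp_integral (f := EFin \o f))//.
exact/measurable_EFinP.
Qed.

Lemma mp_sqi (f : X -> R) : sqi mu D f -> sqi mu (phi @^-1` D) (f \o phi).
Proof.
move=> [mf fi]; split; first exact: mp_measurable.
rewrite (mp_integral (f := fun x => (f x ^+ 2)%:E))//.
by apply/measurable_EFinP; exact: measurable_funX.
Qed.

Lemma mp_ip (f g : X -> R) : measurable_fun D f -> measurable_fun D g ->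
  ip mu (phi @^-1` D) (f \o phi) (g \o phi) = ip mu D f g.
Proof. by move=> mf mg; exact: (mp_Rintegral (measurable_funM mf mg)). Qed.

End MeasurePreserving.

Section PlaneMaps.
Context {R : realType}.
Local Notation leb := (@lebesgue_measure R).

Lemma leb_scale (s : R) (A : set (measurableTypeR R)) : 0 < s -> measurable A ->
  leb ((fun x => s * x) @^-1` A) = ((s^-1)%:E * leb A)%E.
Proof.
move=> s0 mA.
have ms : measurable_fun [set: measurableTypeR R] (fun x : measurableTypeR R => s * x : measurableTypeR R).
  by apply: measurable_funM; [exact: measurable_cst|exact: measurable_id].
pose nu := measure_function_pushforward__canonical__measure_function_Measure leb ms.
have sge : 0 <= s by exact: ltW.
pose nu' := mscale (NngNum sge) nu.
have h : leb A = nu' A.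
  apply: lebesgue_measure_unique mA => _ [[a b] _ <-].
  rewrite -[RHS]/((s%:E * leb ((fun x : R => (s * x)%R) @^-1` `]a, b]%classic))%E).
  have -> : (fun x => s * x) @^-1` `]a, b]%classic = `]a / s, b / s]%classic.
    apply/seteqP; split=> x /=; rewrite !in_itv /= ltr_pdivrMr// ler_pdivlMr// (mulrC x)//.
  rewrite !lebesgue_measure_itv /= !lte_fin ltr_pM2r ?invr_gt0//.
  case: ifPn => ab; last by rewrite mule0.
  by rewrite -!EFinB -EFinM -mulrBl mulrC divfK// gt_eqF.
by rewrite h /nu' /mscale /= muleA -EFinM mulVf ?mul1e// gt_eqF.
Qed.

Definition dilate (a : R) (p : plane R) : plane R := (a * p.1, a^-1 * p.2).
Definition mirror (p : plane R) : plane R := (p.2, p.1).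

Lemma measurable_dilate (a : R) : measurable_fun setT (dilate a).
Proof.
apply/measurable_fun_pairP; split.
  by apply: measurable_funM; [exact: measurable_cst|exact: measurable_fst].
by apply: measurable_funM; [exact: measurable_cst|exact: measurable_snd].
Qed.

Lemma measurable_mirror : measurable_fun setT mirror.
Proof. by apply/measurable_fun_pairP; split; [exact: measurable_snd|exact: measurable_fst]. Qed.

Lemma plane_measure_unique (phi : plane R -> plane R) : measurable_fun setT phi ->
  (forall A B : set (measurableTypeR R), measurable A -> measurable B ->
    mu2 R (phi @^-1` (A `*` B)) = (leb A * leb B)%E) ->
  forall A, measurable A -> mu2 R (phi @^-1` A) = mu2 R A.
Proof.
move=> mphi h A mA; apply/esym.
exact: (@product_measure_unique _ _ _ _ _ leb leb
  (measure_function_pushforward__canonical__measure_function_Measure (mu2 R) mphi) h A mA).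
Qed.

Lemma mu2_dilate (a : R) : 0 < a -> forall A, measurable A -> mu2 R (dilate a @^-1` A) = mu2 R A.
Proof.
move=> a0; apply: plane_measure_unique; first exact: measurable_dilate.
move=> A B mA mB.
have -> : dilate a @^-1` (A `*` B) = ((fun x => a * x) @^-1` A) `*` ((fun x => a^-1 * x) @^-1` B) by [].
have m s (C : set (measurableTypeR R)) : measurable C -> measurable ((fun x : measurableTypeR R => s * x : measurableTypeR R) @^-1` C).
  move=> mC; rewrite -(setTI (_ @^-1` _)).
  have : measurable_fun [set: measurableTypeR R] (fun x : measurableTypeR R => s * x : measurableTypeR R).
    by apply: measurable_funM; [exact: measurable_cst|exact: measurable_id].
  exact.
rewrite product_measure1E; [|exact: m|exact: m].
transitivity ((a^-1)%:E * leb A * (a%:E * leb B))%E.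
  congr (_ * _)%E; first exact: leb_scale.
  by rewrite -{2}(invrK a); apply: leb_scale; rewrite ?invr_gt0.
by rewrite muleACA -EFinM mulVf ?mul1e// gt_eqF.
Qed.

Lemma mu2_mirror A : measurable A -> mu2 R (mirror @^-1` A) = mu2 R A.
Proof.
apply: plane_measure_unique; first exact: measurable_mirror.
move=> B C mB mC; have -> : mirror @^-1` (B `*` C) = C `*` B.
  by apply/seteqP; split=> -[x y] [].
by rewrite product_measure1E// muleC.
Qed.

End PlaneMaps.

(** * The magnetic forms *)

Section Magnetic.
Context {R : realType}.
Local Notation cfield := (cfield R).
Local Notation triple := (triple R).
Local Notation V := (V R).
Local Notation dV := (@dV R).

Implicit Types (f g : cfield) (x y : triple).

Definition mulc (k : R * R -> R) (f : cfield) : cfield := fun c p => k p * f c p.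

Lemma mulc_lin k (a : R) f g : mulc k (a *: f + g) = a *: mulc k f + mulc k g.
Proof.
apply/funext => c; apply/funext => p.
by rewrite -[LHS]/(k p * (a * f c p + g c p)) -[RHS]/(a * (k p * f c p) + k p * g c p); ring.
Qed.

Lemma imul_mulc k f : imul (mulc k f) = mulc k (imul f).
Proof. by apply/funext => -[]; apply/funext => p //=; rewrite /mulc /= mulrN. Qed.

Lemma mulc_bounded k f (M : R) : measurable_fun setT (k : plane R -> R) ->
  (forall p, sq1 p -> `|k p| <= M) -> sqc f ->
  sqc (mulc k f) /\ ipc (mulc k f) (mulc k f) <= M ^+ 2 * ipc f f.
Proof.
move=> mk kM sf; have mk' : measurable_fun (sq1 : set (plane R)) k by exact: measurable_funTS.
have [t1 t2] := sqi_bounded msq1 mk' kM (sf true).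
have [f1 f2] := sqi_bounded msq1 mk' kM (sf false).
split; first by case.
by rewrite /ipc mulrDr; exact: lerD.
Qed.

Lemma coord1_le (p : R * R) : sq1 p -> `|p.1| <= 1 / 2.
Proof. by move=> [+ _]; rewrite /I12 /= in_itv /= -ltr_norml => /ltW. Qed.
Lemma coord2_le (p : R * R) : sq1 p -> `|p.2| <= 1 / 2.
Proof. by move=> [_]; rewrite /I12 /= in_itv /= -ltr_norml => /ltW. Qed.

(** The zero-order terms of the covariant derivatives for b = 1: those of u are
    d_1 u + i b y u and d_2 u - i b x u. *)
Definition potential1 (f : cfield) : cfield := mulc snd (imul f).
Definition potential2 (f : cfield) : cfield := - mulc fst (imul f).

Definition cov1 (b : R) (x : triple) : cfield := b *: potential1 x.1.1 + x.1.2.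
Definition cov2 (b : R) (x : triple) : cfield := b *: potential2 x.1.1 + x.2.

Lemma potential1_lin (a : R) f g : potential1 (a *: f + g) = a *: potential1 f + potential1 g.
Proof. by rewrite /potential1 imul_lin mulc_lin. Qed.
Lemma potential2_lin (a : R) f g : potential2 (a *: f + g) = a *: potential2 f + potential2 g.
Proof. by rewrite /potential2 imul_lin mulc_lin opprD scalerN. Qed.

Lemma cov1_lin b (a : R) x y : cov1 b (a *: x + y) = a *: cov1 b x + cov1 b y.
Proof.
rewrite /cov1 lin11 lin12 potential1_lin scalerDr scalerA mulrC -scalerA.
by rewrite scalerDr addrACA.
Qed.
Lemma cov2_lin b (a : R) x y : cov2 b (a *: x + y) = a *: cov2 b x + cov2 b y.
Proof.
rewrite /cov2 lin11 lin2 potential2_lin scalerDr scalerA mulrC -scalerA.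
by rewrite scalerDr addrACA.
Qed.

Lemma ipcN f g : ipc (- f) (- g) = ipc f g.
Proof.
by rewrite /ipc; congr (_ + _); congr (Rintegral _ _ _); apply/funext => p; rewrite /= mulrNN.
Qed.

Lemma sqcN f : sqc f -> sqc (- f).
Proof. by move=> sf; have := sqc_lin (-1) sf (@sqc0 R); rewrite addr0 scaleN1r. Qed.

Lemma half_sqr : (1 / 2) ^+ 2 = 1 / 4 :> R.
Proof. by field. Qed.

Lemma potential1_bounded f : sqc f ->
  sqc (potential1 f) /\ ipc (potential1 f) (potential1 f) <= 1 / 4 * ipc f f.
Proof.
move=> sf; rewrite -half_sqr -(ipc_imul f f).
apply: mulc_bounded; [exact: measurable_snd|exact: coord2_le|exact: sqc_imul].
Qed.
Lemma potential2_bounded f : sqc f ->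
  sqc (potential2 f) /\ ipc (potential2 f) (potential2 f) <= 1 / 4 * ipc f f.
Proof.
move=> sf; rewrite -half_sqr -(ipc_imul f f) ipcN.
have [h1 h2] : sqc (mulc fst (imul f)) /\
    ipc (mulc fst (imul f)) (mulc fst (imul f)) <= (1 / 2) ^+ 2 * ipc (imul f) (imul f).
  apply: mulc_bounded; [exact: measurable_fst|exact: coord1_le|exact: sqc_imul].
by split=> //; exact: sqcN.
Qed.

Lemma sqc_cov1 b x : sqt x -> sqc (cov1 b x).
Proof. by move=> [s1 s2 _]; apply: sqc_lin => //; have [] := potential1_bounded s1. Qed.
Lemma sqc_cov2 b x : sqt x -> sqc (cov2 b x).
Proof. by move=> [s1 _ s2]; apply: sqc_lin => //; have [] := potential2_bounded s1. Qed.

Lemma cov1_imult b x : cov1 b (imult x) = imul (cov1 b x).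
Proof. by rewrite /cov1 imul_lin /potential1 imul_mulc. Qed.
Lemma cov2_imult b x : cov2 b (imult x) = imul (cov2 b x).
Proof.
rewrite /cov2 imul_lin /potential2; congr (_ *: _ + _).
by rewrite -[imult x]/(imul x.1.1, imul x.1.2, imul x.2) /= -imul_mulc -imulK -[in RHS]imulK.
Qed.

Definition t1V (b : R) (u v : V) : R := ipc (cov1 b (vval u)) (cov1 b (vval v)).
Definition t2V (b : R) (u v : V) : R := ipc (cov2 b (vval u)) (cov2 b (vval v)).

Lemma t1V_symbil b : symbil (t1V b).
Proof.
apply: (@symbil_of _ (fun u => cov1 b (vval u))) => [u|a u v]; last exact: (cov1_lin b a (vval u) (vval v)).
exact: sqc_cov1 (VP u).1.
Qed.
Lemma t2V_symbil b : symbil (t2V b).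
Proof.
apply: (@symbil_of _ (fun u => cov2 b (vval u))) => [u|a u v]; last exact: (cov2_lin b a (vval u) (vval v)).
exact: sqc_cov2 (VP u).1.
Qed.

Lemma preserves_t1V b : preserves (@JV R) (t1V b).
Proof. by move=> u v; rewrite /t1V !JVE !cov1_imult ipc_imul. Qed.
Lemma preserves_t2V b : preserves (@JV R) (t2V b).
Proof. by move=> u v; rewrite /t2V !JVE !cov2_imult ipc_imul. Qed.

(** The cross term 2 b ipc k g is split by the inequality between arithmetic and
    geometric mean. *)
Lemma ipc_perturb (b : R) k g : sqc k -> sqc g ->
  `|ipc (b *: k + g) (b *: k + g) - ipc g g| <= `|b| * (ipc k k + ipc g g) + b ^+ 2 * ipc k k.
Proof.
move=> sk sg; have s (c : R) := sqc_lin c sk sg.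
have e (c : R) : ipc (c *: k + g) (c *: k + g) = c ^+ 2 * ipc k k + 2 * c * ipc k g + ipc g g.
  rewrite (ipc_lin c sk sg (s c)) (ipcC k) (ipcC g) (ipc_lin c sk sg sk) (ipc_lin c sk sg sg).
  by rewrite (ipcC g k); ring.
have p := ipc_ge0 (1 *: k + g); have m := ipc_ge0 ((-1) *: k + g).
rewrite e in p; rewrite e in m; rewrite e.
have K0 := ipc_ge0 k; have G0 := ipc_ge0 g; move: p m K0 G0.
move: (ipc k k) (ipc k g) (ipc g g) => K X G p m K0 G0.
have X1 : `|2 * X| <= K + G by rewrite ler_norml; apply/andP; split; lra.
have -> : b ^+ 2 * K + 2 * b * X + G - G = b * (2 * X) + b ^+ 2 * K by ring.
apply: (le_trans (ler_normD _ _)); apply: lerD; first by rewrite normrM ler_wpM2l.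
by rewrite ger0_norm// mulr_ge0// sqr_ge0.
Qed.

(** 2 q is the difference of the nonnegative forms M d + q and M d - q, both of
    which obey the Cauchy-Schwarz inequality. *)
Lemma bounded_diag (W : lmodType R) (d q : W -> W -> R) (M : R) : symbil d -> symbil q ->
  0 <= M -> (forall u, 0 <= d u u) -> (forall u, `|q u u| <= M * d u u) -> bounded_by d q M.
Proof.
move=> Hd Hq M0 d0 qd u v.
have Hp := symbil_comb M 1 Hd Hq; have Hn := symbil_comb M (-1) Hd Hq.
have p0 z : 0 <= M * d z z + 1 * q z z by have := qd z; rewrite ler_norml => /andP[]; lra.
have n0 z : 0 <= M * d z z + (-1) * q z z by have := qd z; rewrite ler_norml => /andP[]; lra.
have cp := cauchy_schwarz Hp p0 u v; have cn := cauchy_schwarz Hn n0 u v.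
rewrite /nrm.
have s (f : W -> R) z : (forall z, 0 <= f z) -> Num.sqrt (f z) ^+ 2 = f z by move=> h; rewrite sqr_sqrtr.
have a1 := s (fun z => M * d z z + 1 * q z z) u p0; have a2 := s (fun z => M * d z z + 1 * q z z) v p0.
have b1 := s (fun z => M * d z z + -1 * q z z) u n0; have b2 := s (fun z => M * d z z + -1 * q z z) v n0.
have e1 := s (fun z => d z z) u d0; have e2 := s (fun z => d z z) v d0.
move: cp cn a1 a2 b1 b2 e1 e2; cbv beta.
move: (sqrtr_ge0 (M * d u u + 1 * q u u)) (sqrtr_ge0 (M * d v v + 1 * q v v)).
move: (sqrtr_ge0 (M * d u u + -1 * q u u)) (sqrtr_ge0 (M * d v v + -1 * q v v)).
move: (sqrtr_ge0 (d u u)) (sqrtr_ge0 (d v v)).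
move: (Num.sqrt (M * d u u + 1 * q u u)) (Num.sqrt (M * d v v + 1 * q v v)).
move: (Num.sqrt (M * d u u + -1 * q u u)) (Num.sqrt (M * d v v + -1 * q v v)).
move: (Num.sqrt (d u u)) (Num.sqrt (d v v)).
move: (d u u) (d v v) (d u v) (q u u) (q v v) (q u v) => du dv duv qu qv quv.
move=> D1 D2 N1 N2 P1 P2 D10 D20 N10 N20 P10 P20 cp cn a1 a2 b1 b2 e1 e2.
have key : P1 * P2 + N1 * N2 <= 2 * M * (D1 * D2).
  rewrite -ler_sqr ?nnegrE ?addr_ge0 ?mulr_ge0//.
  have -> : (2 * M * (D1 * D2)) ^+ 2 = (2 * M * D1 ^+ 2) * (2 * M * D2 ^+ 2) by ring.
  have h1 : 2 * M * D1 ^+ 2 = P1 ^+ 2 + N1 ^+ 2 by rewrite e1 a1 b1; ring.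
  have h2 : 2 * M * D2 ^+ 2 = P2 ^+ 2 + N2 ^+ 2 by rewrite e2 a2 b2; ring.
  by rewrite h1 h2 -subr_ge0; have := sqr_ge0 (P1 * N2 - P2 * N1); congr (_ <= _); ring.
move: cp cn; rewrite !ler_norml => /andP[c1 c2] /andP[c3 c4].
by apply/andP; split; lra.
Qed.

End Magnetic.

(** * Perturbation bounds and the mirror symmetry *)

Section Near.
Context {R : realType}.
Local Notation cfield := (cfield R).
Local Notation triple := (triple R).
Local Notation V := (V R).
Local Notation dV := (@dV R).

Lemma symbilB (q1 q2 : V -> V -> R) : symbil q1 -> symbil q2 -> symbil (fun u v => q1 u v - q2 u v).
Proof.
move=> h1 h2; split=> [u v|c u v x]; first by rewrite (symbilC h1) (symbilC h2).
by rewrite !(symbilE h1) !(symbilE h2); ring.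
Qed.

Lemma mV_le_dV (u : V) : mV u u <= dV u u.
Proof. exact: up_md (@unperturbed_square R) u. Qed.

Let arith (b X K G M D : R) : X <= `|b| * (K + G) + b ^+ 2 * K ->
  K <= 1 / 4 * M -> M <= D -> 0 <= K -> 0 <= M -> 0 <= G -> G <= D ->
  X <= (2 * `|b| + b ^+ 2) * D.
Proof.
move=> h1 h2 h3 h4 h5 h6 h7; apply: (le_trans h1); rewrite mulrDl; apply: lerD.
  have -> : 2 * `|b| * D = `|b| * (2 * D) by ring.
  rewrite ler_wpM2l//; lra.
by rewrite ler_wpM2l ?sqr_ge0//; lra.
Qed.

Let eps_ge0 (b : R) : 0 <= 2 * `|b| + b ^+ 2.
Proof. by rewrite addr_ge0 ?sqr_ge0// mulr_ge0. Qed.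

Lemma t1V_near (b : R) : bounded_by dV (fun u v => t1V b u v - d1V u v) (2 * `|b| + b ^+ 2).
Proof.
apply: bounded_diag; [exact: dV_symbil|exact: symbilB (t1V_symbil b) (@d1V_symbil R)|exact: eps_ge0|exact: dV_ge0|].
move=> u; have [[s1 s2 _] _] := VP u; have [p1 p2] := potential1_bounded s1.
apply: (arith (ipc_perturb b p1 s2) p2 (mV_le_dV u)); [exact: ipc_ge0|exact: ipc_ge0|exact: ipc_ge0|].
by rewrite /dV lerDl; exact: ipc_ge0.
Qed.

Lemma t2V_near (b : R) : bounded_by dV (fun u v => t2V b u v - d2V u v) (2 * `|b| + b ^+ 2).
Proof.
apply: bounded_diag; [exact: dV_symbil|exact: symbilB (t2V_symbil b) (@d2V_symbil R)|exact: eps_ge0|exact: dV_ge0|].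
move=> u; have [[s1 _ s2] _] := VP u; have [p1 p2] := potential2_bounded s1.
apply: (arith (ipc_perturb b p1 s2) p2 (mV_le_dV u)); [exact: ipc_ge0|exact: ipc_ge0|exact: ipc_ge0|].
by rewrite /dV lerDr; exact: ipc_ge0.
Qed.

End Near.

Section TestComposition.
Context {R : realType}.
Implicit Types (f : R * R -> R).

Lemma rtest_comp Omega Omega' (S T : R * R -> R * R) f : continuous S -> cancel T S ->
  (forall p, Omega p -> Omega' (S p)) -> (forall f, smooth f -> smooth (f \o T)) ->
  rtest Omega f -> rtest Omega' (f \o T).
Proof.
move=> cS TK hO hs [sf [K [cK KO K0]]]; split; first exact: hs.
exists (S @` K); split.
- by apply: continuous_compact => //; exact: continuous_subspaceT.
- by move=> _ [p /KO Op <-]; exact: hO.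
by move=> p hp; apply: K0 => KT; apply: hp; exists (T p).
Qed.

Lemma derive_mirror1 f p : 'D_e1 (f \o mirror) p = 'D_e2 f (mirror p).
Proof. by rewrite derive_slice1 derive_slice2. Qed.
Lemma derive_mirror2 f p : 'D_e2 (f \o mirror) p = 'D_e1 f (mirror p).
Proof. by rewrite derive_slice1 derive_slice2. Qed.

Lemma continuous_mirror : continuous (mirror : R * R -> R * R).
Proof.
move=> p; have h1 : (fun q : R * R => q.1) @ p --> p.1 by exact: cvg_fst.
have h2 : (fun q : R * R => q.2) @ p --> p.2 by exact: cvg_snd.
exact: cvg_pair h2 h1.
Qed.

Lemma smooth_mirror f : smooth f -> smooth (f \o mirror).
Proof.
move=> sf k; elim: k f {sf}(sf k) => [|k IH] f [cf hf]; split=> //.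
- by move=> p; apply: continuous_comp; [exact: continuous_mirror|exact: cf].
- by move=> p; apply: continuous_comp; [exact: continuous_mirror|exact: cf].
case: hf => h1 h2 h3 h4; split.
- by move=> p; rewrite derivable_slice1; have := h2 (mirror p); rewrite derivable_slice2.
- by move=> p; rewrite derivable_slice2; have := h1 (mirror p); rewrite derivable_slice1.
- have -> : (fun p => 'D_e1 (f \o mirror) p) = (fun p => 'D_e2 f p) \o mirror.
    by apply/funext => p; exact: derive_mirror1.
  exact: IH.
- have -> : (fun p => 'D_e2 (f \o mirror) p) = (fun p => 'D_e1 f p) \o mirror.
    by apply/funext => p; exact: derive_mirror2.
  exact: IH.
Qed.

End TestComposition.

Section Swap.
Context {R : realType}.
Local Notation cfield := (cfield R).
Local Notation triple := (triple R).
Local Notation V := (V R).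
Implicit Types (f g : cfield) (x y : triple).

Lemma mirror_sq1 : mirror @^-1` sq1 = sq1 :> set (plane R).
Proof. by apply/seteqP; split=> -[a b] []. Qed.

Lemma sqi_mirror (h : R * R -> R) : sq2 h -> sq2 (h \o mirror).
Proof. by move=> sh; have := mp_sqi measurable_mirror msq1 mu2_mirror sh; rewrite mirror_sq1. Qed.

Lemma ip_mirror (h k : R * R -> R) : sq2 h -> sq2 k -> ip2 (h \o mirror) (k \o mirror) = ip2 h k.
Proof. by move=> [mh _] [mk _]; have := mp_ip measurable_mirror msq1 mu2_mirror mh mk; rewrite mirror_sq1. Qed.

(** Reflection in the diagonal followed by complex conjugation: the reflection
    reverses the magnetic field, and the conjugation restores it. *)
Definition cswap f : cfield := fun c p => if c then f true (mirror p) else - f false (mirror p).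
Definition tswap x : triple := (cswap x.1.1, cswap x.2, cswap x.1.2).

Lemma sqc_cswap f : sqc f -> sqc (cswap f).
Proof.
move=> sf [] /=; first exact: sqi_mirror (sf true).
by have := sqi_lin msq1 (-1) (sqi_mirror (sf false)) (sqi0 _ _); rewrite addr0 scaleN1r.
Qed.

Lemma ipc_cswap f g : sqc f -> sqc g -> ipc (cswap f) (cswap g) = ipc f g.
Proof.
move=> sf sg; rewrite /ipc -(ip_mirror (sf true) (sg true)) -(ip_mirror (sf false) (sg false)).
by congr (_ + _); congr (Rintegral _ _ _); apply/funext => p; rewrite /= mulrNN.
Qed.

Lemma cswap_lin (a : R) f g : cswap (a *: f + g) = a *: cswap f + cswap g.
Proof.
apply/funext => -[]; apply/funext => p //=.
by rewrite -[LHS]/(- (a * f false (mirror p) + g false (mirror p)))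
  -[RHS]/(a * - f false (mirror p) + - g false (mirror p)); ring.
Qed.
Lemma tswap_lin (a : R) x y : tswap (a *: x + y) = a *: tswap x + tswap y.
Proof. by rewrite /tswap lin11 lin12 lin2 !cswap_lin. Qed.
Lemma tswapB x y : tswap (x - y) = tswap x - tswap y.
Proof. by rewrite addrC -scaleN1r tswap_lin scaleN1r addrC. Qed.

Lemma rtest_mirror (h : R * R -> R) : rtest sq1 h -> rtest sq1 (h \o mirror).
Proof.
apply: (@rtest_comp _ _ _ mirror mirror); [exact: continuous_mirror|by case| |exact: smooth_mirror].
by move=> p []; split.
Qed.

Lemma ctest_cswap f : ctest f -> ctest (cswap f).
Proof.
move=> h []; first exact: rtest_mirror (h true).
exact: rtestN (rtest_mirror (h false)).
Qed.

Lemma jet_cswap f : ctest f -> jet (cswap f) = tswap (jet f).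
Proof.
move=> h; have c1 := smooth_C1 (rtest_mirror (h false)).1.
rewrite /jet /tswap /=; congr (_, _, _); apply/funext => -[]; apply/funext => p.
- exact: derive_mirror1.
- rewrite -[LHS]/('D_e1 (- (f false \o mirror)) p) deriveN; last exact: (C1_der1 c1).
  by rewrite derive_mirror1.
- exact: derive_mirror2.
- rewrite -[LHS]/('D_e2 (- (f false \o mirror)) p) deriveN; last exact: (C1_der2 c1).
  by rewrite derive_mirror2.
Qed.

Lemma nsq_tswap x : sqt x -> nsq (tswap x) = nsq x.
Proof.
move=> [s1 s2 s3]; rewrite /nsq /=.
by rewrite (ipc_cswap s1 s1) (ipc_cswap s2 s2) (ipc_cswap s3 s3) [X in _ + X]addrC.
Qed.

Lemma W0_tswap x : W0 x -> W0 (tswap x).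
Proof.
move=> [sx hx]; split; first by case: sx => s1 s2 s3; split; exact: sqc_cswap.
move=> e e0; have [phi tphi hphi] := hx e e0; exists (cswap phi); first exact: ctest_cswap.
rewrite (jet_cswap tphi) -tswapB nsq_tswap; first exact: hphi.
exact: sqtB sx (sqt_jet tphi).
Qed.

Definition SV (u : V) : V := toV (W0_tswap (VP u)).

Lemma cov1_tswap b x : cov1 b (tswap x) = cswap (cov2 b x).
Proof.
rewrite /cov1 /cov2 cswap_lin; congr (_ *: _ + _).
apply/funext => -[]; apply/funext => p; rewrite /potential1 /potential2 /cswap /mulc /=.
  by rewrite -[LHS]/(p.2 * - - x.1.1 false (mirror p)) -[RHS]/(- (p.2 * - x.1.1 false (mirror p))); ring.
by rewrite -[LHS]/(p.2 * x.1.1 true (mirror p)) -[RHS]/(- - (p.2 * x.1.1 true (mirror p))); ring.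
Qed.

Lemma cov2_tswap b x : cov2 b (tswap x) = cswap (cov1 b x).
Proof.
rewrite /cov1 /cov2 cswap_lin; congr (_ *: _ + _).
apply/funext => -[]; apply/funext => p; rewrite /potential1 /potential2 /cswap /mulc /=.
  by rewrite -[LHS]/(- (p.1 * - - x.1.1 false (mirror p))) -[RHS]/(p.1 * - x.1.1 false (mirror p)); ring.
by [].
Qed.

Lemma t1V_SV b (u : V) : t1V b (SV u) (SV u) = t2V b u u.
Proof.
rewrite /t1V /t2V /= cov1_tswap.
by have h := sqc_cov2 b (VP u).1; exact: (ipc_cswap h h).
Qed.
Lemma t2V_SV b (u : V) : t2V b (SV u) (SV u) = t1V b u u.
Proof.
rewrite /t1V /t2V /= cov2_tswap.
by have h := sqc_cov1 b (VP u).1; exact: (ipc_cswap h h).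
Qed.
Lemma mV_SV (u : V) : mV (SV u) (SV u) = mV u u.
Proof. by have [[h _ _] _] := VP u; exact: (ipc_cswap h h). Qed.

End Swap.

(** * The eigenvalue curve of the square *)

Section SquarePencil.
Context {R : realType}.
Local Notation V := (V R).
Local Notation mV := (@mV R).

Let mu : R := 2 * pi ^+ 2.
Let c : R := 1 / 4.

Lemma small_field (theta kappa m : R) : 0 < theta -> 0 < kappa -> 0 < m ->
  exists2 C : R, 0 < C & forall b, `|b| <= C ->
    2 * `|b| + b ^+ 2 <= theta /\ ((2 * `|b| + b ^+ 2) * (8 + 8 / kappa)) ^+ 2 * m < kappa.
Proof.
move=> t0 k0 m0; have [K KE] : exists K, K = 8 + 8 / kappa by eexists.
have K0 : 0 < K by rewrite KE addr_gt0 ?divr_gt0.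
have [D DE] : exists D, D = kappa / (2 * K ^+ 2 * m) by eexists.
have P0 : 0 < K ^+ 2 * m by rewrite mulr_gt0 ?exprn_gt0.
have D0 : 0 < D by rewrite DE divr_gt0// -mulrA mulr_gt0.
have DK : D * (K ^+ 2 * m) = kappa / 2.
  by rewrite DE; field; rewrite !gt_eqF.
have [s sE] : exists s, s = Num.min theta (Num.min 1 D) by eexists.
have s0 : 0 < s by rewrite sE !lt_min t0 ltr01.
have [st [s1 sD]] : s <= theta /\ (s <= 1 /\ s <= D).
  by rewrite sE !ge_min !lexx !orbT.
(* 2 |b| + b^2 <= 3 |b|, since s <= 1 *)
exists (s / 3); first by rewrite divr_gt0.
move=> b hb; rewrite -KE.
have b0 := normr_ge0 b.
have es : 2 * `|b| + b ^+ 2 <= s.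
  by rewrite -(real_normK (num_real b)); move: `|b| b0 hb => x x0 hx; nra.
have e0 : 0 <= 2 * `|b| + b ^+ 2 by rewrite addr_ge0 ?sqr_ge0// mulr_ge0.
split; first exact: le_trans es st.
move: (2 * `|b| + b ^+ 2) es e0 => e es e0.
rewrite exprMn -mulrA; apply: (@le_lt_trans _ _ (D * (K ^+ 2 * m))); last by rewrite DK; lra.
by rewrite ler_wpM2r ?(ltW P0)//; nra.
Qed.

Theorem square_pencil : exists2 C : R, 0 < C & forall b : R, `|b| <= C ->
  exists L : R -> R,
  [/\ forall a, `|a - 1| < pencil_delta mu c -> derivable L a 1,
      derivable (derive1 L) (1 : R) 1, derive1 L 1 = 0 & 0 < derive1n 2 L 1] /\
  forall a, `|a - 1| < pencil_delta mu c -> exists psi : V,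
    [/\ 0 < mV psi psi, forall v, pencil (t1V b) (t2V b) a psi v = L a * mV psi v &
        forall u, L a * mV u u <= pencil (t1V b) (t2V b) a u u].
Proof.
have mu0 : 0 < mu by rewrite mulr_gt0// exprn_gt0// pi_gt0.
have c0 : 0 < c by rewrite divr_gt0.
have th0 : 0 < pencil_theta0 mu c / 4.
  by rewrite divr_gt0// divr_gt0// mulr_gt0// addr_gt0// mulr_gt0.
have k0 : 0 < kappa0 mu c by rewrite divr_gt0// mulr_gt0// addr_gt0.
have [C C0 hC] := small_field th0 k0 mu0.
exists C => // b /hC[h1 h2].
have eps0 : 0 <= 2 * `|b| + b ^+ 2 by rewrite addr_ge0 ?sqr_ge0// mulr_ge0.
have d12 v : d1V (@wV R) v = d2V (@wV R) v by rewrite d1V_w d2V_w.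
exact: (pencil_regular (@unperturbed_square R) (@d1V_symbil R) (@d2V_symbil R) (@d1V_ge0 R) (@d2V_ge0 R) d12
  (t1V_symbil b) (t2V_symbil b) (preserves_t1V b) (preserves_t2V b) eps0 (t1V_near b) (t2V_near b)
  (t1V_SV b) (t2V_SV b) (@mV_SV R) h1 h2).
Qed.

End SquarePencil.

(** * Dilations between the square and the rectangle *)

Section Dilation.
Context {R : realType}.
Implicit Types (f : R * R -> R) (a : R).

Let is_derive_scale (h : R -> R) a x : derivable h (a * x) 1 ->
  is_derive x (1 : R) (h \o ( *%R a)) (a * 'D_1 h (a * x)).
Proof.
move=> dh; have h1 : is_derive x (1 : R) ( *%R a : R -> R) a.
  have -> : ( *%R a : R -> R) = a *: (@id R) by apply/funext => y.
  by apply: is_derive_eq; rewrite /GRing.scale /= mulr1.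
have := @is_derive1_comp _ h _ x _ _ (derivableP dh) h1.
by rewrite mulrC.
Qed.

Lemma is_derive_dilate1 a f p : derivable f (dilate a p) e1 ->
  is_derive p e1 (f \o dilate a) (a * 'D_e1 f (dilate a p)).
Proof.
rewrite derivable_slice1 derive_slice1 => d.
have [d1 d2] := @is_derive_scale (fun s => f (s, a^-1 * p.2)) a p.1 d.
by split; [rewrite derivable_slice1|rewrite derive_slice1].
Qed.

Lemma is_derive_dilate2 a f p : derivable f (dilate a p) e2 ->
  is_derive p e2 (f \o dilate a) (a^-1 * 'D_e2 f (dilate a p)).
Proof.
rewrite derivable_slice2 derive_slice2 => d.
have [d1 d2] := @is_derive_scale (fun s => f (a * p.1, s)) a^-1 p.2 d.
by split; [rewrite derivable_slice2|rewrite derive_slice2].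
Qed.

Lemma continuous_dilate a : continuous (dilate a : R * R -> R * R).
Proof.
move=> p; have h1 : (fun q : R * R => a * q.1) @ p --> a * p.1.
  by apply: cvgM; [exact: cvg_cst|exact: cvg_fst].
have h2 : (fun q : R * R => a^-1 * q.2) @ p --> a^-1 * p.2.
  by apply: cvgM; [exact: cvg_cst|exact: cvg_snd].
exact: cvg_pair h1 h2.
Qed.

Lemma smooth_dilate a f : smooth f -> smooth (f \o dilate a).
Proof.
move=> sf k; elim: k f {sf}(sf k) => [|k IH] f [cf hf]; split=> //.
- by move=> p; apply: continuous_comp; [exact: continuous_dilate|exact: cf].
- by move=> p; apply: continuous_comp; [exact: continuous_dilate|exact: cf].
case: hf => h1 h2 h3 h4.
have z (c : R) g : Ck k g -> Ck k (fun p => c * g p).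
  move=> cg; have := Ck_lin c cg (Ck_cst k 0); congr Ck.
  by apply/funext => p; rewrite addr0.
split.
- by move=> p; case: (is_derive_dilate1 (h1 (dilate a p))).
- by move=> p; case: (is_derive_dilate2 (h2 (dilate a p))).
- have -> : (fun p => 'D_e1 (f \o dilate a) p) = (fun p => a * ((fun p => 'D_e1 f p) \o dilate a) p).
    by apply/funext => p; case: (is_derive_dilate1 (h1 (dilate a p))).
  by apply: z; exact: IH.
- have -> : (fun p => 'D_e2 (f \o dilate a) p) = (fun p => a^-1 * ((fun p => 'D_e2 f p) \o dilate a) p).
    by apply/funext => p; case: (is_derive_dilate2 (h2 (dilate a p))).
  by apply: z; exact: IH.
Qed.

Lemma dilateK a : a != 0 -> cancel (dilate a) (dilate a^-1 : R * R -> R * R).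
Proof. by move=> a0 [x y]; rewrite /dilate /= invrK !mulrA mulVf// mulfV// !mul1r. Qed.
Lemma dilateKV a : a != 0 -> cancel (dilate a^-1) (dilate a : R * R -> R * R).
Proof. by move=> a0 [x y]; rewrite /dilate /= invrK !mulrA mulVf// mulfV// !mul1r. Qed.

Lemma dilate_rectangle a : 0 < a -> dilate a @^-1` rectangle a = sq1 :> set (plane R).
Proof.
move=> a0; have a1 : 0 < a^-1 by rewrite invr_gt0.
have e1 : a / 2 = a * (1 / 2) by rewrite mul1r.
have e2 : 1 / (2 * a) = a^-1 * (1 / 2) by rewrite invfM mul1r mulrC mul1r.
apply/seteqP; split=> -[x y]; rewrite /rectangle /sq1 /I12 /dilate /= !in_itv /= e1 e2 -!mulrN;
  by rewrite !ltr_pM2l.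
Qed.

Lemma dilate_sq1 a : 0 < a -> dilate a^-1 @^-1` sq1 = rectangle a :> set (plane R).
Proof.
move=> a0; rewrite -(dilate_rectangle a0).
by apply/seteqP; split=> p; rewrite /preimage /= dilateKV// gt_eqF.
Qed.

Lemma mrectangle a : 0 < a -> measurable (rectangle a : set (plane R)).
Proof. by move=> a0; rewrite -dilate_sq1//; exact: (mp_domain (@measurable_dilate R a^-1) msq1). Qed.

Lemma rtest_dilate a f : 0 < a -> rtest (rectangle a) f -> rtest sq1 (f \o dilate a).
Proof.
move=> a0; apply: (@rtest_comp _ _ _ (dilate a^-1) (dilate a)).
- exact: continuous_dilate.
- by apply: dilateK; rewrite gt_eqF.
- by move=> p; rewrite -(dilate_sq1 a0).
- exact: smooth_dilate.
Qed.
Lemma rtest_dilateV a f : 0 < a -> rtest sq1 f -> rtest (rectangle a) (f \o dilate a^-1).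
Proof.
move=> a0; apply: (@rtest_comp _ _ _ (dilate a) (dilate a^-1)).
- exact: continuous_dilate.
- by apply: dilateKV; rewrite gt_eqF.
- by move=> p; rewrite -(dilate_rectangle a0).
- exact: smooth_dilate.
Qed.

End Dilation.

Section Pullback.
Context {R : realType}.
Local Notation cfield := (cfield R).
Local Notation triple := (triple R).
Variable a : R.
Hypothesis a0 : 0 < a.
Implicit Types (u v : R * R -> R[i]) (f g : cfield).
Local Notation rect := (rectangle a).

Let an0 : a != 0. Proof. by rewrite gt_eqF. Qed.

Definition parts (u : R * R -> R[i]) : cfield := fun c p => if c then complex.Re (u p) else complex.Im (u p).
(** [pull] composes with the dilation, which preserves the measure: it is an
    isometry from L2 of the rectangle to L2 of the square, inverse to [push]. *)
Definition pull u : cfield := fun c p => parts u c (dilate a p).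
Definition push f : R * R -> R[i] := fun p => (f true (dilate a^-1 p) +i* f false (dilate a^-1 p))%C.

Lemma pullK f : pull (push f) = f.
Proof.
by apply/funext => -[]; apply/funext => p; rewrite /pull /push /= dilateK.
Qed.

Lemma sqi_rect (h : R * R -> R) : sqi (mu2 R) (rect : set (plane R)) h -> sq2 (h \o dilate a).
Proof.
by move=> sh; have := mp_sqi (@measurable_dilate R a) (mrectangle a0) (mu2_dilate a0) sh; rewrite (dilate_rectangle a0).
Qed.

Lemma sqi_rectV (h : R * R -> R) : sq2 (h \o dilate a) -> sqi (mu2 R) (rect : set (plane R)) h.
Proof.
have a1 : 0 < a^-1 by rewrite invr_gt0.
move=> sh; have := mp_sqi (@measurable_dilate R a^-1) msq1 (mu2_dilate a1) sh; rewrite (dilate_sq1 a0).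
by congr (sqi _ _ _); apply/funext => p; rewrite /= dilateKV.
Qed.

Lemma Rintegral_rect (h : R * R -> R) : measurable_fun (rect : set (plane R)) h ->
  Rintegral (mu2 R) rect h = Rintegral (mu2 R) sq1 (h \o dilate a).
Proof.
move=> mh; rewrite -(dilate_rectangle a0).
exact: (esym (mp_Rintegral (@measurable_dilate R a) (mrectangle a0) (mu2_dilate a0) mh)).
Qed.

Let mrect := mrectangle a0.

Lemma L2_sqi u : L2 rect u <-> forall c, sqi (mu2 R) (rect : set (plane R)) (parts u c).
Proof.
split=> [[m1 m2 fin]|h].
  have ms (c : bool) : measurable_fun (rect : set (plane R)) (parts u c) by case: c.
  move=> c; split; first exact: ms.
  apply: le_lt_trans fin; apply: ge0_le_integral => //.
  - by move=> p _; rewrite lee_fin sqr_ge0.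
  - by apply/measurable_EFinP; exact: measurable_funX.
  - by apply/measurable_EFinP; apply: measurable_funD; apply: measurable_funX; [exact: (ms true)|exact: (ms false)].
  - by move=> p _; rewrite lee_fin; case: c; rewrite /parts ?lerDl ?lerDr sqr_ge0.
split; [exact: (h true).1|exact: (h false).1|].
rewrite /L2sqnorm; under eq_integral do rewrite EFinD.
rewrite ge0_integralD//.
- by apply: lte_add_pinfty; [exact: (h true).2|exact: (h false).2].
- by move=> p _; rewrite lee_fin sqr_ge0.
- by apply/measurable_EFinP; apply: measurable_funX; exact: (h true).1.
- by move=> p _; rewrite lee_fin sqr_ge0.
- by apply/measurable_EFinP; apply: measurable_funX; exact: (h false).1.
Qed.

Lemma L2_pull u : L2 rect u <-> sqc (pull u).
Proof.
split=> [/L2_sqi h c|h]; first exact: sqi_rect (h c).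
by apply/L2_sqi => c; apply: sqi_rectV; exact: h.
Qed.

Lemma L2sqnorm_pull u : L2 rect u -> L2sqnorm rect u = (ipc (pull u) (pull u))%:E.
Proof.
move=> /L2_sqi h; rewrite /L2sqnorm; under eq_integral do rewrite EFinD.
have e c : (\int[mu2 R]_(p in rect) ((parts u c p) ^+ 2)%:E = (ip2 (pull u c) (pull u c))%:E)%E.
  rewrite (ip_sqr mrect (h c)); congr EFin.
  by rewrite /ip Rintegral_rect//; apply: measurable_funM; exact: (h c).1.
rewrite ge0_integralD//.
- by rewrite [X in (X + _)%E](e true) [X in (_ + X)%E](e false).
- by move=> p _; rewrite lee_fin sqr_ge0.
- by apply/measurable_EFinP; apply: measurable_funX; exact: (h true).1.
- by move=> p _; rewrite lee_fin sqr_ge0.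
- by apply/measurable_EFinP; apply: measurable_funX; exact: (h false).1.
Qed.

(** The imaginary part of the complex inner product is the real inner product
    with i v. *)
Lemma L2inner_pull u v : L2 rect u -> L2 rect v ->
  L2inner rect u v = (ipc (pull u) (pull v) +i* ipc (pull u) (imul (pull v)))%C.
Proof.
move=> lu lv; have hu := (L2_pull u).1 lu; have hv := (L2_pull v).1 lv.
have mU c := ((L2_sqi u).1 lu c).1; have mW c := ((L2_sqi v).1 lv c).1.
have I c c' : (mu2 R).-integrable (sq1 : set (plane R)) (EFin \o (fun p => pull u c p * pull v c' p)).
  exact: (sqi_mul msq1 (hu c) (hv c')).
rewrite /L2inner /cintegral; congr (_ +i* _)%C.
  have -> : (fun p => complex.Re (u p * (v p)^*%C)) = (fun p => parts u true p * parts v true p + parts u false p * parts v false p).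
    by apply/funext => p; rewrite /parts; case: (u p) (v p) => x y [z t] /=; ring.
  rewrite Rintegral_rect; first exact: (RintegralD msq1 (I true true) (I false false)).
  by apply: measurable_funD; apply: measurable_funM; first [exact: mU|exact: mW].
have -> : (fun p => complex.Im (u p * (v p)^*%C)) = (fun p => - (parts u true p * parts v false p) + parts u false p * parts v true p).
  by apply/funext => p; rewrite /parts; case: (u p) (v p) => x y [z t] /=; ring.
have J : (mu2 R).-integrable (sq1 : set (plane R)) (EFin \o (fun p => pull u true p * imul (pull v) true p)).
  exact: (sqi_mul msq1 (hu true) (sqc_imul hv true)).
rewrite Rintegral_rect.
  have -> : (fun p => - (parts u true p * parts v false p) + parts u false p * parts v true p) \o dilate a =
    (fun p => pull u true p * imul (pull v) true p + pull u false p * pull v true p).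
    by apply/funext => p; rewrite /imul /= mulrN.
  exact: (RintegralD msq1 J (I false true)).
by apply: measurable_funD; [apply: measurableT_comp => //|]; apply: measurable_funM; first [exact: mU|exact: mW].
Qed.

End Pullback.

(** * Weak gradients *)

Section WeakGradient.
Context {R : realType}.
Local Notation cfield := (cfield R).
Local Notation triple := (triple R).
Local Notation V := (V R).
Implicit Types (f g psi : cfield) (x : triple).

Lemma quadratic_discriminant (F X G : R) : 0 <= F -> (forall t : R, 0 <= t ^+ 2 * F + 2 * t * X + G) ->
  X ^+ 2 <= F * G.
Proof.
move=> F0 h; have [F00|Fn] := eqVneq F 0.
  have [->|Xn] := eqVneq X 0; first by rewrite F00 mul0r expr0n.
  have := h (- (G + 1) / (2 * X)); rewrite F00 mulr0 add0r.
  have -> : 2 * (- (G + 1) / (2 * X)) * X = - (G + 1) by field.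
  by move=> hh; exfalso; lra.
have Fp : 0 < F by rewrite lt_def Fn.
have := h (- X / F).
have -> : (- X / F) ^+ 2 * F + 2 * (- X / F) * X + G = (F * G - X ^+ 2) / F by field.
by rewrite pmulr_lge0 ?invr_gt0// subr_ge0.
Qed.

Lemma ipcZl (k : R) f g : sqc f -> sqc g -> ipc (k *: f) g = k * ipc f g.
Proof.
move=> sf sg; have z : ipc (0 : cfield) g = 0.
  by have := ipc_lin (-1) sg sg sg; rewrite scaleN1r addNr => ->; ring.
by have := ipc_lin k sf (@sqc0 R) sg; rewrite addr0 z addr0.
Qed.
Lemma ipcZr (k : R) f g : sqc f -> sqc g -> ipc f (k *: g) = k * ipc f g.
Proof. by move=> sf sg; rewrite ipcC ipcZl// ipcC. Qed.

Lemma ipc_cs f g : sqc f -> sqc g -> ipc f g ^+ 2 <= ipc f f * ipc g g.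
Proof.
move=> sf sg; apply: quadratic_discriminant; first exact: ipc_ge0.
move=> t; have s := sqc_lin t sf sg; have := ipc_ge0 (t *: f + g).
rewrite (ipc_lin t sf sg s) (ipcC f) (ipcC g) (ipc_lin t sf sg sf) (ipc_lin t sf sg sg).
by rewrite (ipcC g f); congr (0 <= _); ring.
Qed.

(** The form - l u l v is bounded, and nonnegative on test functions. *)
Lemma dense_functional_eq0 (l : V -> R) (M : R) : (forall (c : R) u v, l (c *: u + v) = c * l u + l v) ->
  0 <= M -> (forall u, l u ^+ 2 <= M * nV u u) ->
  (forall psi (h : ctest psi), l (jetV h) = 0) -> forall u, l u = 0.
Proof.
move=> ll M0 lM l0 u.
have S : symbil (fun u v => - (l u * l v)).
  by split=> [v w|c v w z]; [rewrite mulrC|rewrite ll; ring].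
have B : bounded_by (@nV R) (fun u v => - (l u * l v)) M.
  apply: (bounded_diag (@nV_symbil R) S M0 (@nV_ge0 R)) => v.
  by rewrite normrN -expr2 ger0_norm ?sqr_ge0.
have := dense_form_ge0 S B _ u; rewrite oppr_ge0 -expr2 => h.
apply/eqP; rewrite -sqrf_eq0 eq_le sqr_ge0 andbT; apply: h => psi tpsi.
by rewrite l0 mul0r oppr0.
Qed.

Let add4_eq0 (x1 x2 y1 y2 : R) : x1 + y1 = 0 -> x2 + y2 = 0 -> x1 + x2 + (y1 + y2) = 0.
Proof. by move=> h1 h2; rewrite addrACA h1 h2 addr0. Qed.

Let arith (A B m d k1 k2 : R) : A ^+ 2 <= m * k1 -> B ^+ 2 <= d * k2 -> 0 <= m -> 0 <= d -> 0 <= k1 -> 0 <= k2 ->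
  (A + B) ^+ 2 <= (2 * k1 + 2 * k2) * (m + d).
Proof. by move=> *; have := sqr_ge0 (A - B); nra. Qed.

Lemma W0_ibp1 x psi : W0 x -> ctest psi ->
  ipc x.1.1 (jet psi).1.2 = - ipc x.1.2 psi.
Proof.
move=> Wx tpsi; have [s0 s1 s2] := sqt_jet tpsi.
pose l (u : V) := ipc (vval u).1.1 (jet psi).1.2 + ipc (vval u).1.2 psi.
suff h : l (toV Wx) = 0 by apply/eqP; rewrite -addr_eq0; apply/eqP.
apply: (@dense_functional_eq0 l (2 * ipc (jet psi).1.2 (jet psi).1.2 + 2 * ipc psi psi)).
- move=> c u v; have [[u1 u2 _] _] := VP u; have [[v1 v2 _] _] := VP v.
  rewrite /l -[vval (c *: u + v)]/(c *: vval u + vval v) lin11 lin12.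
  by rewrite (ipc_lin c u1 v1 s1) (ipc_lin c u2 v2 s0); ring.
- by rewrite addr_ge0// mulr_ge0// ipc_ge0.
- move=> u; have [[u1 u2 u3] _] := VP u.
  have m0 := ipc_ge0 (vval u).1.1; have d0 := ipc_ge0 (vval u).1.2; have d20 := ipc_ge0 (vval u).2.
  apply: (@le_trans _ _ ((2 * ipc (jet psi).1.2 (jet psi).1.2 + 2 * ipc psi psi) *
     (ipc (vval u).1.1 (vval u).1.1 + ipc (vval u).1.2 (vval u).1.2))).
    exact: (arith (ipc_cs u1 s1) (ipc_cs u2 s0) m0 d0 (ipc_ge0 _) (ipc_ge0 _)).
  apply: ler_wpM2l; first by rewrite addr_ge0// mulr_ge0// ipc_ge0.
  by apply: lerD; rewrite // /dV lerDl; exact: d20.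
- move=> phi tphi; rewrite /l /ipc /=.
  have e c : ip2 (phi c) (fun p => 'D_e1 (psi c) p) + ip2 (fun p => 'D_e1 (phi c) p) (psi c) = 0.
    rewrite (ibp1 (smooth_C1 (tphi c).1) (smooth_C1 (tpsi c).1) (rtest_in_box (tpsi c))).
    exact: addNr.
  exact: (add4_eq0 (e true) (e false)).
Qed.

Lemma W0_ibp2 x psi : W0 x -> ctest psi ->
  ipc x.1.1 (jet psi).2 = - ipc x.2 psi.
Proof.
move=> Wx tpsi; have [s0 s1 s2] := sqt_jet tpsi.
pose l (u : V) := ipc (vval u).1.1 (jet psi).2 + ipc (vval u).2 psi.
suff h : l (toV Wx) = 0 by apply/eqP; rewrite -addr_eq0; apply/eqP.
apply: (@dense_functional_eq0 l (2 * ipc (jet psi).2 (jet psi).2 + 2 * ipc psi psi)).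
- move=> c u v; have [[u1 _ u2] _] := VP u; have [[v1 _ v2] _] := VP v.
  rewrite /l -[vval (c *: u + v)]/(c *: vval u + vval v) lin11 lin2.
  by rewrite (ipc_lin c u1 v1 s2) (ipc_lin c u2 v2 s0); ring.
- by rewrite addr_ge0// mulr_ge0// ipc_ge0.
- move=> u; have [[u1 u2 u3] _] := VP u.
  have m0 := ipc_ge0 (vval u).1.1; have d0 := ipc_ge0 (vval u).1.2; have d20 := ipc_ge0 (vval u).2.
  apply: (@le_trans _ _ ((2 * ipc (jet psi).2 (jet psi).2 + 2 * ipc psi psi) *
     (ipc (vval u).1.1 (vval u).1.1 + ipc (vval u).2 (vval u).2))).
    exact: (arith (ipc_cs u1 s2) (ipc_cs u3 s0) m0 d20 (ipc_ge0 _) (ipc_ge0 _)).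
  apply: ler_wpM2l; first by rewrite addr_ge0// mulr_ge0// ipc_ge0.
  by apply: lerD; rewrite // /dV lerDr; exact: d0.
- move=> phi tphi; rewrite /l /ipc /=.
  have e c : ip2 (phi c) (fun p => 'D_e2 (psi c) p) + ip2 (fun p => 'D_e2 (phi c) p) (psi c) = 0.
    rewrite (ibp2 (smooth_C1 (tphi c).1) (smooth_C1 (tpsi c).1) (rtest_in_box (tpsi c))).
    exact: addNr.
  exact: (add4_eq0 (e true) (e false)).
Qed.

End WeakGradient.

(** * The Sobolev space of the rectangle *)

Section Transport.
Context {R : realType}.
Local Notation cfield := (cfield R).
Local Notation triple := (triple R).
Local Notation V := (V R).
Variable a : R.
Hypothesis a0 : 0 < a.
Implicit Types (u v g phi : R * R -> R[i]) (f : cfield).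
Local Notation rect := (rectangle a).
Local Notation pulla := (pull a).
Local Notation push := (push a).

Let an0 : a != 0. Proof. by rewrite gt_eqF. Qed.

(** The factors on the gradient come from the chain rule. *)
Definition tpull u g1 g2 : triple := (pulla u, a *: pulla g1, a^-1 *: pulla g2).

Lemma pullB u v : pulla (fun p => u p - v p) = pulla u - pulla v.
Proof.
apply/funext => c; apply/funext => p; rewrite /pull /parts.
rewrite -[RHS]/((if c then complex.Re (u (dilate a p)) else complex.Im (u (dilate a p))) -
  (if c then complex.Re (v (dilate a p)) else complex.Im (v (dilate a p)))).
by case: c; case: (u _) (v _) => x y [z t].
Qed.

Lemma ctest_pull phi : test_function rect phi -> ctest (pulla phi).
Proof. by move=> /test_functionP[h1 h2] []; [exact: rtest_dilate a0 h1|exact: rtest_dilate a0 h2]. Qed.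

Lemma test_push f : ctest f -> test_function rect (push f).
Proof.
move=> h; apply/test_functionP; split.
  exact: rtest_dilateV a0 (h true).
exact: rtest_dilateV a0 (h false).
Qed.

Lemma test_conj phi : test_function rect phi -> test_function rect (fun p => (phi p)^*%C).
Proof.
move=> /test_functionP[h1 h2]; apply/test_functionP; split.
  by have := h1; congr rtest; apply/funext => p; case: (phi p).
by have := rtestN h2; congr rtest; apply/funext => p; case: (phi p).
Qed.

Lemma jet_pull phi : test_function rect phi ->
  jet (pulla phi) = tpull phi (partial e1 phi) (partial e2 phi).
Proof.
move=> /test_functionP[[s1 _] [s2 _]].
have [_ d11 d12 _ _] := smooth_C1 s1; have [_ d21 d22 _ _] := smooth_C1 s2.
rewrite /jet /tpull; congr (_, _, _); apply/funext => -[]; apply/funext => p.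
- by case: (is_derive_dilate1 (d11 (dilate a p))).
- by case: (is_derive_dilate1 (d21 (dilate a p))).
- by case: (is_derive_dilate2 (d12 (dilate a p))).
- by case: (is_derive_dilate2 (d22 (dilate a p))).
Qed.

Lemma tpullB u g1 g2 v h1 h2 : tpull (fun p => u p - v p) (fun p => g1 p - h1 p) (fun p => g2 p - h2 p) =
  tpull u g1 g2 - tpull v h1 h2.
Proof. by rewrite /tpull !pullB !scalerBr. Qed.

Lemma sqc_Z (k : R) f : sqc f -> sqc (k *: f).
Proof. by move=> sf; have := sqc_lin k sf (@sqc0 R); rewrite addr0. Qed.

Lemma sqt_tpull u g1 g2 : L2 rect u -> L2 rect g1 -> L2 rect g2 -> sqt (tpull u g1 g2).
Proof.
move=> /(L2_pull a0) h /(L2_pull a0) h1 /(L2_pull a0) h2; split => //; exact: sqc_Z.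
Qed.

Lemma tpull_L2 u g1 g2 : sqt (tpull u g1 g2) -> [/\ L2 rect u, L2 rect g1 & L2 rect g2].
Proof.
move=> [h h1 h2]; split; apply/(L2_pull a0) => //.
  by have := sqc_Z a^-1 h1; rewrite scalerA mulVf// scale1r.
by have := sqc_Z a h2; rewrite scalerA mulfV// scale1r.
Qed.

(** The squared Sobolev norms before and after dilation are comparable with this
    constant. *)
Definition distortion : R := 1 + a ^+ 2 + a^-1 ^+ 2.

Lemma W12sqnorm_pull u g1 g2 : L2 rect u -> L2 rect g1 -> L2 rect g2 ->
  W12sqnorm rect u g1 g2 =
  (ipc (pulla u) (pulla u) + ipc (pulla g1) (pulla g1) + ipc (pulla g2) (pulla g2))%:E.
Proof. by move=> h h1 h2; rewrite /W12sqnorm !(L2sqnorm_pull a0)// !EFinD. Qed.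

Lemma nsq_tpull u g1 g2 : L2 rect u -> L2 rect g1 -> L2 rect g2 ->
  nsq (tpull u g1 g2) = ipc (pulla u) (pulla u) +
    (a ^+ 2 * ipc (pulla g1) (pulla g1) + a^-1 ^+ 2 * ipc (pulla g2) (pulla g2)).
Proof.
move=> /(L2_pull a0) h /(L2_pull a0) h1 /(L2_pull a0) h2; rewrite /nsq /=.
have z (k : R) f : sqc f -> ipc (k *: f) (k *: f) = k ^+ 2 * ipc f f.
  by move=> sf; rewrite (ipcZl k sf (sqc_Z k sf)) (ipcZr k sf sf) mulrA expr2.
by rewrite (z a _ h1) (z a^-1 _ h2).
Qed.

Let nsq_le_arith (A B C s t : R) : 0 <= A -> 0 <= B -> 0 <= C -> 0 <= s -> 0 <= t ->
  A + (s * B + t * C) <= (1 + s + t) * (A + B + C).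
Proof. by move=> *; nra. Qed.
Let le_nsq_arith (A B C s t : R) : 0 <= A -> 0 <= B -> 0 <= C -> 0 <= s -> 0 <= t -> s * t = 1 ->
  A + B + C <= (1 + s + t) * (A + (s * B + t * C)).
Proof.
move=> A0 B0 C0 s0 t0 st.
have h1 : t * (s * B) = B by rewrite mulrA (mulrC t) st mul1r.
have h2 : s * (t * C) = C by rewrite mulrA st mul1r.
have : 0 <= s * B by exact: mulr_ge0. have : 0 <= t * C by exact: mulr_ge0.
move: (s * B) (t * C) h1 h2 => X Y h1 h2 Y0 X0.
have p1 := mulr_ge0 s0 A0; have p2 := mulr_ge0 t0 A0; have p3 := mulr_ge0 s0 X0; have p4 := mulr_ge0 t0 Y0.
by rewrite !mulrDr !mulrDl h1 h2 !mul1r; lra.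
Qed.

Let distortion_gt0 : 0 < distortion.
Proof. by rewrite /distortion -addrA ltr_wpDr// addr_ge0 ?sqr_ge0. Qed.

Lemma L2B u v : L2 rect u -> L2 rect v -> L2 rect (fun p => u p - v p).
Proof.
move=> /(L2_pull a0) hu /(L2_pull a0) hv; apply/(L2_pull a0); rewrite pullB; exact: sqcB.
Qed.

Lemma L2_test phi : test_function rect phi ->
  [/\ L2 rect phi, L2 rect (partial e1 phi) & L2 rect (partial e2 phi)].
Proof. by move=> h; apply: tpull_L2; rewrite -(jet_pull h); exact: sqt_jet (ctest_pull h). Qed.

Lemma W012_pull u g1 g2 : W012 rect u g1 g2 -> W0 (tpull u g1 g2).
Proof.
move=> [[hu h1 h2 _ _] approx]; split; first exact: sqt_tpull.
move=> e e0; have [phi tphi hphi] := approx _ (divr_gt0 e0 distortion_gt0).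
exists (pulla phi); first exact: ctest_pull.
have [lp lp1 lp2] := L2_test tphi.
have lu := L2B hu lp; have lu1 := L2B h1 lp1; have lu2 := L2B h2 lp2.
rewrite (jet_pull tphi) -tpullB (nsq_tpull lu lu1 lu2).
move: hphi; rewrite (W12sqnorm_pull lu lu1 lu2) lte_fin ltr_pdivlMr// mulrC => hphi.
apply: le_lt_trans hphi; apply: nsq_le_arith; rewrite ?ipc_ge0 ?sqr_ge0//.
Qed.

(** Both directions at once: D is the derivative on the square and k its factor
    in the chain rule. The real identity applied to psi and to i psi yields the
    real and the imaginary part of the complex one. *)
Let weak (psi : R * R -> R[i]) (e : R * R) (k : R) u g (D : cfield -> cfield) :
  k != 0 -> L2 rect u -> L2 rect g -> test_function rect psi -> L2 rect (partial e psi) ->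
  k *: pulla (partial e psi) = D (pulla psi) -> D (imul (pulla psi)) = imul (D (pulla psi)) ->
  (forall f, ctest f -> ipc (pulla u) (D f) = - ipc (k *: pulla g) f) ->
  L2inner rect u (partial e psi) = - L2inner rect g psi.
Proof.
move=> k0 lu lg tpsi lpp kD DJ ibp; have [lp _ _] := L2_test tpsi.
have hu := (L2_pull a0 u).1 lu; have hg := (L2_pull a0 g).1 lg.
have hp := (L2_pull a0 psi).1 lp; have hpp := (L2_pull a0 (partial e psi)).1 lpp.
rewrite (L2inner_pull a0 lu lpp) (L2inner_pull a0 lg lp).
have e1 : ipc (pulla u) (pulla (partial e psi)) = - ipc (pulla g) (pulla psi).
  apply: (mulfI k0); rewrite -(ipcZr k hu hpp) kD (ibp _ (ctest_pull tpsi)).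
  by rewrite (ipcZl k hg hp) mulrN.
have e2 : ipc (pulla u) (imul (pulla (partial e psi))) = - ipc (pulla g) (imul (pulla psi)).
  apply: (mulfI k0); rewrite -(ipcZr k hu (sqc_imul hpp)).
  have -> : k *: imul (pulla (partial e psi)) = D (imul (pulla psi)).
    rewrite DJ -kD; have := imul_lin k (pulla (partial e psi)) 0.
    have -> : imul (0 : cfield) = 0 by apply/funext => -[]; apply/funext => p //=; rewrite oppr0.
    by rewrite !addr0.
  by rewrite (ibp _ (ctest_imul (ctest_pull tpsi))) (ipcZl k hg (sqc_imul hp)) mulrN.
by rewrite e1 e2.
Qed.

Let partial_conj e phi : test_function rect phi -> (forall p, derivable (fun p => complex.Im (phi p)) p e) ->
  partial e (fun p => (phi p)^*%C) = (fun p => (partial e phi p)^*%C).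
Proof.
move=> _ d; apply/funext => p; rewrite /partial /=; congr (_ +i* _)%C.
  by congr ('D_e _ p); apply/funext => q; case: (phi q).
have -> : (fun q => complex.Im ((phi q)^*%C)) = - (fun q => complex.Im (phi q)).
  by apply/funext => q; rewrite -[RHS]/(- complex.Im (phi q)); case: (phi q).
by rewrite deriveN.
Qed.

Let cint_L2inner u v : cintegral rect (fun p => u p * v p) = L2inner rect u (fun p => (v p)^*%C).
Proof. by rewrite /L2inner; congr cintegral; apply/funext => p; congr (_ * _); case: (v p) => x y; rewrite -[RHS]/(x +i* (- - y))%C opprK. Qed.

Lemma pull_W012 u g1 g2 : W0 (tpull u g1 g2) -> W012 rect u g1 g2.
Proof.
move=> Wx; have [sx hx] := Wx; have [lu l1 l2] := tpull_L2 sx; split; last first.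
  move=> e e0; have [f tf hf] := hx _ (divr_gt0 e0 distortion_gt0).
  exists (push f); first exact: test_push.
  have tphi := test_push tf; have [lp lp1 lp2] := L2_test tphi.
  have su := L2B lu lp; have su1 := L2B l1 lp1; have su2 := L2B l2 lp2.
  rewrite (W12sqnorm_pull su su1 su2) lte_fin.
  have fE : f = pulla (push f) by rewrite pullK.
  move: hf; rewrite [in nsq _]fE (jet_pull tphi) -tpullB (nsq_tpull su su1 su2).
  rewrite ltr_pdivlMr// mulrC => hf; apply: le_lt_trans hf.
  apply: le_nsq_arith; rewrite ?ipc_ge0 ?sqr_ge0//.
  by rewrite -exprMn mulfV// expr1n.
split=> // phi tphi; rewrite !cint_L2inner; have tc := test_conj tphi.
- have [_ [si _]] := (test_functionP _ _).1 tphi; have [_ d1 d2 _ _] := smooth_C1 si.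
  rewrite -(partial_conj tphi d1).
  have [_ lc _] := L2_test tc.
  have J := jet_pull tc; have JJ := jet_imul (ctest_pull tc).
  apply: (weak (k := a) (D := fun f => (jet f).1.2)) => //.
  + by rewrite J.
  + by rewrite JJ.
  + by move=> f tf; rewrite (W0_ibp1 Wx tf).
- have [_ [si _]] := (test_functionP _ _).1 tphi; have [_ d1 d2 _ _] := smooth_C1 si.
  rewrite -(partial_conj tphi d2).
  have [_ _ lc] := L2_test tc.
  have J := jet_pull tc; have JJ := jet_imul (ctest_pull tc).
  apply: (weak (k := a^-1) (D := fun f => (jet f).2)) => //.
  + by rewrite invr_neq0.
  + by rewrite J.
  + by rewrite JJ.
  + by move=> f tf; rewrite (W0_ibp2 Wx tf).
Qed.

End Transport.

(** * The magnetic form of the rectangle *)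

Lemma ae_eq0_equiv d (X : measurableType d) (R : realType) (mu : {measure set X -> \bar R})
  (D : set X) (F : X -> \bar R) (P : X -> Prop) : (forall x, F x = 0%E <-> P x) ->
  ae_eq mu D F (cst 0%E) <-> {ae mu, forall x, D x -> P x}.
Proof. by move=> FP; split; apply: filterS => x hx Dx; apply/FP; exact: hx. Qed.

Section Eigenvalues.
Context {R : realType}.
Local Notation cfield := (cfield R).
Local Notation triple := (triple R).
Local Notation V := (V R).
Local Notation mV := (@mV R).
Variables (a B : R).
Hypothesis a0 : 0 < a.
Implicit Types (u v g : R * R -> R[i]) (f : cfield).
Local Notation rect := (rectangle a).
Local Notation A := (constant_field_potential B).
Local Notation b := (B / 2).
Local Notation pulla := (pull a).


Let an0 : a != 0. Proof. by rewrite gt_eqF. Qed.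

Let sub_i_mul (z t r x y : R) :
  ((z +i* t) - 'i * r%:C * (x +i* y) = (z + r * y) +i* (t - r * x))%C.
Proof.
rewrite -[LHS]/((z - ((0 * r - 1 * 0) * x - (0 * 0 + 1 * r) * y)) +i*
  (t - ((0 * r - 1 * 0) * y + (0 * 0 + 1 * r) * x)))%C.
by congr (_ +i* _)%C; ring.
Qed.

Lemma pull_covariant1 u g1 g2 : pulla (covariant1 A u g1) = a^-1 *: cov1 b (tpull a u g1 g2).
Proof.
apply/funext => c; apply/funext => p.
rewrite /pull /parts /covariant1.
rewrite -[RHS]/(a^-1 * (b * (p.2 * imul (pulla u) c p) + a * pulla g1 c p)) mulrDr mulKf//.
rewrite /imul /pull /parts.
case: (u (dilate a p)) (g1 (dilate a p)) => x y [z t]; rewrite sub_i_mul.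
by case: c => /=; ring.
Qed.

Lemma pull_covariant2 u g1 g2 : pulla (covariant2 A u g2) = a *: cov2 b (tpull a u g1 g2).
Proof.
apply/funext => c; apply/funext => p.
rewrite /pull /parts /covariant2.
rewrite -[RHS]/(a * (b * - (p.1 * imul (pulla u) c p) + a^-1 * pulla g2 c p)) mulrDr mulVKf//.
rewrite /imul /pull /parts.
case: (u (dilate a p)) (g2 (dilate a p)) => x y [z t]; rewrite sub_i_mul.
by case: c => /=; ring.
Qed.

(** The potential is linear, so that dilation multiplies it by the inverse of
    the factor of the corresponding derivative, and each covariant derivative
    is multiplied as a whole. Replacing v by i v gives the imaginary part. *)
Lemma magnetic_form_pull u g1 g2 v h1 h2 (Wu : W0 (tpull a u g1 g2)) (Wv : W0 (tpull a v h1 h2)) :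
  magnetic_form A rect u g1 g2 v h1 h2 =
  (pencil (t1V b) (t2V b) a (toV Wu) (toV Wv) +i* pencil (t1V b) (t2V b) a (toV Wu) (JV (toV Wv)))%C.
Proof.
have su1 := sqc_cov1 b Wu.1; have sv1 := sqc_cov1 b Wv.1.
have su2 := sqc_cov2 b Wu.1; have sv2 := sqc_cov2 b Wv.1.
have L1 w k1 k2 : sqc (cov1 b (tpull a w k1 k2)) -> L2 rect (covariant1 A w k1).
  by move=> s; apply/(L2_pull a0); rewrite (pull_covariant1 w k1 k2); exact: sqc_Z.
have L2' w k1 k2 : sqc (cov2 b (tpull a w k1 k2)) -> L2 rect (covariant2 A w k2).
  by move=> s; apply/(L2_pull a0); rewrite (pull_covariant2 w k1 k2); exact: sqc_Z.
have imulZ (k : R) f : imul (k *: f) = k *: imul f.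
  have := imul_lin k f 0; have -> : imul (0 : cfield) = 0.
    by apply/funext => -[]; apply/funext => p //=; rewrite oppr0.
  by rewrite !addr0.
have sc (k : R) f f' : sqc f -> sqc f' -> ipc (k *: f) (k *: f') = k ^+ 2 * ipc f f'.
  by move=> sf sf'; rewrite (ipcZl k sf (sqc_Z k sf')) (ipcZr k sf sf') mulrA expr2.
rewrite /magnetic_form (L2inner_pull a0 (L1 _ _ _ su1) (L1 _ _ _ sv1)).
rewrite (L2inner_pull a0 (L2' _ _ _ su2) (L2' _ _ _ sv2)).
rewrite (pull_covariant1 u g1 g2) (pull_covariant1 v h1 h2) (pull_covariant2 u g1 g2) (pull_covariant2 v h1 h2).
rewrite !imulZ (sc a^-1 _ _ su1 sv1) (sc a^-1 _ _ su1 (sqc_imul sv1)).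
rewrite (sc a _ _ su2 sv2) (sc a _ _ su2 (sqc_imul sv2)) exprVn.
by rewrite /pencil /t1V /t2V JVE cov1_imult cov2_imult.
Qed.

Lemma pull_scale (lambda : R) u : pulla (fun p => lambda%:C%C * u p) = lambda *: pulla u.
Proof.
apply/funext => c; apply/funext => p; rewrite -[RHS]/(lambda * pulla u c p) /pull /parts.
by case: c; case: (u _) => x y /=; ring.
Qed.

Lemma L2inner_scale_pull lambda u g1 g2 v h1 h2 (Wu : W0 (tpull a u g1 g2)) (Wv : W0 (tpull a v h1 h2)) :
  L2inner rect (fun p => lambda%:C%C * u p) v =
  (lambda * mV (toV Wu) (toV Wv) +i* (lambda * mV (toV Wu) (JV (toV Wv))))%C.
Proof.
have [su _ _] := Wu.1; have [sv _ _] := Wv.1.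
have lu : L2 rect (fun p => lambda%:C%C * u p).
  by apply/(L2_pull a0); rewrite pull_scale; exact: sqc_Z su.
have lv : L2 rect v by apply/(L2_pull a0).
rewrite (L2inner_pull a0 lu lv) pull_scale (ipcZl lambda su sv) (ipcZl lambda su (sqc_imul sv)).
by [].
Qed.

Lemma mass_eq0 u g1 g2 (Wu : W0 (tpull a u g1 g2)) :
  {ae mu2 R, forall p, rect p -> u p = 0} <-> mV (toV Wu) (toV Wu) = 0.
Proof.
have [su _ _] := Wu.1; have lu := (L2_pull a0 u).2 su.
have hs := (L2_sqi a0 u).1 lu; have mrect := mrectangle a0.
pose F := fun p => ((complex.Re (u p)) ^+ 2 + (complex.Im (u p)) ^+ 2)%:E.
have F0 p : (0 <= F p)%E by rewrite lee_fin addr_ge0 ?sqr_ge0.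
have mF : measurable_fun (rect : set (plane R)) F.
  apply/measurable_EFinP; apply: measurable_funD; apply: measurable_funX;
    [exact: (hs true).1|exact: (hs false).1].
have e : (\int[mu2 R]_(p in rect) `|F p| = (mV (toV Wu) (toV Wu))%:E)%E.
  rewrite -(L2sqnorm_pull a0 lu); apply: eq_integral => p _; exact: gee0_abs.
have Fu p : F p = 0%E <-> u p = 0.
  rewrite /F; case: (u p) => x y /=; split=> [[] /eqP|[-> ->]].
    by rewrite paddr_eq0 ?sqr_ge0// !sqrf_eq0 => /andP[/eqP -> /eqP ->].
  by rewrite expr0n addr0.
have P := ae_eq_integral_abs (mu2 R) mrect mF.
have Q := @ae_eq0_equiv _ _ _ (mu2 R) rect F (fun p => u p = 0) Fu.
split=> h.
  have /P : ae_eq (mu2 R) rect F (cst 0%E) by exact/Q.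
  by rewrite e => -[].
have : (\int[mu2 R]_(p in rect) `|F p| = 0)%E by rewrite e h.
by move=> /P; exact: Q.1.
Qed.

End Eigenvalues.

(** * The lowest eigenvalue of the rectangle *)

Section Lowest.
Context {R : realType}.
Local Notation V := (V R).
Local Notation mV := (@mV R).

(** Real and imaginary part of the eigenvalue equation are the equation on the
    square tested with v and J v. Testing any eigenfunction with itself bounds
    its eigenvalue from below by l. *)
Lemma lowest_of_pencil (a B l : R) (psi : V) : 0 < a -> 0 < mV psi psi ->
  (forall v, pencil (t1V (B / 2)) (t2V (B / 2)) a psi v = l * mV psi v) ->
  (forall u : V, l * mV u u <= pencil (t1V (B / 2)) (t2V (B / 2)) a u u) ->
  lowest_magnetic_eigenvalue (constant_field_potential B) (rectangle a) l.
Proof.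
move=> a0 psi0 hpsi hmin; have an0 : a != 0 by rewrite gt_eqF.
pose u := push a (vval psi).1.1.
pose g1 := push a (a^-1 *: (vval psi).1.2).
pose g2 := push a (a *: (vval psi).2).
have uE : tpull a u g1 g2 = vval psi.
  rewrite /tpull !pullK// !scalerA mulfV// mulVf// !scale1r.
  by case: (vval psi) => -[].
have Wu : W0 (tpull a u g1 g2) by rewrite uE; exact: VP.
have toVu : toV Wu = psi by apply: val_inj.
split.
  exists u; split; last by move=> /(mass_eq0 a0 Wu); rewrite toVu => h; rewrite h ltxx in psi0.
  split.
    apply/(L2_pull a0); rewrite pull_scale; apply: sqc_Z; by case: (Wu.1).
  exists g1, g2; split; first exact: pull_W012.
  move=> v h1 h2 /(W012_pull a0) Wv.
  by rewrite (magnetic_form_pull B a0 Wu Wv) (L2inner_scale_pull a0 l Wu Wv) toVu !hpsi.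
move=> nu [v [[_ [h1 [h2 [/[dup] W /(W012_pull a0) Wv hv]]]] vn]].
have := hv v h1 h2 W; rewrite (magnetic_form_pull B a0 Wv Wv) (L2inner_scale_pull a0 nu Wv Wv).
move=> [e _]; have := hmin (toV Wv); rewrite e.
rewrite ler_pM2r// lt_def mV_ge0 andbT; apply/eqP => /(mass_eq0 a0 Wv).
exact: vn.
Qed.

Lemma lambda1_eq (B a l : R) :
  lowest_magnetic_eigenvalue (constant_field_potential B) (rectangle a) l -> lambda1 B a = l.
Proof.
move=> [el ml]; rewrite /lambda1; case: xgetP => [x _ [ex mx]|/(_ l) h].
  by apply/eqP; rewrite eq_le mx// ml.
by exfalso; apply: h; split.
Qed.

(** Derivatives at a point depend on the germ only, but the second one involves
    the first at neighbouring points. *)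
Lemma germ_regular (f g : R -> R) (delta : R) : 0 < delta ->
  (forall a : R, `|a - 1| < delta -> f a = g a) ->
  [/\ forall a : R, `|a - 1| < delta -> derivable g a 1,
      derivable (derive1 g) (1 : R) 1, derive1 g 1 = 0 & 0 < derive1n 2 g 1] ->
  (\forall a \near (1 : R), derivable f a 1) /\ derivable (derive1 f) (1 : R) 1 /\
  derive1 f 1 = 0 /\ 0 < derive1n 2 f 1.
Proof.
move=> d0 fg [dg dg1 g1 g2].
have nb (a : R) : `|a - 1| < delta -> \forall x \near a, `|x - 1| < delta.
  move=> ha; have h0 : 0 < delta - `|a - 1| by rewrite subr_gt0.
  near=> x; have : `|a - x| < delta - `|a - 1|.
    by near: x; exact: cvgr_dist_lt.
  rewrite (distrC a) => hx; have := ler_normD (x - a) (a - 1); rewrite subrKA => h.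
  by apply: (le_lt_trans h); rewrite -ltrBrDr.
have nfg (a : R) : `|a - 1| < delta -> \forall x \near a, g x = f x.
  by move=> /nb; apply: filterS => x /fg.
have one : `|1 - 1| < delta by rewrite subrr normr0.
have e1 (a : R) : `|a - 1| < delta -> derive1 g a = derive1 f a.
  by move=> ha; rewrite !derive1E; apply: near_eq_derive; exact: nfg.
have n1 : \forall x \near (1 : R), derive1 g x = derive1 f x.
  by have := nb 1 one; apply: filterS => x /e1.
split.
  have := nb 1 one; apply: filterS => x hx.
  by apply: near_eq_derivable (dg x hx); exact: nfg.
split; first by apply: near_eq_derivable dg1; exact: n1.
split; first by rewrite -e1.
move: g2; rewrite !derive1nS /= !derive1E.
by rewrite (near_eq_derive _ n1).
Unshelve. all: by end_near. Qed.

End Lowest.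

Theorem theorem3 (R : realType) :
  exists C : R, 0 < C /\
    forall B : R, `|B| <= C ->
      (\forall a \near (1 : R), derivable (lambda1 B) a 1) /\
      derivable (derive1 (lambda1 B)) (1 : R) 1 /\
      derive1 (lambda1 B) 1 = 0 /\
      0 < derive1n 2 (lambda1 B) 1.
Proof.
have [C C0 hC] := @square_pencil R; exists (2 * C); split; first by rewrite mulr_gt0.
move=> B hB; have [|L [reg eig]] := hC (B / 2).
  by rewrite normrM (ger0_norm (_ : 0 <= 2^-1)) ?invr_ge0// ler_pdivrMr// mulrC.
apply: germ_regular reg; first by exact: pencil_delta_gt0 (@unperturbed_square R).
move=> a ha; have [psi [psi0 hpsi hmin]] := eig a ha.
apply: lambda1_eq; apply: lowest_of_pencil psi0 hpsi hmin.
have : `|a - 1| < 1 / 2 by apply: lt_le_trans ha _; rewrite ge_min lexx.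
by rewrite ltr_norml => /andP[h _]; lra.
Qed.
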